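(* Let $\{\varepsilon_i : i \in \mathbb{Z}\}$ be independent and identically distributed real random variables on a probability space $(\Omega,\mathcal{F},\mathbb{P})$ with $\mathbb{E}\varepsilon_i = 0$ and finite variance $\sigma_\varepsilon^2$, having a common bounded probability density $f_\varepsilon$. Let $\{a_i\}_{i\ge 0}$ be real coefficients with $\sum_{i=0}^\infty |a_i| < \infty$ and $\sum_{i=0}^\infty a_i \neq 0$ (short memory), and let $X_n = \sum_{i=0}^\infty a_i \varepsilon_{n-i}$, $n \in \mathbb{N}$, be the one-sided linear process, with common marginal probability density $f$. Assume the Shannon entropy $S(f) = -\int_{\mathbb{R}} f(x)\log f(x)\,dx$ is finite. Let $K:\mathbb{R}\to\mathbb{R}$ be a kernel with $\int_{\mathbb{R}} K(u)\,du = 1$, let $\{h_n\}$ be positive bandwidths, and let $f_n(x) = \frac{1}{nh_n}\sum_{i=1}^n K\big(\frac{x-X_i}{h_n}\big)$ be the kernel density estimator. Assume: (B.1) $h_n \asymp (n^{-1}\log n)^{1/5}$; (K.1) $K$ is bounded, has bounded support, and is Hölder continuous of some order $\iota \in (0,1]$; (K.2) $\int u K(u)\,du = 0$; (D.1) $f_\varepsilon, f_\varepsilon', f_\varepsilon''$ are bounded (belong to $\mathcal{L}^\infty(\mathbb{R})$); (D.2) $f_\varepsilon, f_\varepsilon', f_\varepsilon'' \in \mathcal{L}^2(\mathbb{R})$; (D.3) $f''$ is bounded. Let $\{\gamma_n\}$ be a sequence of positive reals with $\gamma_n \to 0$ and $h_n = o(\gamma_n)$. Define the random sets $A_n = \{x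 \in \mathbb{R} : 0 < \gamma_n \le f_n(x)\}$ and the estimator $S_n(f) = -\int_{A_n} f_n(x)\log f_n(x)\,dx$. Then, almost surely, $$\limsup_{n\to\infty} \Big(\frac{n\gamma_n^5}{\log n}\Big)^{2/5}\,\Big| S_n(f) - \int_{A_n} \big(-\log f(x)\big) f(x)\,dx\Big| < \infty.$$
   Context: $a_n \asymp b_n$ means $0<\liminf a_n/b_n \le \limsup a_n/b_n<\infty$. Hölder continuity of order $\iota$ means there is $C$ with $|K(x)-K(x')|\le C|x-x'|^\iota$ for all $x,x'$. *)

(* Defs.v *)
From HB Require Import structures.
From mathcomp Require Import all_boot all_order all_algebra.
From mathcomp Require Import all_classical all_reals all_analysis.
Set Implicit Arguments. Unset Strict Implicit. Unset Printing Implicit Defensive.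
Import Order.TTheory GRing.Theory Num.Theory.
Import numFieldNormedType.Exports.
Local Open Scope classical_set_scope.
Local Open Scope ring_scope.

Definition mutually_independent {d} {T : measurableType d} {R : realType}
  (P : probability T R) (I : eqType) (X : I -> T -> R) : Prop :=
  forall (s : seq I) (B : I -> set R), uniq s ->
    (forall i, measurable (B i)) ->
    P (\bigcap_(i in [set` s]) (X i @^-1` B i)) =
    (\prod_(i <- s) P (X i @^-1` B i))%E.

Definition has_density {d} {T : measurableType d} {R : realType}
  (P : probability T R) (Y : T -> R) (g : R -> R) : Prop :=
  forall A : set R, measurable A ->
    P (Y @^-1` A) = (\int[lebesgue_measure]_(x in A) (g x)%:E)%E.

Definition asymp {R : realType} (a b : nat -> R) : Prop :=
  (0 < limn_einf (fun n => (a n / b n)%:E))%E /\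
  (limn_einf (fun n => (a n / b n)%:E) <= limn_esup (fun n => (a n / b n)%:E))%E /\
  (limn_esup (fun n => (a n / b n)%:E) < +oo)%E.

Definition bounded_real {R : realType} (g : R -> R) : Prop :=
  exists M : R, forall x, `|g x| <= M.

Definition linear_process {T : Type} {R : realType} (a : nat -> R)
  (eps : int -> T -> R) (n : nat) (w : T) : R :=
  limn (series (fun i : nat => a i * eps (n%:Z - i%:Z) w)).

Definition kde {T : Type} {R : realType} (K : R -> R) (h : nat -> R)
  (X : nat -> T -> R) (n : nat) (w : T) (x : R) : R :=
  (n%:R * h n)^-1 * \sum_(1 <= i < n.+1) K ((x - X i w) / h n).

Definition An {T : Type} {R : realType} (K : R -> R) (h gamma : nat -> R)
  (X : nat -> T -> R) (n : nat) (w : T) : set R :=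
  [set x | 0 < gamma n <= kde K h X n w x].

Definition entropy_est {T : Type} {R : realType} (K : R -> R) (h gamma : nat -> R)
  (X : nat -> T -> R) (n : nat) (w : T) : \bar R :=
  (- \int[lebesgue_measure]_(x in An K h gamma X n w)
       (kde K h X n w x * ln (kde K h X n w x))%:E)%E.

(* Main.v *)
(** After discarding the vanishing leading coefficients, write [X_i = a_0 eps_i + Y_i] with [Y_i]
    measurable with respect to the past, and let [g] be the density of [a_0 eps_0]. Then [f_n - f]
    is the sum of
    - a martingale part [Z_n(x) / (n h)], with increments the kernel terms minus their conditional
      means given the past;
    - the smoothed past part [(1/n) \int K(v) S_n(x - h v) dv], where
      [S_n(x) = \sum_i (g(x - Y_i) - f(x))];
    - the smoothing bias, [O(h^2)] uniformly since [f''] is bounded and [K] has mean [0].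
    No uniform bound over [x] is needed for the first two terms: on [A_n] the integrand
    [f_n ln f_n - f ln f] is [O(|f_n - f| / gamma)] up to a square, and [A_n] has Lebesgue measure
    [O(1 / gamma)], so integral bounds over [x] suffice. For the martingale part, a conditional
    exponential inequality integrated in [x] gives [\int cosh2 (h^2 Z_n) dx = O(n^D)] almost surely.
    For the past part, averaging out the innovations one at a time gives
    [E \int S_n^2 dx = O(n)], because translations of [g] are Lipschitz in [L^2]; a dyadic maximal
    argument turns this into [\int S_n^2 dx = O(n^(6/5))] almost surely. Altogether the deviation is
    [O(h^2 / gamma^2)], which is the inverse of the rate. *)

Require Import Defs.
From HB Require Import structures.
From mathcomp Require Import all_boot all_order all_algebra.
From mathcomp Require Import all_classical all_reals all_analysis.
From mathcomp Require Import measurable_realfun ring lra zify.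
Import Order.TTheory GRing.Theory Num.Theory.
Import numFieldNormedType.Exports.
Local Open Scope classical_set_scope.
Local Open Scope ring_scope.
Set Implicit Arguments. Unset Strict Implicit. Unset Printing Implicit Defensive.

Import HBNNSimple.

(** By (B.1), [n h^5] is of order [log n], so the inverse of the rate is of order [h^2 / gamma^2].
    One factor [1 / gamma] is the measure of [A_n], the other is the price of the logarithm near 0,
    and each part of [f_n - f] has to be [O(h^2)] in mean. For the martingale this dictates the
    exponent [h^2]: the exponential moment is then [exp (O(n h^5))], a power of [n]. Cutting at
    level [D log n] gives [O(h^-2 log n / gamma)] for the integral of [|Z_n|] over [A_n], and
    division by [n h] leaves [log n / (n h^3) = O(h^2)] per unit of measure. For the past part,
    [n^(6/5) = O(n^2 h^4)], so [S_n / n] has [L^2] norm [O(h^2)]; the gap between the mean [O(n)]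
    and [n^(6/5)] is what lets a crude dyadic sum replace a sharp maximal inequality. Conditioning
    on the past is done without conditional expectations: the sample space receives a smaller
    sigma-algebra, and the new innovation is integrated against its law by Tonelli. The infinite
    past is cut at a lag [J], with bounds uniform in [J], and recovered by Fatou. *)

(** * Integration against densities and affine changes of variable *)

Section density.
Context d (T : measurableType d) (R : realType).
Local Open Scope ereal_scope.

Lemma ge0_integral_density (mu nu : {measure set T -> \bar R}) (f : T -> R) :
  measurable_fun setT f -> (forall x, 0 <= f x)%R ->
  (forall A, measurable A -> nu A = \int[mu]_(x in A) (f x)%:E) ->
  forall phi : T -> \bar R, measurable_fun setT phi -> (forall x, 0 <= phi x) ->
  \int[nu]_x phi x = \int[mu]_x (phi x * (f x)%:E).
Proof.
move=> mf f0 nuE phi mphi phi0.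
pose s_ := nnsfun_approx measurableT mphi.
have cvs x : (s_ n x)%:E @[n --> \oo] --> phi x.
  by apply: cvg_nnsfun_approx.
have mfE : measurable_fun setT (fun x => (f x)%:E) by exact/measurable_EFinP.
have s_fE n : \int[nu]_x (s_ n x)%:E = \int[mu]_x ((s_ n x)%:E * (f x)%:E).
  under eq_integral do rewrite fimfunE -fsumEFin//.
  under [in RHS]eq_integral do rewrite fimfunE -fsumEFin//.
  rewrite ge0_integral_fsum//; last 2 first.
  - by move=> y; exact/measurable_EFinP/measurable_funM.
  - by move=> y x _; rewrite nnfun_muleindic_ge0.
  transitivity (\sum_(k \in range (s_ n)) \int[mu]_x ((k * \1_(s_ n @^-1` [set k]) x)%:E * (f x)%:E)).
    apply: eq_fsbigr => r /[!inE] -[y _ ry].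
    have r0 : (0 <= r)%R by rewrite -ry.
    have mr : measurable (s_ n @^-1` [set r]) by [].
    under eq_integral do rewrite EFinM.
    rewrite ge0_integralZl_EFin//; last by exact/measurable_EFinP.
    rewrite integral_indic// setIT nuE//.
    under [RHS]eq_integral do rewrite EFinM -muleA.
    rewrite [RHS]ge0_integralZl_EFin//; last 2 first.
    - by move=> x _; rewrite -EFinM lee_fin mulr_ge0.
    - by apply: emeasurable_funM => //; exact/measurable_EFinP.
    rewrite integral_mkcond; congr (_ * _); apply: eq_integral => x _.
    by rewrite patchE indicE; case: ifP => _; rewrite ?mul1e ?mul0e.
  rewrite -ge0_integral_fsum//.
  - apply: eq_integral => x _; rewrite ge0_mule_fsuml// => r.
    by have := nnfun_muleindic_ge0 (s_ n) r x; rewrite lee_fin.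
  - move=> r; apply: emeasurable_funM => //; exact/measurable_EFinP/measurable_funM.
  - move=> r x _; rewrite mule_ge0// ?lee_fin//.
    by have := nnfun_muleindic_ge0 (s_ n) r x; rewrite lee_fin.
transitivity (limn (fun n => \int[nu]_x (s_ n x)%:E)).
  rewrite -monotone_convergence//.
  - by apply: eq_integral => x _; apply/esym/cvg_lim.
  - by move=> n; exact/measurable_EFinP/measurable_funP.
  - by move=> n y _; rewrite lee_fin.
  - by move=> y _ m n mn; rewrite lee_fin; exact/lefP/nd_nnsfun_approx.
under eq_fun do rewrite s_fE.
rewrite -monotone_convergence//.
- apply: eq_integral => x _; apply/cvg_lim => //.
  by apply: cvgeZr.
- by move=> n; apply: emeasurable_funM => //; exact/measurable_EFinP/measurable_funP.
- by move=> n y _; rewrite mule_ge0// lee_fin.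
- move=> y _ m n mn; apply: lee_wpmul2r; first by rewrite lee_fin.
  by rewrite lee_fin; exact/lefP/nd_nnsfun_approx.
Qed.

End density.

Definition pushforward_measure d1 d2 (T1 : measurableType d1) (T2 : measurableType d2)
    (R : realType) (m : {measure set T1 -> \bar R}) (f : T1 -> T2)
    (mf : measurable_fun setT f) : {measure set T2 -> \bar R}.
Proof. by unshelve refine [the {measure set T2 -> \bar R} of pushforward m f]. Defined.

Section affine_change.
Context (R : realType).
Local Notation leb := (@lebesgue_measure R).
Local Open Scope ereal_scope.

Lemma measurable_affine (a b : R) : measurable_fun setT (fun x : R => (a * x + b)%R).
Proof.
by apply: measurable_funD => //; apply: measurable_funM.
Qed.

(** By uniqueness of Lebesgue measure only half-open intervals need checking. For [a < 0] the
    preimage is closed on the left and open on the right, which does not change its length. *)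
Lemma lebesgue_measure_affine (a b : R) (A : set R) : (a != 0)%R -> measurable A ->
  leb A = `|a|%:E * leb ((fun x : R => (a * x + b)%R) @^-1` A).
Proof.
move=> a0 mA.
pose phi : measurableTypeR R -> measurableTypeR R := fun x => (a * x + b)%R.
have mphi : measurable_fun setT phi by exact: measurable_affine.
pose m := mscale (NngNum (normr_ge0 a)) (pushforward_measure leb mphi).
suff : leb A = m A by [].
apply: lebesgue_measure_unique => // _ [[s t]] _ <-.
rewrite -[RHS]/(`|a|%:E * leb (phi @^-1` `](s, t).1, (s, t).2]%classic))/=.
have xE x : (x = (a * x + b - b) / a)%R by field.
have [a_lt0|a_gt0|a_eq0] := ltgtP a 0%R; last by rewrite a_eq0 eqxx in a0.
- rewrite (_ : _ @^-1` _ = `[((t - b) / a)%R, ((s - b) / a)%R[%classic); last first.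
    apply/seteqP; split => x /=; rewrite !in_itv/= /phi ler_ndivrMr// ltr_ndivlMr//;
      move=> /andP[H1 H2]; apply/andP; split; nra.
  rewrite !lebesgue_measure_itv/= !lte_fin ltr_ndivrMr// divfK//.
  rewrite ltrD2r; case: ifP => // _; last by rewrite mule0.
  rewrite ltr0_norm// -!EFinB -EFinM; congr EFin; field => //.
- rewrite (_ : _ @^-1` _ = `]((s - b) / a)%R, ((t - b) / a)%R]%classic); last first.
    apply/seteqP; split => x /=; rewrite !in_itv/= /phi ltr_pdivrMr// ler_pdivlMr//;
      move=> /andP[H1 H2]; apply/andP; split; nra.
  rewrite !lebesgue_measure_itv/= !lte_fin ltr_pdivlMr// divfK//.
  rewrite ltrD2r; case: ifP => // _; last by rewrite mule0.
  rewrite gtr0_norm// -!EFinB -EFinM; congr EFin; field => //.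
Qed.

Lemma ge0_integral_affine (a b : R) (k : R -> \bar R) : (a != 0)%R ->
  measurable_fun setT k -> (forall x, 0 <= k x) ->
  \int[leb]_x k x = `|a|%:E * \int[leb]_x k (a * x + b)%R.
Proof.
move=> a0 mk k0.
pose phi : measurableTypeR R -> measurableTypeR R := fun x => (a * x + b)%R.
have mphi : measurable_fun setT phi by exact: measurable_affine.
pose m := mscale (NngNum (normr_ge0 a)) (pushforward_measure leb mphi).
rewrite (eq_measure_integral m); last first.
  by move=> A mA _; exact: lebesgue_measure_affine.
by rewrite ge0_integral_mscale//= ge0_integral_pushforward.
Qed.

Lemma ge0_integral_shift (b : R) (k : R -> \bar R) :
  measurable_fun setT k -> (forall x, 0 <= k x) ->
  \int[leb]_x k (x - b)%R = \int[leb]_x k x.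
Proof.
move=> mk k0; rewrite (@ge0_integral_affine 1%R (- b)%R k)//.
by rewrite normr1 mul1e; apply: eq_integral => x _; rewrite mul1r.
Qed.

End affine_change.

(** * Independence *)

Section independence.
Context d (T : measurableType d) (R : realType) (P : probability T R).
Context (I : choiceType) (e : I -> {RV P >-> R}).
Hypothesis indep : mutually_independent P (fun i => (e i : T -> R)).
Local Open Scope ereal_scope.

(** Finite intersections instead of single preimages: they are closed under intersection and contain
    the whole space, so finite measures that agree on them agree on the sigma-algebra they
    generate. *)
Definition cylinders (Q : set I) : set (set T) :=
  [set A | exists s : seq I, exists B : I -> set R,
    [/\ uniq s, (forall i, i \in s -> Q i), (forall i, measurable (B i)) &
        A = \bigcap_(i in [set` s]) (e i @^-1` B i)]].

(** The sample space with the sigma-algebra of the variables indexed by [Q]. Measurability from this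
    type expresses dependence on those variables only. *)
Definition sigma_of (Q : set I) := g_sigma_algebraType (cylinders Q).

Lemma measurable_preimage_RV (X : {RV P >-> R}) (B : set R) :
  measurable B -> measurable (X @^-1` B).
Proof. by move=> mB; rewrite -[_ @^-1` _]setTI; exact: (measurable_funP X). Qed.

Lemma cylinders_measurable Q : cylinders Q `<=` measurable.
Proof.
move=> _ [s [B [_ _ mB ->]]]; apply: fin_bigcap_measurable => // i _.
exact: measurable_preimage_RV.
Qed.

Lemma cylinders_setT Q : cylinders Q setT.
Proof.
exists [::], (fun=> setT); split => //.
by rewrite set_nil bigcap_set0.
Qed.

Lemma cylinders_setI Q : setI_closed (cylinders Q).
Proof.
move=> _ _ [s [B [us sQ mB ->]]] [s' [B' [us' sQ' mB' ->]]].
exists (undup (s ++ s')),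
  (fun i => (if i \in s then B i else setT) `&` (if i \in s' then B' i else setT)).
split.
- exact: undup_uniq.
- by move=> i; rewrite mem_undup mem_cat => /orP[/sQ|/sQ'].
- by move=> i; apply: measurableI; case: ifP.
- apply/seteqP; split => [x [xs xs'] i /=|x xss'].
    by rewrite mem_undup mem_cat => _; split; case: ifP => // ? ; [exact: xs|exact: xs'].
  by split => i /= si; have /= := xss' i; rewrite mem_undup mem_cat si ?orbT => /(_ isT)[].
Qed.

Lemma sigma_of_measurable Q : <<s cylinders Q >> `<=` measurable.
Proof.
by apply: smallest_sub => //; [exact: sigma_algebra_measurable|exact: cylinders_measurable].
Qed.

Lemma sigma_of_measurable_fun Q d' (U : measurableType d') (f : T -> U) :
  measurable_fun [set: sigma_of Q] f -> measurable_fun [set: T] f.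
Proof. by move=> mf _ Y mY; apply: sigma_of_measurable; exact: mf. Qed.

Lemma sigma_of_subset Q Q' d' (U : measurableType d') (f : T -> U) : Q `<=` Q' ->
  measurable_fun [set: sigma_of Q] f -> measurable_fun [set: sigma_of Q'] f.
Proof.
move=> QQ' mf _ Y mY; have := mf measurableT Y mY.
apply: smallest_sub; first exact: smallest_sigma_algebra.
move=> A [s [B [us sQ mB ->]]]; apply: sub_sigma_algebra.
by exists s, B; split => // i /sQ /QQ'.
Qed.

Lemma measurable_sigma_of Q i : Q i -> measurable_fun [set: sigma_of Q] (e i).
Proof.
move=> Qi _ Y mY; rewrite setTI; apply: sub_sigma_algebra.
exists [:: i], (fun=> Y); split => //.
  by move=> k; rewrite inE => /eqP ->.
by rewrite bigcap_seq big_seq1.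
Qed.

(** Both sides are finite measures in [A], namely [P] restricted to the event and [P] scaled by its
    probability. They agree on cylinders by independence, hence on the generated sigma-algebra. *)
Lemma indep_sigma_of Q j (A : set T) (B : set R) : ~ Q j ->
  <<s cylinders Q >> A -> measurable B ->
  P (A `&` e j @^-1` B) = P A * P (e j @^-1` B).
Proof.
move=> Qj sA mB.
have mC : measurable (e j @^-1` B) by exact: measurable_preimage_RV.
have PC : P (e j @^-1` B) \is a fin_num by exact: fin_num_measure.
have C0 : (0 <= fine (P (e j @^-1` B)))%R by exact: fine_ge0.
pose m1 := mrestr P mC.
pose m2 := mscale (NngNum C0) P.
suff : m1 A = m2 A by rewrite /m1 /m2 /mrestr /mscale/= fineK// muleC.
apply: (@g_sigma_algebra_measure_unique _ _ _ (cylinders Q) _ (fun=> setT)) => //.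
- exact: cylinders_measurable.
- by move=> _; exact: cylinders_setT.
- by rewrite bigcup_const.
- exact: cylinders_setI.
- move=> _ [s [D [us sQ mD ->]]].
  rewrite -[RHS]/((fine (P (e j @^-1` B)))%:E * P (\bigcap_(i in [set` s]) (e i @^-1` D i))).
  rewrite -[LHS]/(P (\bigcap_(i in [set` s]) (e i @^-1` D i) `&` e j @^-1` B)) fineK//.
  have js : j \notin s by apply/negP => /sQ.
  rewrite indep//.
  have := @indep (j :: s) (fun i => if i == j then B else D i).
  rewrite cons_uniq js us => /(_ isT).
  have -> : \bigcap_(i in [set` (j :: s)]) (e i @^-1` (if i == j then B else D i)) =
    \bigcap_(i in [set` s]) e i @^-1` D i `&` e j @^-1` B.
    rewrite !bigcap_seq big_cons eqxx setIC; congr (_ `&` _).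
    rewrite !big_seq; apply: eq_bigr => i si.
    by case: eqP => // ij; move: js; rewrite -ij si.
  move=> ->; last by move=> i; case: ifP.
  rewrite big_cons eqxx; congr (_ * _).
  rewrite !big_seq; apply: eq_bigr => i si.
  by case: eqP => // ij; move: js; rewrite -ij si.
- by move=> _; rewrite -[X in X < _]/(P (setT `&` e j @^-1` B)) setTI -ge0_fin_numE.
Qed.

(** Plays the part of conditioning: [e j] is integrated out while everything measurable with respect
    to [Q] stays fixed. The joint law of the sample point and [e j] is a product measure, and
    Tonelli applies. *)
Lemma integral_indep Q j (Psi : sigma_of Q * R -> \bar R) : ~ Q j ->
  measurable_fun setT Psi -> (forall z, 0 <= Psi z) ->
  \int[P]_w Psi (w, e j w) = \int[P]_w \int[distribution P (e j)]_u Psi (w, u).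
Proof.
move=> Qj mPsi Psi0.
(* The identity into the coarser space acts as one random element that carries all the variables of
   [Q]. *)
have mid : measurable_fun [set: T] (id : T -> sigma_of Q).
  by move=> _ Y mY; rewrite setTI; exact: (@sigma_of_measurable Q _ mY).
pose idM : {RV P >-> sigma_of Q} := HB.pack (id : T -> sigma_of Q)
   (isMeasurableFun.Build _ _ _ _ _ mid).
have mpair : measurable_fun [set: T] (fun w => (w : sigma_of Q, e j w)).
  exact/measurable_fun_pair.
transitivity (\int[distribution P idM \x distribution P (e j)]_z Psi z).
  rewrite (eq_measure_integral (pushforward_measure P mpair)); last first.
    move=> A mA _; apply: product_measure_unique => //= X Y mX mY.
    rewrite /distribution/= /pushforward/=.
    by rewrite -(indep_sigma_of Qj mX mY).
  by rewrite /= ge0_integral_pushforward.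
rewrite fubini_tonelli1// ge0_integral_pushforward//.
  exact: measurable_fun_fubini_tonelli_F.
by move=> w _; exact: integral_ge0.
Qed.

End independence.

(** * Almost sure bounds, measurable limits and probability integrals *)

Section as_tools.
Context d (T : measurableType d) (R : realType).
Local Open Scope ereal_scope.

(** A nonnegative series with finite integral converges almost everywhere, and its sum dominates
    each term. This serves where Borel-Cantelli would be used. *)
Lemma ae_bounded (mu : {measure set T -> \bar R}) (V : nat -> T -> \bar R) :
  (forall n, measurable_fun setT (V n)) -> (forall n w, 0 <= V n w) ->
  \sum_(0 <= n <oo) \int[mu]_w V n w < +oo ->
  {ae mu, forall w, exists M : R, forall n, V n w <= M%:E}.
Proof.
move=> mV V0 SV.
pose S w := \sum_(0 <= n <oo) V n w.
have S0 w : 0 <= S w by apply: nneseries_ge0.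
have mS : measurable_fun setT S by apply: ge0_emeasurable_sum.
have iS : mu.-integrable setT S.
  apply/integrableP; split=> //.
  under eq_integral do rewrite gee0_abs//.
  by rewrite /S integral_nneseries.
have := integrable_ae measurableT iS.
apply: filterS => w /(_ I) Sfin.
exists (fine (S w)) => n; rewrite fineK//.
apply: le_trans (nneseries_lim_ge n.+1 _); last by move=> k _ _; exact: V0.
by rewrite big_nat_recr//= leeDr// sume_ge0.
Qed.

Lemma cvgn_einf_esupP (u : nat -> R) :
  cvgn u <-> (limn_einf (EFin \o u) = limn_esup (EFin \o u) /\
              limn_esup (EFin \o u) \is a fin_num).
Proof.
split=> [/cvg_ex[l ul]|[ie fe]].
  have /cvg_limn_einf_sup[-> ->] // : (EFin \o u) x @[x --> \oo] --> l%:E.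
  by apply: cvg_EFin => //; exact: nearW.
have : (EFin \o u) x @[x --> \oo] --> limn_esup (EFin \o u).
  apply: (@squeeze_cvge _ _ _ _ (einfs (EFin \o u)) _ (esups (EFin \o u))).
  - apply: nearW => n; apply/andP; split.
      by apply: ereal_inf_lbound; exists n => /=.
    by apply: ereal_sup_ubound; exists n => /=.
  - by rewrite -ie limn_einf_lim; exact: is_cvg_einfs.
  - by rewrite limn_esup_lim; exact: is_cvg_esups.
rewrite -(fineK fe) => /fine_cvgP[_ ul].
by apply/cvg_ex; eexists; exact: ul.
Qed.

(** Where the sequence diverges, [limn] takes the default value [point]. The function is therefore
    glued from a true limit on the measurable set [C] of convergence and a constant outside it. *)
Lemma measurable_fun_limn_real (u : nat -> T -> R) :
  (forall n, measurable_fun setT (u n)) ->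
  measurable_fun setT (fun w => limn (u^~ w)).
Proof.
move=> mu.
pose C := [set w | cvgn (u^~ w)].
have mE n : measurable_fun setT (fun w => (u n w)%:E) by exact/measurable_EFinP.
have mes : measurable_fun setT (fun w => limn_esup (fun n => (u n w)%:E)).
  exact: measurable_fun_limn_esup.
have mei : measurable_fun setT (fun w => limn_einf (fun n => (u n w)%:E)).
  rewrite /limn_einf; apply: measurableT_comp => //.
  by apply: measurable_fun_limn_esup => n; exact: measurableT_comp.
have mC : measurable C.
  have -> : C = [set w | limn_einf (fun n => (u n w)%:E) = limn_esup (fun n => (u n w)%:E)]
     `&` ((fun w => limn_esup (fun n => (u n w)%:E)) @^-1` [set x | x \is a fin_num]).
    by apply/seteqP; split => w /=; rewrite /C/= cvgn_einf_esupP.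
  apply: measurableI.
    by rewrite -[X in measurable X]setTI; exact: measurable_eqe.
  by rewrite -[X in measurable X]setTI; exact: emeasurable_fin_num.
rewrite (_ : setT = C `|` ~` C); last by rewrite setUv.
apply/measurable_funU => //; first exact: measurableC.
split.
  apply: (@measurable_fun_cvg _ _ _ _ u) => [n|w]; first exact: measurable_funTS.
  exact.
apply: (eq_measurable_fun (fun=> point)) => // w.
by rewrite inE => /= nC; rewrite dvgP.
Qed.

End as_tools.

Section probability_tools.
Context d (T : measurableType d) (R : realType) (mu : probability T R).

Lemma bounded_integrable (F : T -> R) (M : R) : measurable_fun setT F ->
  (forall x, `|F x| <= M) -> mu.-integrable setT (EFin \o F).
Proof.
move=> mF FM; apply: measurable_bounded_integrable => //.
  by rewrite -ge0_fin_numE //; exact: fin_num_measure.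
exists M; split; first exact: num_real.
by move=> x Mx y _; exact: le_trans (FM y) (ltW Mx).
Qed.

Lemma EFin_Rintegral d' (U : measurableType d') (nu : {measure set U -> \bar R})
    (D : set U) (F : U -> R) : measurable D -> nu.-integrable D (EFin \o F) ->
  (\int[nu]_(x in D) (F x)%:E = (\int[nu]_(x in D) F x)%:E)%E.
Proof. by move=> mD iF; rewrite /Rintegral fineK//; exact: integrable_fin_num. Qed.

Lemma Rintegral_prob_cst (c : R) : \int[mu]_x c = c.
Proof.
rewrite Rintegral_cst// -[RHS]mulr1; congr (_ * _).
by rewrite -[RHS]/(fine 1%E); congr fine; exact: probability_setT.
Qed.

Lemma integral_prob_cst (c : \bar R) : (\int[mu]_x c = c)%E.
Proof.
by rewrite integral_cst// -[RHS]mule1; congr (_ * _)%E; exact: probability_setT.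
Qed.

Lemma Rintegral_norm_le (F : T -> R) (M : R) : measurable_fun setT F ->
  (forall x, `|F x| <= M) -> `|\int[mu]_x F x| <= M.
Proof.
move=> mF FM; have iF := bounded_integrable mF FM.
apply: le_trans (le_normr_Rintegral _ iF) _ => //.
rewrite -[leRHS]Rintegral_prob_cst; apply: le_Rintegral => //.
- exact: (integrable_norm iF).
- by apply: (@bounded_integrable _ `|M|) => //.
Qed.

Lemma Rintegral_sum (q : nat) (F : nat -> T -> R) (M : R) :
  (forall p, measurable_fun setT (F p)) -> (forall p x, `|F p x| <= M) ->
  \int[mu]_x (\sum_(p < q) F p x) = \sum_(p < q) \int[mu]_x F p x.
Proof.
move=> mF FM; elim: q => [|q IH].
  by under eq_Rintegral do rewrite big_ord0; rewrite Rintegral_prob_cst big_ord0.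
under eq_Rintegral do rewrite big_ord_recr/=.
rewrite RintegralD//; first by rewrite IH big_ord_recr.
- apply: (@bounded_integrable _ (\sum_(p < q) M)); first exact: measurable_sum.
  by move=> x; rewrite (le_trans (ler_norm_sum _ _ _))// ler_sum.
- exact: bounded_integrable.
Qed.

(** The mean minimizes the quadratic deviation, so any [k] may replace it, and the cross term with
    the constant [V] vanishes. With [k] the value for innovation 0, the variance becomes an
    increment of [F]. *)
Lemma sqr_centered_le (F : T -> R) (M k V : R) : measurable_fun setT F ->
  (forall x, `|F x| <= M) ->
  (\int[mu]_x ((F x - \int[mu]_y F y + V) ^+ 2)%:E <=
   \int[mu]_x ((F x - k) ^+ 2)%:E + (V ^+ 2)%:E)%E.
Proof.
move=> mF FM; have iF := bounded_integrable mF FM.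
set m := \int[mu]_y F y.
have mk2 c : measurable_fun setT (fun x => (F x - c) ^+ 2).
  by apply: measurable_funX; apply: measurable_funB.
have ik2 c : mu.-integrable setT (EFin \o (fun x => (F x - c) ^+ 2)).
  apply: (@bounded_integrable _ ((M + `|c|) ^+ 2)) => // x.
  rewrite normrX lerXn2r// ?nnegrE//.
    by rewrite addr_ge0// (le_trans _ (FM x)).
  by rewrite (le_trans (ler_normB _ _))// lerD2r.
have i2 : mu.-integrable setT (EFin \o (fun x => (2 * (V - m + k)) * F x)).
  by apply: (@bounded_integrable _ (`|2 * (V - m + k)| * M)) => [|x];
    [exact: measurable_funM|rewrite normrM ler_wpM2l].
have i3 (c : R) : mu.-integrable setT (EFin \o (fun x => c)).
  by apply: (@bounded_integrable _ `|c|).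
(* The difference of the two squares is affine in [F x]; its mean is [V^2 - (m - k)^2]. *)
pose G x := (2 * (V - m + k)) * F x + ((V - m) ^+ 2 - k ^+ 2).
have iG : mu.-integrable setT (EFin \o G).
  rewrite (_ : _ \o _ = (fun x => (2 * (V - m + k) * F x)%:E + ((V - m) ^+ 2 - k ^+ 2)%R%:E)%E)//.
  exact: (integrableD measurableT i2 (i3 ((V - m) ^+ 2 - k ^+ 2))).
have -> : (fun x => ((F x - m + V) ^+ 2)%:E) =
    (fun x => (((F x - k) ^+ 2)%R%:E + (G x)%:E)%E).
  by apply/funext => x /=; rewrite -EFinD /G; congr EFin; ring.
have -> : (\int[mu]_x (((F x - k) ^+ 2)%:E + (G x)%:E) =
    \int[mu]_x ((F x - k) ^+ 2)%:E + \int[mu]_x (G x)%:E)%E.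
  exact: (integralD measurableT (ik2 k) iG).
rewrite leeD2l// EFin_Rintegral//.
rewrite RintegralD// Rintegral_prob_cst RintegralZl// -/m lee_fin.
by have := sqr_ge0 (m - k); nra.
Qed.

Lemma sqr_Rintegral_le (F : T -> R) (M : R) : measurable_fun setT F ->
  (forall x, `|F x| <= M) ->
  (((\int[mu]_y F y) ^+ 2)%:E <= \int[mu]_x ((F x) ^+ 2)%:E)%E.
Proof.
move=> mF FM; have iF := bounded_integrable mF FM.
have i2 : mu.-integrable setT (EFin \o (fun x => F x ^+ 2)).
  apply: (@bounded_integrable _ (M ^+ 2)) => [|x]; first exact: measurable_funX.
  by rewrite normrX lerXn2r// nnegrE// (le_trans _ (FM x)).
rewrite EFin_Rintegral// lee_fin.
set m := \int[mu]_y F y.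
(* Jensen through the tangent line of the square at the mean. *)
have : \int[mu]_x (2 * m * F x - m ^+ 2) <= \int[mu]_x (F x ^+ 2).
  apply: le_Rintegral => //.
    apply: (@bounded_integrable _ (`|2 * m| * M + m ^+ 2)) => [|x].
      by apply: measurable_funB => //; exact: measurable_funM.
    rewrite (le_trans (ler_normB _ _))// lerD//; last by rewrite ger0_norm ?sqr_ge0.
    by rewrite normrM ler_wpM2l.
  by move=> x _; have := sqr_ge0 (F x - m); nra.
rewrite RintegralB//; last first.
  by apply: (@bounded_integrable _ `|m ^+ 2|).
  apply: (@bounded_integrable _ (`|2 * m| * M)) => [|x]; first exact: measurable_funM.
  by rewrite normrM ler_wpM2l.
by rewrite Rintegral_prob_cst RintegralZl// -/m; nra.
Qed.

End probability_tools.

(** * Functions averaged over innovations *)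

Section averaging.
Context (R : realType) (mu : probability R R).
Local Notation leb := (@lebesgue_measure R).

(** A class stable under averaging over an innovation. The last condition, translations Lipschitz in
    [L^2], measures the effect of changing one innovation after integration over [x]. *)
Definition nice (B L1 L2 : R) (G : R -> R) : Prop :=
  [/\ forall x, `|G x| <= B,
      forall x y, `|G x - G y| <= L1 * `|x - y| &
      forall s, (\int[leb]_y ((G (y - s) - G y) ^+ 2)%:E <= (L2 * s ^+ 2)%:E)%E].

Definition avg (c : R) (G : R -> R) (y : R) : R := \int[mu]_u G (y - c * u).

Lemma lipschitz_measurable (L : R) (G : R -> R) :
  (forall x y, `|G x - G y| <= L * `|x - y|) -> measurable_fun setT G.
Proof.
move=> GL; apply: continuous_measurable_fun => x.
apply/cvgrPdist_le => e e0; near=> y.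
apply: le_trans (GL x y) _.
have L1 : 0 < `|L| + 1 by rewrite ltr_wpDl.
apply: (@le_trans _ _ ((`|L| + 1) * `|x - y|)).
  by rewrite ler_wpM2r// (le_trans (ler_norm _))// lerDl.
rewrite mulrC -ler_pdivlMr//.
near: y; apply: cvgr_dist_le; last by rewrite divr_gt0.
exact: cvg_id.
Unshelve. all: by end_near. Qed.

Lemma nice_measurable B L1 L2 G : nice B L1 L2 G -> measurable_fun setT G.
Proof. by move=> [_ GL _]; exact: lipschitz_measurable GL. Qed.

Lemma measurable_comp_affine (G : R -> R) (y c : R) : measurable_fun setT G ->
  measurable_fun setT (fun u => G (y - c * u)).
Proof.
move=> mG; apply: (@measurableT_comp _ _ _ _ _ _ G) => //.
by apply: measurable_funB => //; exact: measurable_funM.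
Qed.

(** The [L^2] condition survives by Jensen under the average, then Tonelli and translation
    invariance of Lebesgue measure; no constant is lost. *)
Lemma nice_avg B L1 L2 c G : nice B L1 L2 G -> nice B L1 L2 (avg c G).
Proof.
move=> nG; have [GB GL GL2] := nG; have mG := nice_measurable nG.
have mGc y : measurable_fun setT (fun u => G (y - c * u)) by exact: measurable_comp_affine.
have iGc y : mu.-integrable setT (EFin \o (fun u => G (y - c * u))).
  exact: (@bounded_integrable _ _ _ mu (fun u => G (y - c * u)) B).
have avgL x y : `|avg c G x - avg c G y| <= L1 * `|x - y|.
  rewrite /avg -RintegralB//; apply: Rintegral_norm_le.
    exact: measurable_funB.
  by move=> u; apply: le_trans (GL _ _) _; rewrite opprB addrA subrK.
have mavg := lipschitz_measurable avgL.
split => //; first by move=> x; exact: Rintegral_norm_le.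
move=> s.
pose D (y : R) := (G (y - s) - G y) ^+ 2.
have mD : measurable_fun setT D.
  apply: measurable_funX; apply: measurable_funB => //.
  by apply: (@measurableT_comp _ _ _ _ _ _ G) => //; exact: measurable_funB.
have mD2 : measurable_fun setT (fun z : R * R => D (z.1 - c * z.2)).
  apply: (@measurableT_comp _ _ _ _ _ _ D) => //; apply: measurable_funB => //.
  exact: measurable_funM.
apply: (@le_trans _ _ (\int[leb]_y \int[mu]_u (D (y - c * u))%:E)%E).
  apply: ge0_le_integral => //.
  - by move=> y _; rewrite lee_fin sqr_ge0.
  - apply/measurable_EFinP; apply: measurable_funX; apply: measurable_funB => //.
    by apply: (@measurableT_comp _ _ _ _ _ _ (avg c G)) => //; exact: measurable_funB.
  - apply: (@measurable_fun_fubini_tonelli_F _ _ _ _ _ mu (fun z : R * R => (D (z.1 - c * z.2))%:E)) => //.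
      exact/measurable_EFinP.
    by move=> z; rewrite lee_fin sqr_ge0.
  - move=> y _; rewrite /avg -RintegralB//.
    have -> : (\int[mu]_u (D (y - c * u))%:E = \int[mu]_u ((G (y - s - c * u) - G (y - c * u)) ^+ 2)%:E)%E.
      by apply: eq_integral => u _; rewrite /D addrAC.
    apply: (@sqr_Rintegral_le _ _ _ mu _ (B + B)); first exact: measurable_funB.
    by move=> u; rewrite (le_trans (ler_normB _ _))// lerD.
rewrite (@fubini_tonelli _ _ _ _ _ leb mu (fun z : R * R => (D (z.1 - c * z.2))%:E))//=; last 2 first.
- exact/measurable_EFinP.
- by move=> z; rewrite lee_fin sqr_ge0.
have -> : (\int[mu]_u \int[leb]_y (D (y - c * u))%:E = \int[mu]_u \int[leb]_y (D y)%:E)%E.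
  apply: eq_integral => u _.
  apply: (@ge0_integral_shift _ (c * u) (fun y => (D y)%:E)); first exact/measurable_EFinP.
  by move=> y; rewrite lee_fin sqr_ge0.
by rewrite integral_prob_cst; exact: GL2.
Qed.

(** The coefficient of largest index is averaged first: in [lsum] it multiplies the latest
    innovation, which is independent of the remaining ones. *)
Fixpoint avgs (c : nat -> R) (N : nat) (G : R -> R) : R -> R :=
  if N is N'.+1 then avgs c N' (avg (c N') G) else G.

Lemma nice_avgs B L1 L2 c N G : nice B L1 L2 G -> nice B L1 L2 (avgs c N G).
Proof. by elim: N G => [//|N IH] G nG /=; apply: IH; exact: nice_avg. Qed.

(** Cauchy-Schwarz with weights [|c p|]. Since the inverse of 0 is 0, terms of zero weight must
    vanish by hypothesis. *)
Lemma sqr_sum_le (q : nat) (c y : nat -> R) :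
  (forall p, c p = 0 -> y p = 0) ->
  (\sum_(p < q) y p) ^+ 2 <= (\sum_(p < q) `|c p|) * \sum_(p < q) (`|c p|^-1 * y p ^+ 2).
Proof.
move=> cy; elim: q => [|q IH]; first by rewrite !big_ord0 expr0n mul0r.
rewrite !big_ord_recr/=.
set a := \sum_(i < q) y i in IH *; set A := \sum_(i < q) `|c i| in IH *.
set b := \sum_(i < q) _ in IH *.
have A0 : 0 <= A by apply: sumr_ge0.
have b0 : 0 <= b by apply: sumr_ge0 => i _; rewrite mulr_ge0// ?invr_ge0// sqr_ge0.
have [c0|c0] := eqVneq (c q) 0.
  by rewrite (cy _ c0) c0 normr0 expr0n/= mulr0 !addr0.
have cq : 0 < `|c q| by rewrite normr_gt0.
set t := `|c q|^-1 * _.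
have yt : y q ^+ 2 = `|c q| * t by rewrite /t mulrA mulfV ?mul1r// gt_eqF.
have t0 : 0 <= t by rewrite /t mulr_ge0// ?invr_ge0// sqr_ge0.
have At : 0 <= A * t by exact: mulr_ge0.
have cb : 0 <= `|c q| * b by rewrite mulr_ge0.
(* The arithmetic-geometric mean inequality, since [(a * y q)^2 <= (A * t) * (|c q| * b)] by
   induction. *)
suff : 2 * (a * y q) <= A * t + `|c q| * b by nra.
apply: le_trans (ler_norm _) _.
rewrite -(ler_pXn2r (_ : 0 < 2)%N)// ?nnegrE// ?addr_ge0//.
rewrite -normrX ger0_norm ?sqr_ge0// !exprMn yt.
have : a ^+ 2 * (`|c q| * t) <= (A * b) * (`|c q| * t) by rewrite ler_wpM2r// mulr_ge0.
have := sqr_ge0 (A * t - `|c q| * b).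
nra.
Qed.

(** Unweighted Cauchy-Schwarz would cost a factor [q]. The weights [|c p|] give the square of their
    sum instead, which absolute summability bounds independently of [q]. *)
Lemma increments_L2 B L1 L2 (q : nat) (G : nat -> R -> R) (s c : nat -> R) (u : R) :
  (forall p, nice B L1 L2 (G p)) ->
  (\int[leb]_x ((\sum_(p < q) (G p (x - s p - c p * u) - G p (x - s p))) ^+ 2)%:E <=
   (L2 * (\sum_(p < q) `|c p|) ^+ 2 * u ^+ 2)%:E)%E.
Proof.
move=> nG.
set A := \sum_(p < q) `|c p|.
have A0 : 0 <= A by apply: sumr_ge0.
have mG p := nice_measurable (nG p).
pose D p (x : R) := G p (x - c p * u) - G p x.
have mD p : measurable_fun setT (D p).
  apply: measurable_funB => //.
  by apply: (@measurableT_comp _ _ _ _ _ _ (G p)) => //; exact: measurable_funB.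
have mDs p : measurable_fun setT (fun x : R => D p (x - s p)).
  by apply: (@measurableT_comp _ _ _ _ _ _ (D p)) => //; exact: measurable_funB.
have mE p : measurable_fun setT (fun x : R => (A * `|c p|^-1)%:E * (D p (x - s p)%R ^+ 2)%R%:E)%E.
  by apply: emeasurable_funM => //; apply/measurable_EFinP; exact: measurable_funX.
apply: (@le_trans _ _ (\int[leb]_x \sum_(p < q) ((A * `|c p|^-1)%:E * (D p (x - s p)%R ^+ 2)%R%:E))%E).
  apply: ge0_le_integral => //.
  - by move=> x _; rewrite lee_fin sqr_ge0.
  - apply/measurable_EFinP; apply: measurable_funX.
    apply: (@eq_measurable_fun _ _ _ _ _ (fun x : R => \sum_(p < q) D p (x - s p))).
      by move=> x _; apply: eq_bigr => p _; rewrite /D addrAC.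
    by apply: measurable_sum => p; exact: mDs.
  - by apply: emeasurable_sum => p; exact: mE.
  - move=> x _.
    under [leRHS]eq_bigr do rewrite -EFinM.
    rewrite sumEFin lee_fin.
    under [leRHS]eq_bigr do rewrite -mulrA.
    rewrite -mulr_sumr.
    have := @sqr_sum_le q c (fun p => D p (x - s p)).
    rewrite -/A (_ : \sum_(p < q) D p (x - s p) = \sum_(p < q) (G p (x - s p - c p * u) - G p (x - s p)))//.
    by apply => p; rewrite /D => ->; rewrite mul0r subr0 subrr.
rewrite ge0_integral_sum//; last 2 first.
- by move=> p; exact: mE.
- by move=> p x _; rewrite -EFinM lee_fin mulr_ge0// ?sqr_ge0// mulr_ge0// invr_ge0.
apply: (@le_trans _ _ (\sum_(p < q) (A * `|c p| * L2 * u ^+ 2)%:E)%E).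
  apply: lee_sum => p _.
  rewrite ge0_integralZl_EFin//; last 3 first.
  - by move=> x _; rewrite lee_fin sqr_ge0.
  - by apply/measurable_EFinP; apply: measurable_funX; exact: mDs.
  - by rewrite mulr_ge0// invr_ge0.
  rewrite (@ge0_integral_shift _ (s p) (fun x => (D p x ^+ 2)%:E)); last 2 first.
  - by apply/measurable_EFinP; apply: measurable_funX; exact: mD.
  - by move=> x; rewrite lee_fin sqr_ge0.
  have [_ _ /(_ (c p * u)) GL2] := nG p.
  apply: le_trans (lee_wpmul2l _ GL2) _; first by rewrite lee_fin mulr_ge0// invr_ge0.
  rewrite -EFinM lee_fin.
  have [->|c0] := eqVneq (c p) 0; first by rewrite normr0 invr0 !(mulr0,mul0r).
  rewrite exprMn -(real_normK (num_real (c p))) le_eqVlt; apply/orP; left; apply/eqP.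
  by field; rewrite normr_eq0.
rewrite sumEFin lee_fin -!mulr_suml -mulr_sumr -/A.
by rewrite le_eqVlt; apply/orP; left; apply/eqP; ring.
Qed.

End averaging.

(** * Variance bounds for arrays of linear sums *)

Section linear_array.
Context d (T : measurableType d) (R : realType) (P : probability T R).
Context (eps : int -> {RV P >-> R}) (mu : probability R R).
Hypothesis indep : mutually_independent P (fun i => (eps i : T -> R)).
Hypothesis law : forall j A, measurable A -> P (eps j @^-1` A) = mu A.
Local Notation leb := (@lebesgue_measure R).

Lemma integral_law j (phi : R -> \bar R) : measurable_fun setT phi ->
  (forall x, (0 <= phi x)%E) -> (\int[P]_w phi (eps j w) = \int[mu]_u phi u)%E.
Proof.
move=> mphi phi0.
transitivity (\int[distribution P (eps j)]_u phi u)%E.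
  by rewrite ge0_integral_distribution.
by apply: eq_measure_integral => A mA _; exact: law.
Qed.

Lemma integral_indep_law Q j (Psi : sigma_of eps Q * R -> \bar R) : ~ Q j ->
  measurable_fun setT Psi -> (forall z, (0 <= Psi z)%E) ->
  (\int[P]_w Psi (w, eps j w) = \int[P]_w \int[mu]_u Psi (w, u))%E.
Proof.
move=> Qj mPsi Psi0; rewrite (integral_indep indep Qj)//.
apply: eq_integral => w _; apply: eq_measure_integral => A mA _; exact: law.
Qed.

Definition past (j : int) : set int := [set i | (i < j)%R].

(** Innovations are listed forward in time, so that the last summand is the one to integrate out. *)
Definition lsum (c : nat -> R) (tau : int) (N : nat) (w : T) : R :=
  \sum_(s < N) c s * eps (tau + s%:Z) w.

Lemma measurable_lsum c tau N :
  measurable_fun [set: sigma_of eps (past (tau + N%:Z))] (lsum c tau N).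
Proof.
apply: measurable_sum => s; apply: measurable_funM => //.
by apply: measurable_sigma_of; rewrite /past/= ltrD2l ltz_nat.
Qed.

Lemma measurable_lsumT c tau N : measurable_fun [set: T] (lsum c tau N).
Proof.
by apply: (@sigma_of_measurable_fun _ _ _ P _ eps (past (tau + N%:Z)));
  exact: measurable_lsum.
Qed.

(** Induction on the number of innovations, in the manner of martingale differences: integrating out
    the latest one splits the square into the deviation of the averaged functions and a conditional
    variance. By [sqr_centered_le] the latter is at most the squared effect of setting that
    innovation to 0, which [increments_L2] bounds after integration over [x]. *)
Lemma array_L2 B L1 L2 s2 (q : nat) (c : nat -> nat -> R) (tau : int) (N : nat)
    (G : nat -> R -> R) :
  0 <= L2 -> (\int[mu]_u (u ^+ 2)%:E <= s2%:E)%E ->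
  (forall p, nice B L1 L2 (G p)) ->
  (\int[leb]_x \int[P]_w ((\sum_(p < q) G p (x - lsum (c p) tau N w) -
      \sum_(p < q) avgs mu (c p) N (G p) x) ^+ 2)%:E <=
   (\sum_(s < N) L2 * (\sum_(p < q) `|c p s|) ^+ 2 * s2)%:E)%E.
Proof.
move=> L20 mus2; elim: N G => [|N IH] G nG.
  rewrite big_ord0 integral0_eq// => x _; rewrite integral0_eq// => w _ /=.
  rewrite (_ : \sum_(p < q) _ = \sum_(p < q) G p x) ?subrr ?expr0n//.
  by apply: eq_bigr => p _; rewrite /lsum big_ord0 subr0.
(* The rows have different coefficients, so averaging yields functions that depend on [p]; this is
   why the induction carries a family [G]. *)
pose G' p := avg mu (c p N) (G p).
have nG' p : nice B L1 L2 (G' p) by exact: nice_avg.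
have mG p := nice_measurable (nG p).
have mG' p := nice_measurable (nG' p).
have GB p x : `|G p x| <= B by have [/(_ x)] := nG p.
pose j := (tau + N%:Z)%R.
pose S p := lsum (c p) tau N.
have mS p : measurable_fun [set: sigma_of eps (past j)] (S p) by exact: measurable_lsum.
have mST p : measurable_fun [set: T] (S p) by exact: measurable_lsumT.
pose C x := \sum_(p < q) avgs mu (c p) N (G' p) x.
pose F (x : R) (z : T * R) := \sum_(p < q) G p (x - S p z.1 - c p N * z.2).
pose V x w := \sum_(p < q) G' p (x - S p w) - C x.
have mC : measurable_fun setT C.
  by apply: measurable_sum => p; exact: nice_measurable (nice_avgs _ _ _ (nG' p)).
have FE x w : \sum_(p < q) G p (x - lsum (c p) tau N.+1 w) = F x (w, eps j w).
  apply: eq_bigr => p _; rewrite /S /lsum big_ord_recr/=.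
  by congr (G p _); rewrite opprD addrA.
have mF x : measurable_fun [set: sigma_of eps (past j) * R] (F x).
  apply: measurable_sum => p; apply: (@measurableT_comp _ _ _ _ _ _ (G p)) => //.
  apply: measurable_funB; last exact: measurable_funM.
  by apply: measurable_funB => //; exact: (measurableT_comp (mS p)).
have mFT : measurable_fun [set: R * T] (fun z => F z.1 (z.2, eps j z.2)).
  apply: measurable_sum => p; apply: (@measurableT_comp _ _ _ _ _ _ (G p)) => //=.
  apply: measurable_funB; last first.
    by apply: measurable_funM => //; exact: measurableT_comp.
  by apply: measurable_funB => //; exact: (measurableT_comp (mST p)).
have mF0T : measurable_fun [set: R * T] (fun z => F z.1 (z.2, 0)).
  apply: measurable_sum => p; apply: (@measurableT_comp _ _ _ _ _ _ (G p)) => //=.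
  apply: measurable_funB => //.
  by apply: measurable_funB => //; exact: (measurableT_comp (mST p)).
have mVT : measurable_fun [set: R * T] (fun z => V z.1 z.2).
  apply: measurable_funB; last exact: (measurableT_comp mC).
  apply: measurable_sum => p; apply: (@measurableT_comp _ _ _ _ _ _ (G' p)) => //=.
  by apply: measurable_funB => //; exact: (measurableT_comp (mST p)).
have mV x : measurable_fun [set: sigma_of eps (past j)] (V x).
  apply: measurable_funB => //.
  apply: measurable_sum => p; apply: (@measurableT_comp _ _ _ _ _ _ (G' p)) => //=.
  exact: measurable_funB.
have Fbound x z : `|F x z| <= \sum_(p < q) B.
  by rewrite (le_trans (ler_norm_sum _ _ _))// ler_sum.
have mFw x w : measurable_fun setT (fun u => F x (w, u)).
  apply: measurable_sum => p.
  exact: (@measurable_comp_affine _ (G p) (x - S p w) (c p N)).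
have Fmean x w : \int[mu]_u F x (w, u) = \sum_(p < q) G' p (x - S p w).
  apply: (@Rintegral_sum _ _ _ mu q (fun p u => G p (x - S p w - c p N * u)) B) => [p|p u].
    exact: (@measurable_comp_affine _ (G p) (x - S p w) (c p N)).
  exact: GB.
pose D x z := (F x z - F x (z.1, 0)) ^+ 2.
have D0 x z : (0 <= (D x z)%:E)%E by rewrite lee_fin sqr_ge0.
have mD x : measurable_fun [set: sigma_of eps (past j) * R] (D x).
  apply: measurable_funX; apply: measurable_funB => //.
  apply: measurable_sum => p; apply: (@measurableT_comp _ _ _ _ _ _ (G p)) => //=.
  apply: measurable_funB => //.
  by apply: measurable_funB => //; exact: (measurableT_comp (mS p)).
have pj : ~ past j j by rewrite /past/= ltxx.
have mFC x : measurable_fun [set: sigma_of eps (past j) * R] (fun z => (F x z - C x) ^+ 2).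
  by apply: measurable_funX; exact: measurable_funB.
have step x : (\int[P]_w ((F x (w, eps j w) - C x) ^+ 2)%:E <=
    \int[P]_w (D x (w, eps j w))%:E + \int[P]_w (V x w ^+ 2)%:E)%E.
  rewrite (@integral_indep_law (past j) j (fun z => ((F x z - C x) ^+ 2)%:E)); last 3 first.
  - exact: pj.
  - by apply/measurable_EFinP; exact: mFC.
  - by move=> z; rewrite lee_fin sqr_ge0.
  rewrite (@integral_indep_law (past j) j (fun z => (D x z)%:E)); last 3 first.
  - exact: pj.
  - by apply/measurable_EFinP; exact: mD.
  - exact: D0.
  rewrite -ge0_integralD//; last 4 first.
  - by move=> w _; apply: integral_ge0 => u _; exact: D0.
  - apply: (@sigma_of_measurable_fun _ _ _ P _ eps (past j)).
    apply: (@measurable_fun_fubini_tonelli_F _ _ _ _ _ mu (fun z : sigma_of eps (past j) * R => (D x z)%:E)) => //.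
    by apply/measurable_EFinP; exact: mD.
  - by move=> w _; rewrite lee_fin sqr_ge0.
  - apply/measurable_EFinP; apply: measurable_funX.
    exact: (@sigma_of_measurable_fun _ _ _ P _ eps (past j)).
  apply: ge0_le_integral => //.
  - by move=> w _; apply: integral_ge0 => u _; rewrite lee_fin sqr_ge0.
  - apply: (@sigma_of_measurable_fun _ _ _ P _ eps (past j)).
    apply: (@measurable_fun_fubini_tonelli_F _ _ _ _ _ mu (fun z : sigma_of eps (past j) * R => ((F x z - C x) ^+ 2)%:E)) => //.
      by apply/measurable_EFinP; exact: mFC.
    by move=> z; rewrite lee_fin sqr_ge0.
  - apply: emeasurable_funD.
      apply: (@sigma_of_measurable_fun _ _ _ P _ eps (past j)).
      apply: (@measurable_fun_fubini_tonelli_F _ _ _ _ _ mu (fun z : sigma_of eps (past j) * R => (D x z)%:E)) => //.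
      by apply/measurable_EFinP; exact: mD.
    apply/measurable_EFinP; apply: measurable_funX.
    exact: (@sigma_of_measurable_fun _ _ _ P _ eps (past j)).
  - move=> w _.
    have := @sqr_centered_le _ _ _ mu (fun u => F x (w, u)) _ (F x (w, 0)) (V x w)
      (mFw x w) (fun u => Fbound x (w, u)).
    rewrite Fmean; apply: le_trans; rewrite le_eqVlt; apply/orP; left; apply/eqP.
    by apply: eq_integral => u _; rewrite /V addrA subrK.
have mDT : measurable_fun [set: R * T] (fun z => (D z.1 (z.2, eps j z.2))%:E).
  by apply/measurable_EFinP; apply: measurable_funX; exact: measurable_funB.
have mV2T : measurable_fun [set: R * T] (fun z => (V z.1 z.2 ^+ 2)%:E).
  by apply/measurable_EFinP; exact: measurable_funX.
apply: (@le_trans _ _ (\int[leb]_x (\int[P]_w (D x (w, eps j w))%:E + \int[P]_w (V x w ^+ 2)%:E))%E).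
  under eq_integral => x _ do under eq_integral => w _ do rewrite FE.
  apply: ge0_le_integral => //.
  - by move=> x _; apply: integral_ge0 => w _; rewrite lee_fin sqr_ge0.
  - apply: (@measurable_fun_fubini_tonelli_F _ _ _ _ _ P (fun z : R * T => ((F z.1 (z.2, eps j z.2) - C z.1) ^+ 2)%:E)) => //.
      apply/measurable_EFinP; apply: measurable_funX; apply: measurable_funB => //.
      exact: (measurableT_comp mC).
    by move=> z; rewrite lee_fin sqr_ge0.
  - apply: emeasurable_funD.
      exact: (@measurable_fun_fubini_tonelli_F _ _ _ _ _ P (fun z : R * T => (D z.1 (z.2, eps j z.2))%:E)).
    apply: (@measurable_fun_fubini_tonelli_F _ _ _ _ _ P (fun z : R * T => (V z.1 z.2 ^+ 2)%:E)) => //.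
    by move=> z; rewrite lee_fin sqr_ge0.
rewrite ge0_integralD//; last 4 first.
- by move=> x _; apply: integral_ge0 => w _; exact: D0.
- exact: (@measurable_fun_fubini_tonelli_F _ _ _ _ _ P (fun z : R * T => (D z.1 (z.2, eps j z.2))%:E)).
- by move=> x _; apply: integral_ge0 => w _; rewrite lee_fin sqr_ge0.
- apply: (@measurable_fun_fubini_tonelli_F _ _ _ _ _ P (fun z : R * T => (V z.1 z.2 ^+ 2)%:E)) => //.
  by move=> z; rewrite lee_fin sqr_ge0.
have IHV : (\int[leb]_x \int[P]_w (V x w ^+ 2)%:E <=
    (\sum_(s < N) L2 * (\sum_(p < q) `|c p s|) ^+ 2 * s2)%:E)%E := IH G' nG'.
rewrite big_ord_recr EFinD [leLHS]addeC; apply: leeD; first by exact: IHV.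
rewrite (@fubini_tonelli _ _ _ _ _ leb P (fun z : R * T => (D z.1 (z.2, eps j z.2))%:E))//=.
apply: (@le_trans _ _ (\int[P]_w ((L2 * (\sum_(p < q) `|c p N|) ^+ 2)%:E * (eps j w ^+ 2)%:E))%E).
  apply: ge0_le_integral => //.
  - by move=> w _; apply: integral_ge0 => x _; exact: D0.
  - exact: (@measurable_fun_fubini_tonelli_G _ _ _ _ _ leb (fun z : R * T => (D z.1 (z.2, eps j z.2))%:E)).
  - apply: emeasurable_funM => //; apply/measurable_EFinP; exact: measurable_funX.
  - move=> w _; rewrite -EFinM.
    have := @increments_L2 _ B L1 L2 q G (fun p => S p w) (c^~ N) (eps j w) nG.
    apply: le_trans; rewrite le_eqVlt; apply/orP; left; apply/eqP.
    apply: eq_integral => x _; rewrite /D /F -sumrB; congr (_ ^+ 2)%:E.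
    by apply: eq_bigr => p _ /=; rewrite mulr0 subr0.
rewrite ge0_integralZl_EFin//; last 3 first.
- by move=> w _; rewrite lee_fin sqr_ge0.
- by apply/measurable_EFinP; exact: measurable_funX.
- by rewrite mulr_ge0// sqr_ge0.
rewrite (@integral_law j (fun u => (u ^+ 2)%:E)); last 2 first.
- by apply/measurable_EFinP; exact: measurable_funX.
- by move=> u; rewrite lee_fin sqr_ge0.
by rewrite [leRHS]EFinM lee_wpmul2l// lee_fin mulr_ge0// sqr_ge0.
Qed.

End linear_array.

(** * Exponential bounds for the martingale part *)

Section exp_remainder.
Context (R : realType).

(** Without its first-order part the exponential vanishes to second order at 0 and stays
    nonnegative. Hence it can be integrated over the whole line in [x], where the exponential itself
    has infinite integral. *)
Definition expR2 (t : R) : R := expR t - 1 - t.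

Lemma expR2_ge0 t : 0 <= expR2 t.
Proof. by rewrite /expR2 -addrA -opprD subr_ge0 expR_ge1Dx. Qed.

Lemma expR2_0 : expR2 0 = 0.
Proof. by rewrite /expR2 expR0 subrr subr0. Qed.

Lemma expR_le_quadratic (t : R) : `|t| <= 3^-1 -> expR t <= 1 + t + t ^+ 2.
Proof.
rewrite ler_norml => /andP[t1 t2].
have h1 : 0 < 1 - t / 2 by lra.
(* The square of [exp(-t/2) >= 1 - t/2], inverted. *)
have : expR t <= (1 - t / 2) ^- 2.
  rewrite -[leLHS]invrK -expRN lef_pV2 ?posrE ?exprn_gt0 ?expR_gt0//.
  have -> : - t = (- (t / 2)) + (- (t / 2)) by lra.
  by rewrite expRD -expr2 lerXn2r ?nnegrE ?expR_ge0 ?(ltW h1)// expR_ge1Dx.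
move/le_trans; apply.
rewrite -[leLHS]div1r ler_pdivrMr ?exprn_gt0//.
have -> : (1 + t + t ^+ 2) * (1 - t / 2) ^+ 2 = 1 + t ^+ 2 * ((1 - 3 * t + t ^+ 2) / 4) by field.
rewrite lerDl mulr_ge0 ?sqr_ge0//; nra.
Qed.

Lemma expR_le_expR2 (t : R) : expR t <= 2 * expR2 t + 2.
Proof.
suff : 2 * t <= expR t by rewrite /expR2; lra.
have [t0|t0] := leP t 0; first by have := expR_ge0 t; lra.
have : (1 + t / 2) ^+ 2 <= expR t.
  rewrite {2}(_ : t = t / 2 + t / 2); last by lra.
  by rewrite expRD -expr2 lerXn2r ?nnegrE ?expR_ge0 ?expR_ge1Dx//; lra.
by apply: le_trans; have := sqr_ge0 (1 - t / 2); nra.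
Qed.

Lemma expR2D_le (z D : R) : `|D| <= 3^-1 ->
  expR2 (z + D) <= expR2 z + (expR z - 1) * D + expR z * D ^+ 2.
Proof.
move=> /expR_le_quadratic; rewrite -(ler_pM2l (expR_gt0 z)) -expRD /expR2 => H.
by nra.
Qed.

Lemma measurable_expR2 : measurable_fun setT expR2.
Proof.
by apply: measurable_funB => //; apply: measurable_funB.
Qed.

Context (mu : probability R R).

(** The centred first-order term integrates to 0, and [exp z <= 2 * expR2 z + 2] splits the
    quadratic one. The part with [expR2 z] uses the uniform bound [v] and becomes a growth factor;
    the constant part keeps the actual second moment, which remains integrable in [x]. *)
Lemma integral_expR2_le (F : R -> R) (M z lam v : R) : measurable_fun setT F ->
  (forall u, `|F u| <= M) -> `|lam| * (2 * M) <= 3^-1 ->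
  (\int[mu]_u ((F u) ^+ 2)%:E <= v%:E)%E ->
  (\int[mu]_u (expR2 (z + lam * (F u - \int[mu]_t F t)))%:E <=
    (1 + 2 * lam ^+ 2 * v)%:E * (expR2 z)%:E + (2 * lam ^+ 2)%:E * \int[mu]_u ((F u) ^+ 2)%:E)%E.
Proof.
move=> mF FM lamM Fv; set m := \int[mu]_t F t.
have mM : `|m| <= M by exact: Rintegral_norm_le.
have M0 : 0 <= M by rewrite (le_trans _ mM).
have FmM u : `|F u - m| <= 2 * M.
  by rewrite (le_trans (ler_normB _ _))// mulr_natl mulr2n lerD.
have D3 u : `|lam * (F u - m)| <= 3^-1.
  by rewrite normrM (le_trans _ lamM)// ler_wpM2l.
have mFm : measurable_fun setT (fun u => F u - m) by exact: measurable_funB.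
have iFm : mu.-integrable setT (EFin \o (fun u => F u - m)).
  exact: (@bounded_integrable _ _ _ mu _ (2 * M)).
have iF2 : mu.-integrable setT (EFin \o (fun u => F u ^+ 2)).
  apply: (@bounded_integrable _ _ _ mu _ (M ^+ 2)) => [|u]; first exact: measurable_funX.
  by rewrite normrX lerXn2r// nnegrE.
have iFm2 : mu.-integrable setT (EFin \o (fun u => (F u - m) ^+ 2)).
  apply: (@bounded_integrable _ _ _ mu _ ((2 * M) ^+ 2)) => [|u]; first exact: measurable_funX.
  by rewrite normrX lerXn2r// nnegrE// mulr_ge0.
set V := \int[mu]_u (F u ^+ 2); set W := \int[mu]_u ((F u - m) ^+ 2).
have V0 : 0 <= V by apply: Rintegral_ge0 => u _; exact: sqr_ge0.
have W0 : 0 <= W by apply: Rintegral_ge0 => u _; exact: sqr_ge0.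
have WV : W <= V.
  have := @sqr_centered_le _ _ _ mu F M 0 0 mF FM.
  rewrite -lee_fin /W /V -!EFin_Rintegral//= expr0n adde0 -/m.
  under eq_integral do rewrite addr0.
  by under [X in (_ <= X)%E -> _]eq_integral do rewrite subr0.
have Vv : V <= v by rewrite -lee_fin /V -EFin_Rintegral.
have z0 := expR2_ge0 z; have ez := expR_ge0 z; have ez2 := expR_le_expR2 z.
apply: (@le_trans _ _ (\int[mu]_u (expR2 z + (expR z - 1) * lam * (F u - m) + expR z * lam ^+ 2 * (F u - m) ^+ 2)%:E)%E).
  apply: ge0_le_integral => //.
  - by move=> u _; rewrite lee_fin expR2_ge0.
  - apply/measurable_EFinP; apply: (measurableT_comp measurable_expR2).
    by apply: measurable_funD => //; exact: measurable_funM.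
  - by apply/measurable_EFinP; apply: measurable_funD;
      [apply: measurable_funD => //; exact: measurable_funM|apply: measurable_funM => //; exact: measurable_funX].
  - by move=> u _; rewrite lee_fin (le_trans (expR2D_le _ (D3 u)))// exprMn !mulrA.
have i1 : mu.-integrable setT (EFin \o (fun u => (expR z - 1) * lam * (F u - m))).
  apply: (@bounded_integrable _ _ _ mu _ (`|(expR z - 1) * lam| * (2 * M))) => [|u].
    exact: measurable_funM.
  by rewrite normrM ler_wpM2l.
have i2 : mu.-integrable setT (EFin \o (fun u => expR z * lam ^+ 2 * (F u - m) ^+ 2)).
  apply: (@bounded_integrable _ _ _ mu _ (`|expR z * lam ^+ 2| * (2 * M) ^+ 2)) => [|u].
    by apply: measurable_funM => //; exact: measurable_funX.
  by rewrite normrM ler_wpM2l// normrX lerXn2r// nnegrE// mulr_ge0.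
have i0 (c : R) : mu.-integrable setT (EFin \o (fun u => c)).
  by apply: (@bounded_integrable _ _ _ mu _ `|c|).
have i01 : mu.-integrable setT (EFin \o (fun u => expR2 z + (expR z - 1) * lam * (F u - m))).
  exact: (integrableD measurableT (i0 (expR2 z)) i1).
have i012 : mu.-integrable setT (EFin \o (fun u => expR2 z + (expR z - 1) * lam * (F u - m) + expR z * lam ^+ 2 * (F u - m) ^+ 2)).
  exact: (integrableD measurableT i01 i2).
have Fm0 : \int[mu]_u (F u - m) = 0.
  rewrite RintegralB//; last exact: (@bounded_integrable _ _ _ mu _ M).
  by rewrite Rintegral_prob_cst -/m subrr.
rewrite EFin_Rintegral// EFin_Rintegral// -/V.
rewrite RintegralD// RintegralD// Rintegral_prob_cst RintegralZl// RintegralZl// Fm0 mulr0 addr0 -/W.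
rewrite -!EFinM -EFinD lee_fin.
have l2 := sqr_ge0 lam.
apply: (@le_trans _ _ (expR2 z + (2 * expR2 z + 2) * (lam ^+ 2 * V))).
  rewrite lerD2l -mulrA; apply: ler_pM => //; first by rewrite mulr_ge0.
  by rewrite ler_wpM2l.
have : expR2 z * (lam ^+ 2 * V) <= expR2 z * (lam ^+ 2 * v) by rewrite ler_wpM2l// ler_wpM2l.
nra.
Qed.

End exp_remainder.

Section kernel_martingale.
Context d (T : measurableType d) (R : realType) (P : probability T R).
Context (eps : int -> {RV P >-> R}) (mu : probability R R).
Hypothesis indep : mutually_independent P (fun i => (eps i : T -> R)).
Hypothesis law : forall j A, measurable A -> P (eps j @^-1` A) = mu A.
Local Notation leb := (@lebesgue_measure R).
Context (a0 : R) (Y : nat -> T -> R).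
Hypothesis mY : forall i : nat, measurable_fun [set: sigma_of eps (past i%:Z)] (Y i).

Lemma measurable_avg (c M : R) (k : R -> R) : measurable_fun setT k ->
  (forall x, `|k x| <= M) -> measurable_fun setT (avg mu c k).
Proof.
move=> mk kM.
have kM0 x : 0 <= k x + M by have := kM x; rewrite ler_norml => /andP[]; lra.
(* Adding [M] makes the integrand nonnegative, as Tonelli measurability requires. *)
pose I y := (\int[mu]_u (k (y - c * u) + M)%:E)%E.
have mI : measurable_fun setT I.
  apply: (@measurable_fun_fubini_tonelli_F _ _ _ _ _ mu (fun z : R * R => (k (z.1 - c * z.2) + M)%:E)) => /=.
    apply/measurable_EFinP; apply: measurable_funD => //.
    apply: (@measurableT_comp _ _ _ _ _ _ k) => //; apply: measurable_funB => //.
    exact: measurable_funM.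
  by move=> z; rewrite lee_fin.
have mkc y : measurable_fun setT (fun u => k (y - c * u)) by exact: measurable_comp_affine.
have ik y : mu.-integrable setT (EFin \o (fun u => k (y - c * u))).
  exact: (@bounded_integrable _ _ _ mu _ M).
have avgE : avg mu c k = (fun y => fine (I y) - M).
  apply/funext => y; rewrite /avg.
  have -> : fine (I y) = \int[mu]_u (k (y - c * u) + M) by [].
  rewrite RintegralD//; last exact: (@bounded_integrable _ _ _ mu _ `|M|).
  by rewrite Rintegral_prob_cst addrK.
rewrite avgE; apply: measurable_funB => //.
exact: (measurableT_comp (fine_measurable measurableT) mI).
Qed.

(** The subtracted average is the conditional mean of the kernel term given the innovations before
    time [i.+1]. Times run from 1 to [n], as in [kde]. *)
Definition kmart (k : R -> R) (n : nat) (x : R) (w : T) : R :=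
  \sum_(i < n) (k (x - Y i.+1 w - a0 * eps i.+1%:Z w) - avg mu a0 k (x - Y i.+1 w)).

Lemma measurable_YT i : measurable_fun [set: T] (Y i).
Proof. by apply: (@sigma_of_measurable_fun _ _ _ P _ eps (past i%:Z)); exact: mY. Qed.

Lemma measurable_kmartT (k : R -> R) (M : R) n : measurable_fun setT k ->
  (forall x, `|k x| <= M) -> measurable_fun [set: R * T] (fun z => kmart k n z.1 z.2).
Proof.
move=> mk kM; apply: measurable_sum => i.
have mxY : measurable_fun [set: R * T] (fun z => z.1 - Y i.+1 z.2).
  by apply: measurable_funB => //; exact: (measurableT_comp (measurable_YT i.+1)).
apply: measurable_funB.
  apply: (@measurableT_comp _ _ _ _ _ _ k) => //; apply: measurable_funB => //.
  by apply: measurable_funM => //; exact: measurableT_comp.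
by apply: (@measurableT_comp _ _ _ _ _ _ (avg mu a0 k)) => //; exact: measurable_avg kM.
Qed.

Lemma measurable_kmart (k : R -> R) (M : R) n x : measurable_fun setT k ->
  (forall x, `|k x| <= M) ->
  measurable_fun [set: sigma_of eps (past n.+1%:Z)] (kmart k n x).
Proof.
move=> mk kM; apply: measurable_sum => i.
have mxY : measurable_fun [set: sigma_of eps (past n.+1%:Z)] (fun w => x - Y i.+1 w).
  apply: measurable_funB => //; apply: (@sigma_of_subset _ _ _ P _ eps (past i.+1%:Z)) => //.
  by move=> j; rewrite /past/= => /lt_le_trans; apply; rewrite lez_nat ltnS ltnW.
apply: measurable_funB.
  apply: (@measurableT_comp _ _ _ _ _ _ k) => //; apply: measurable_funB => //.
  apply: measurable_funM => //; apply: measurable_sigma_of.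
  by rewrite /past/= ltz_nat ltnS.
by apply: (@measurableT_comp _ _ _ _ _ _ (avg mu a0 k)) => //; exact: measurable_avg kM.
Qed.

Lemma kmart_step (k : R -> R) (M v lam : R) n x : measurable_fun setT k ->
  (forall x, `|k x| <= M) ->
  (forall y, \int[mu]_u (k (y - a0 * u) ^+ 2)%:E <= v%:E)%E ->
  `|lam| * (2 * M) <= 3^-1 -> 0 <= v ->
  (\int[P]_w (expR2 (lam * kmart k n.+1 x w))%:E <=
   (1 + 2 * lam ^+ 2 * v)%:E * \int[P]_w (expR2 (lam * kmart k n x w))%:E +
   (2 * lam ^+ 2)%:E *
     \int[P]_w (k (x - Y n.+1 w - a0 * eps n.+1%:Z w) ^+ 2)%:E)%E.
Proof.
move=> mk kM kv lamM v0.
pose j := n.+1%:Z.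
have pj : ~ past j j by rewrite /past/= ltxx.
pose Q := sigma_of eps (past j).
have l2 : 0 <= lam ^+ 2 by exact: sqr_ge0.
have mk2 : measurable_fun setT (fun x => k x ^+ 2) by exact: measurable_funX.
have mZ : measurable_fun [set: Q] (kmart k n x) by exact: measurable_kmart kM.
have mYn : measurable_fun [set: Q] (Y n.+1) by exact: mY.
have mav := measurable_avg a0 mk kM.
pose Psi (z : Q * R) := expR2 (lam * kmart k n x z.1 +
   lam * (k (x - Y n.+1 z.1 - a0 * z.2) - avg mu a0 k (x - Y n.+1 z.1))).
have mxYu : measurable_fun [set: Q * R] (fun z => x - Y n.+1 z.1 - a0 * z.2).
  apply: measurable_funB; last exact: measurable_funM.
  by apply: measurable_funB => //; exact: (measurableT_comp mYn).
have mPsi : measurable_fun setT Psi.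
  apply: (measurableT_comp (@measurable_expR2 R)).
  apply: measurable_funD.
    by apply: measurable_funM => //; exact: (measurableT_comp mZ).
  apply: measurable_funM => //; apply: measurable_funB.
    exact: (measurableT_comp mk).
  apply: (measurableT_comp mav); apply: measurable_funB => //.
  exact: (measurableT_comp mYn).
pose Phi (z : Q * R) := k (x - Y n.+1 z.1 - a0 * z.2) ^+ 2.
have mPhi : measurable_fun setT Phi.
  by apply: measurable_funX; exact: (measurableT_comp mk).
have PsiE z : (0 <= (Psi z)%:E)%E by rewrite lee_fin expR2_ge0.
have PhiE z : (0 <= (Phi z)%:E)%E by rewrite lee_fin sqr_ge0.
have mPsiE : measurable_fun [set: Q * R] (fun z => (Psi z)%:E) by exact/measurable_EFinP.
have mPhiE : measurable_fun [set: Q * R] (fun z => (Phi z)%:E) by exact/measurable_EFinP.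
have -> : (\int[P]_w (expR2 (lam * kmart k n.+1 x w))%:E = \int[P]_w (Psi (w, eps j w))%:E)%E.
  by apply: eq_integral => w _; rewrite /kmart big_ord_recr/= mulrDr.
have -> : (\int[P]_w (k (x - Y n.+1 w - a0 * eps n.+1%:Z w) ^+ 2)%:E = \int[P]_w (Phi (w, eps j w))%:E)%E by [].
rewrite (@integral_indep_law _ _ _ _ _ mu indep law (past j) j (fun z => (Psi z)%:E))//.
rewrite (@integral_indep_law _ _ _ _ _ mu indep law (past j) j (fun z => (Phi z)%:E))//.
have mE : measurable_fun [set: T] (fun w => (expR2 (lam * kmart k n x w))%:E).
  apply/measurable_EFinP; apply: (measurableT_comp (@measurable_expR2 R)).
  apply: measurable_funM => //; exact: (@sigma_of_measurable_fun _ _ _ P _ eps (past j)).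
have mIPhi : measurable_fun [set: T] (fun w => \int[mu]_u (Phi (w, u))%:E)%E.
  apply: (@sigma_of_measurable_fun _ _ _ P _ eps (past j)).
  exact: (@measurable_fun_fubini_tonelli_F _ _ _ _ _ mu (fun z : Q * R => (Phi z)%:E)).
have mIPsi : measurable_fun [set: T] (fun w => \int[mu]_u (Psi (w, u))%:E)%E.
  apply: (@sigma_of_measurable_fun _ _ _ P _ eps (past j)).
  exact: (@measurable_fun_fubini_tonelli_F _ _ _ _ _ mu (fun z : Q * R => (Psi z)%:E)).
rewrite -ge0_integralZl_EFin//; last 2 first.
- by move=> w _; rewrite lee_fin expR2_ge0.
- by rewrite addr_ge0// mulr_ge0// mulr_ge0.
rewrite -ge0_integralZl_EFin//; last 2 first.
- by move=> w _; apply: integral_ge0 => u _.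
- by rewrite mulr_ge0.
rewrite -ge0_integralD//; last 4 first.
- by move=> w _; rewrite -EFinM lee_fin mulr_ge0 ?expR2_ge0// addr_ge0// mulr_ge0// mulr_ge0.
- exact: emeasurable_funM.
- by move=> w _; apply: mule_ge0; [rewrite lee_fin mulr_ge0|apply: integral_ge0].
- exact: emeasurable_funM.
apply: ge0_le_integral => //.
- by move=> w _; apply: integral_ge0.
- by apply: emeasurable_funD; exact: emeasurable_funM.
- move=> w _.
  have := @integral_expR2_le _ mu (fun u => k (x - Y n.+1 w - a0 * u)) M
    (lam * kmart k n x w) lam v (measurable_comp_affine _ _ mk)
    (fun u => kM _) lamM (kv (x - Y n.+1 w)).
  by rewrite /Psi /Phi /avg.
Qed.

(** By translation invariance the second moment of each increment, integrated over [x], is the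
    integral of [k^2] whatever the past. So a step multiplies the bound by [1 + 2 * lam^2 * v] and
    adds at most [2 * lam^2 * ka]. *)
Lemma kmart_exp (k : R -> R) (M ka v lam : R) n : measurable_fun setT k ->
  (forall x, `|k x| <= M) ->
  (\int[leb]_y (k y ^+ 2)%:E <= ka%:E)%E ->
  (forall y, \int[mu]_u (k (y - a0 * u) ^+ 2)%:E <= v%:E)%E ->
  `|lam| * (2 * M) <= 3^-1 -> 0 <= ka -> 0 <= v ->
  (\int[leb]_x \int[P]_w (expR2 (lam * kmart k n x w))%:E <=
   (n%:R * (2 * lam ^+ 2 * ka) * (1 + 2 * lam ^+ 2 * v) ^+ n)%:E)%E.
Proof.
move=> mk kM kka kv lamM ka0 v0.
have l2 : 0 <= lam ^+ 2 by exact: sqr_ge0.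
have mk2 : measurable_fun setT (fun x => k x ^+ 2) by exact: measurable_funX.
have l2v : 0 <= 1 + 2 * lam ^+ 2 * v by rewrite addr_ge0// mulr_ge0// mulr_ge0.
have mEn n' : measurable_fun [set: R * T] (fun z => (expR2 (lam * kmart k n' z.1 z.2))%:E).
  apply/measurable_EFinP; apply: (measurableT_comp (@measurable_expR2 R)).
  by apply: measurable_funM => //; exact: measurable_kmartT kM.
have En0 n' (z : R * T) : (0 <= (expR2 (lam * kmart k n' z.1 z.2))%:E)%E.
  by rewrite lee_fin expR2_ge0.
have mIE n' : measurable_fun [set: R] (fun x => \int[P]_w (expR2 (lam * kmart k n' x w))%:E)%E.
  exact: (@measurable_fun_fubini_tonelli_F _ _ _ _ _ P (fun z : R * T => (expR2 (lam * kmart k n' z.1 z.2))%:E)).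
elim: n => [|n IH].
  rewrite integral0_eq ?mul0r// => x _; rewrite integral0_eq// => w _.
  by rewrite /kmart big_ord0 mulr0 expR2_0.
pose Phi (z : R * T) := k (z.1 - Y n.+1 z.2 - a0 * eps n.+1%:Z z.2) ^+ 2.
have mPhi : measurable_fun setT (fun z => (Phi z)%:E).
  apply/measurable_EFinP; apply: measurable_funX; apply: (measurableT_comp mk).
  apply: measurable_funB; last by apply: measurable_funM => //; exact: measurableT_comp.
  by apply: measurable_funB => //; exact: (measurableT_comp (measurable_YT n.+1)).
have Phi0 z : (0 <= (Phi z)%:E)%E by rewrite lee_fin sqr_ge0.
have mIPhi : measurable_fun [set: R] (fun x => \int[P]_w (Phi (x, w))%:E)%E.
  exact: (@measurable_fun_fubini_tonelli_F _ _ _ _ _ P (fun z : R * T => (Phi z)%:E)).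
have m1 : measurable_fun [set: R] (fun x => (1 + 2 * lam ^+ 2 * v)%:E *
    \int[P]_w (expR2 (lam * kmart k n x w))%:E)%E by apply: emeasurable_funM.
have m2 : measurable_fun [set: R] (fun x => (2 * lam ^+ 2)%:E *
    \int[P]_w (Phi (x, w))%:E)%E by apply: emeasurable_funM.
apply: (@le_trans _ _ (\int[leb]_x ((1 + 2 * lam ^+ 2 * v)%:E * \int[P]_w (expR2 (lam * kmart k n x w))%:E +
   (2 * lam ^+ 2)%:E * \int[P]_w (Phi (x, w))%:E))%E).
  apply: ge0_le_integral => //.
  - by move=> x _; apply: integral_ge0 => w _; rewrite lee_fin expR2_ge0.
  - exact: mIE.
  - exact: (emeasurable_funD m1 m2).
  - by move=> x _; exact: kmart_step kM kv _ _.
rewrite ge0_integralD//; last 2 first.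
- by move=> x _; apply: mule_ge0; [rewrite lee_fin|apply: integral_ge0 => w _; rewrite lee_fin expR2_ge0].
- by move=> x _; apply: mule_ge0; [rewrite lee_fin mulr_ge0|apply: integral_ge0].
rewrite ge0_integralZl_EFin//; last 2 first.
- by move=> x _; apply: integral_ge0 => w _; rewrite lee_fin expR2_ge0.
- exact: mIE.
rewrite ge0_integralZl_EFin//; last 2 first.
- by move=> x _; apply: integral_ge0.
- by rewrite mulr_ge0.
rewrite (@fubini_tonelli _ _ _ _ _ leb P (fun z : R * T => (Phi z)%:E))//.
have -> : (\int[P]_w \int[leb]_x (Phi (x, w))%:E = \int[leb]_y (k y ^+ 2)%:E)%E.
  transitivity (\int[P]_w (\int[leb]_y (k y ^+ 2)%:E))%E; last exact: integral_prob_cst.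
  apply: eq_integral => w _.
  rewrite -(@ge0_integral_shift _ (Y n.+1 w + a0 * eps n.+1%:Z w) (fun y => (k y ^+ 2)%:E)).
  - by apply: eq_integral => x _; rewrite /Phi/= opprD addrA.
  - exact/measurable_EFinP.
  - by move=> y; rewrite lee_fin sqr_ge0.
apply: (@le_trans _ _ ((1 + 2 * lam ^+ 2 * v)%:E * (n%:R * (2 * lam ^+ 2 * ka) * (1 + 2 * lam ^+ 2 * v) ^+ n)%:E + (2 * lam ^+ 2)%:E * ka%:E)%E).
  by apply: leeD; apply: lee_wpmul2l => //; rewrite lee_fin// mulr_ge0.
rewrite -!EFinM -EFinD lee_fin.
set q := 1 + _ in l2v *; set b := 2 * lam ^+ 2 * ka; rewrite (exprS q).
have b0 : 0 <= b by rewrite /b mulr_ge0// mulr_ge0.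
have q1 : 1 <= q * q ^+ n.
  rewrite -exprS; apply: exprn_ege1; rewrite /q lerDl mulr_ge0// mulr_ge0//.
have : b * 1 <= b * (q * q ^+ n) by rewrite ler_wpM2l.
rewrite mulr1 => bq.
rewrite (_ : n.+1%:R * b * (q * q ^+ n) = q * (n%:R * b * q ^+ n) + b * (q * q ^+ n)).
  by rewrite lerD2l.
by rewrite -natr1; ring.
Qed.

End kernel_martingale.

(** * Mean value estimates and translations in L2 *)

Section calculus.
Context (R : realType).
Local Notation leb := (@lebesgue_measure R).

Lemma derivable_continuous (f : R -> R) : (forall x, derivable f x 1) -> continuous f.
Proof. by move=> df x; apply: differentiable_continuous; exact/derivable1_diffP. Qed.

Lemma mean_value (f : R -> R) : (forall x, derivable f x 1) ->
  forall x y, exists2 c, `|c - x| <= `|y - x| & f y - f x = derive1 f c * (y - x).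
Proof.
move=> df x y.
have dfE (z : R) : is_derive z (1 : R) f (derive1 f z).
  by rewrite derive1E; apply: derivableP.
have cf : forall a b : R, {within `[a, b], continuous f}.
  by move=> a b; apply: continuous_subspaceT; exact: derivable_continuous.
have [xy|/ltW yx] := leP x y.
  have [c] := MVT_segment xy (fun z _ => dfE z) (cf _ _).
  rewrite in_itv/= => /andP[xc cy] H; exists c => //.
  by rewrite !ger0_norm ?subr_ge0// lerD2r.
have [c] := MVT_segment yx (fun z _ => dfE z) (cf _ _).
rewrite in_itv/= => /andP[yc cx] H; exists c.
  by rewrite !ler0_norm ?subr_le0// !opprB lerD2l lerN2.
by rewrite -opprB H -mulrN opprB.
Qed.

Lemma bounded_derive_lipschitz (f : R -> R) (M : R) : (forall x, derivable f x 1) ->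
  (forall x, `|derive1 f x| <= M) -> forall x y, `|f x - f y| <= M * `|x - y|.
Proof.
move=> df fM x y; have [c _ ->] := mean_value df y x.
by rewrite normrM ler_wpM2r.
Qed.

(** Two mean value steps need only that the second derivative exists and is bounded, without
    continuity; the price is the factor 1/2. *)
Lemma taylor2_le (f : R -> R) (M : R) : (forall x, derivable f x 1) ->
  (forall x, derivable (derive1 f) x 1) -> (forall x, `|derive1 (derive1 f) x| <= M) ->
  forall x t, `|f (x + t) - f x - t * derive1 f x| <= M * t ^+ 2.
Proof.
move=> df ddf fM x t; have [c cx ->] := mean_value df x (x + t).
have e : x + t - x = t by ring.
rewrite e in cx *.
rewrite (_ : _ - _ = (derive1 f c - derive1 f x) * t); last by ring.
rewrite normrM -(real_normK (num_real t)) expr2 mulrA ler_wpM2r//.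
apply: le_trans (bounded_derive_lipschitz ddf fM c x) _.
rewrite ler_wpM2l//.
by rewrite (le_trans _ (fM 0)).
Qed.

(** The increment of [g] is an average of [s * g'] along the segment, [th] being uniform on the unit
    interval in the application. Jensen, Tonelli and translation invariance conclude. *)
Lemma L2_translation_avg (U : probability (measurableTypeR R) R) (g g' : R -> R) (M L s : R) :
  measurable_fun setT g -> measurable_fun setT g' -> (forall x, `|g' x| <= M) ->
  (forall y, \int[U]_th (s * g' (y - s + s * th)) = g y - g (y - s)) ->
  (\int[leb]_x (g' x ^+ 2)%:E <= L%:E)%E ->
  (\int[leb]_y ((g (y - s) - g y) ^+ 2)%:E <= (L * s ^+ 2)%:E)%E.
Proof.
move=> mg mg' gM phi_int gL.
pose phi (y th : R) := s * g' (y - s + s * th).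
have mphi y : measurable_fun setT (phi y).
  apply: measurable_funM => //; apply: (measurableT_comp mg').
  by apply: measurable_funD => //; exact: measurable_funM.
have phiB y th : `|phi y th| <= `|s| * M by rewrite normrM ler_wpM2l.
pose h (y : R) := g' y ^+ 2.
have mh : measurable_fun setT h by exact: measurable_funX.
have mh2 : measurable_fun setT (fun z : R * R => (s ^+ 2)%:E * (h (z.1 - s + s * z.2))%:E)%E.
  apply: emeasurable_funM => //; apply/measurable_EFinP; apply: (measurableT_comp mh).
  by apply: measurable_funD; [exact: measurable_funB|exact: measurable_funM].
have h20 (z : R * R) : (0 <= (s ^+ 2)%:E * (h (z.1 - s + s * z.2))%:E)%E.
  by rewrite -EFinM lee_fin mulr_ge0 ?sqr_ge0.
apply: (@le_trans _ _ (\int[leb]_y \int[U]_th ((s ^+ 2)%:E * (h (y - s + s * th))%:E))%E).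
  apply: ge0_le_integral => //.
  - by move=> y _; rewrite lee_fin sqr_ge0.
  - apply/measurable_EFinP; apply: measurable_funX; apply: measurable_funB => //.
    by apply: (measurableT_comp mg); exact: measurable_funB.
  - exact: (@measurable_fun_fubini_tonelli_F _ _ _ _ _ U (fun z : R * R => (s ^+ 2)%:E * (h (z.1 - s + s * z.2))%:E)%E).
  - move=> y _; rewrite -opprB sqrrN -phi_int.
    have := @sqr_Rintegral_le _ _ _ U _ _ (mphi y) (phiB y).
    move/le_trans; apply; rewrite le_eqVlt; apply/orP; left; apply/eqP.
    by apply: eq_integral => th _; rewrite -EFinM /phi exprMn.
rewrite (@fubini_tonelli _ _ _ _ _ leb U (fun z : R * R => (s ^+ 2)%:E * (h (z.1 - s + s * z.2))%:E)%E)//=.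
have -> : (\int[U]_th \int[leb]_y ((s ^+ 2)%:E * (h (y - s + s * th))%:E) =
  \int[U]_th ((s ^+ 2)%:E * \int[leb]_y (h y)%:E))%E.
  apply: eq_integral => th _; rewrite ge0_integralZl_EFin//; last 3 first.
  - by move=> y _; rewrite lee_fin sqr_ge0.
  - apply/measurable_EFinP; apply: (measurableT_comp mh).
    by apply: measurable_funD => //; exact: measurable_funB.
  - exact: sqr_ge0.
  congr (_ * _)%E; rewrite -(@ge0_integral_shift _ (s - s * th) (fun y => (h y)%:E)).
  - by apply: eq_integral => y _; rewrite opprB addrA addrAC.
  - exact/measurable_EFinP.
  - by move=> y; rewrite lee_fin sqr_ge0.
by rewrite integral_prob_cst (mulrC L) [leRHS]EFinM lee_wpmul2l// lee_fin sqr_ge0.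
Qed.

Lemma L2_translation (g : R -> R) (M L : R) : (forall x, derivable g x 1) ->
  continuous (derive1 g) -> (forall x, `|derive1 g x| <= M) ->
  (\int[leb]_x (derive1 g x ^+ 2)%:E <= L%:E)%E ->
  forall s, (\int[leb]_y ((g (y - s) - g y) ^+ 2)%:E <= (L * s ^+ 2)%:E)%E.
Proof.
move=> dg cg' gM gL s.
pose g' := derive1 g; pose U := uniform_prob (@ltr01 R).
have mg' : measurable_fun setT g' by exact: continuous_measurable_fun.
have mg : measurable_fun setT g by apply: continuous_measurable_fun; exact: derivable_continuous.
pose phi (y th : R) := s * g' (y - s + s * th).
have caff y : continuous (fun th : R => y - s + s * th).
  move=> th; apply: cvgD; first exact: cvg_cst.
  by apply: cvgM; [exact: cvg_cst|exact: cvg_id].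
have cphi y : continuous (phi y).
  move=> th; apply: cvgM; first exact: cvg_cst.
  exact: (continuous_comp (caff y th) (cg' _)).
have mphi y : measurable_fun setT (phi y) by exact: continuous_measurable_fun.
have phiB y th : `|phi y th| <= `|s| * M by rewrite normrM ler_wpM2l.
have phi_int y : \int[U]_th phi y th = g y - g (y - s).
  (* Adding [B] makes the integrand nonnegative, so that [integral_uniform] applies; [F] is a
     primitive of the shifted integrand in [th]. *)
  set B := `|s| * M.
  have phi0 th : 0 <= phi y th + B by have := phiB y th; rewrite -/B ler_norml => /andP[]; lra.
  pose F (th : R) := g (y - s + s * th) + B * th.
  have dF (th : R) : is_derive th (1 : R) F (phi y th + B).
    rewrite /F; apply: is_deriveD.
      have : is_derive th (1 : R) (g \o (fun th : R => y - s + s * th)) (g' (y - s + s * th) * s).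
        apply: is_derive1_comp; first by rewrite /g' derive1E; apply: derivableP.
        by apply: is_derive_eq; rewrite -[s%:A]/(s * 1); ring.
      by rewrite mulrC.
    by apply: is_derive_eq; rewrite -[B%:A]/(B * 1) mulr1.
  have cF : continuous F by apply: derivable_continuous => th; have [] := dF th.
  have FTC : (\int[leb]_(th in `[0%R, 1%R]) (phi y th + B)%:E = (F 1)%:E - (F 0)%:E)%E.
    apply: continuous_FTC2 => //.
    - apply: continuous_subspaceT => th; apply: cvgD; [exact: cphi|exact: cvg_cst].
    - split.
      + by move=> th _; have [] := dF th.
      + by apply: cvg_at_right_filter; exact: cF.
      + by apply: cvg_at_left_filter; exact: cF.
    - by move=> th _; rewrite derive1E; apply: derive_val.
  have : (\int[U]_th (phi y th + B)%:E = (F 1)%:E - (F 0)%:E)%E.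
    rewrite integral_uniform//; last first.
      by apply/measurable_EFinP; apply: measurable_funD => //; exact: mphi.
    by rewrite subr0 invr1 mul1e.
  have iphi : U.-integrable setT (EFin \o phi y) by exact: (@bounded_integrable _ _ _ U _ B (mphi y) (phiB y)).
  have iB : U.-integrable setT (EFin \o (fun=> B)) by exact: (@bounded_integrable _ _ _ U _ `|B|).
  rewrite EFin_Rintegral//; last exact: (integrableD measurableT iphi iB).
  rewrite RintegralD// Rintegral_prob_cst -EFinB => -[].
  rewrite /F !mulr1 !mulr0 !addr0 subrK => H.
  by lra.
exact: (L2_translation_avg mg mg' gM phi_int gL).
Qed.

Lemma nice_of_derive (g : R -> R) (B M L : R) : (forall x, `|g x| <= B) ->
  (forall x, derivable g x 1) ->
  continuous (derive1 g) -> (forall x, `|derive1 g x| <= M) ->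
  (\int[leb]_x (derive1 g x ^+ 2)%:E <= L%:E)%E -> nice B M L g.
Proof.
move=> gB dg cg' gM gL; split => //; first exact: bounded_derive_lipschitz.
exact: L2_translation gM gL.
Qed.

Lemma nice_scale (g : R -> R) (B M L a c : R) : a != 0 -> nice B M L g ->
  nice (`|c| * B) (`|c| * M / `|a|) (c ^+ 2 * L / `|a|) (fun t => c * g (t / a)).
Proof.
move=> a0 ng; have [gB gL gL2] := ng; have mg := nice_measurable ng.
have na : 0 < `|a| by rewrite normr_gt0.
split.
- by move=> x; rewrite normrM ler_wpM2l.
- move=> x y; rewrite -mulrBr normrM -!mulrA ler_wpM2l//.
  apply: le_trans (gL _ _) _.
  by rewrite -mulrBl normrM normfV [`|x - y| * _]mulrC.
- move=> s.
  pose D (y : R) := (g (y - s / a) - g y) ^+ 2.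
  have mD : measurable_fun setT D.
    apply: measurable_funX; apply: measurable_funB => //.
    by apply: (measurableT_comp mg); exact: measurable_funB.
  have D0 y : (0 <= (D y)%:E)%E by rewrite lee_fin sqr_ge0.
  have mDa : measurable_fun setT (fun y : R => D (a^-1 * y + 0)).
    by apply: (measurableT_comp mD); exact: measurable_affine.
  have -> : (\int[leb]_y ((c * g ((y - s) / a) - c * g (y / a)) ^+ 2)%:E =
     (c ^+ 2)%:E * \int[leb]_y (D (a^-1 * y + 0))%:E)%E.
    rewrite -ge0_integralZl_EFin//; last 2 first.
    - exact/measurable_EFinP.
    - exact: sqr_ge0.
    apply: eq_integral => y _; rewrite -EFinM /D -exprMn mulrBr addr0.
    by rewrite mulrBl ![_^-1 * _]mulrC.
  have := @ge0_integral_affine _ a^-1 0 (fun y => (D y)%:E).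
  rewrite invr_eq0 => /(_ a0); rewrite normfV => /(_ _ _)/(congr1 (fun z => `|a|%:E * z)%E).
  rewrite muleA -EFinM mulfV ?gt_eqF// mul1e => <- //; last exact/measurable_EFinP.
  rewrite muleA -EFinM.
  apply: (@le_trans _ _ ((c ^+ 2 * `|a|)%:E * (L * (s / a) ^+ 2)%:E)%E).
    by apply: lee_wpmul2l; [rewrite lee_fin mulr_ge0// sqr_ge0|exact: gL2].
  rewrite -EFinM lee_fin exprMn exprVn -(real_normK (num_real a)).
  by rewrite le_eqVlt; apply/orP; left; apply/eqP; field; rewrite gt_eqF.
Qed.

(** A nonzero difference persists on a ball, which has positive measure. *)
Lemma continuous_ae_eq (f g : R -> R) : continuous f -> continuous g ->
  {ae leb, forall x, f x = g x} -> forall x, f x = g x.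
Proof.
move=> cf cg [N [mN N0 fgN]] x; apply: contrapT => fgx.
have cfg : continuous (fun y => f y - g y) by move=> y; apply: cvgB; [exact: cf|exact: cg].
have : f x - g x != 0 by rewrite subr_eq0; apply/eqP.
rewrite -normr_gt0 => fg0.
have /cvgrPdist_lt/(_ _ fg0) := cfg x.
move=> /nbhs_ballP[r /= r0 Hr].
have : (leb (ball x r) <= leb N)%E.
  rewrite le_measure ?inE//; first exact: measurable_ball.
  move=> y /Hr /= H; apply: fgN => /= fgy.
  by move: H; rewrite fgy subrr subr0 ltxx.
rewrite N0 (lebesgue_measure_ball _ (ltW r0)) => H.
have : (0 < (r *+ 2)%:E)%E by rewrite lte_fin pmulrn_lgt0.
by rewrite ltNge H.
Qed.

End calculus.

(** * Linear processes *)

Section process.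
Context d (T : measurableType d) (R : realType) (P : probability T R).
Context (eps : int -> {RV P >-> R}) (mu : probability R R).
Hypothesis indep : mutually_independent P (fun i => (eps i : T -> R)).
Hypothesis law : forall j A, measurable A -> P (eps j @^-1` A) = mu A.
Local Notation leb := (@lebesgue_measure R).
Context (s2 : R).
Hypothesis mus2 : (\int[mu]_u (u ^+ 2)%:E <= s2%:E)%E.
Context (a : nat -> R).
Hypothesis cva : cvgn (series (fun i => `|a i|)).
Let A := limn (series (fun i => `|a i|)).

Lemma sum_abs_le n : \sum_(i < n) `|a i| <= A.
Proof.
rewrite -(big_mkord xpredT (fun i => `|a i|)).
apply: (nondecreasing_cvgn_le _ cva n).
by apply: nondecreasing_series => i _ _; rewrite normr_ge0.
Qed.

(** The past part [Y_n]. Defined by [limn] at every sample point, it is measurable with respect to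
    the past everywhere; the splitting of the linear process holds only almost surely. *)
Definition tail_process (n : nat) (w : T) : R :=
  limn (series (fun l : nat => a l.+1 * eps (n%:Z - l.+1%:Z) w)).

Definition tail_trunc (J n : nat) (w : T) : R :=
  series (fun l : nat => a l.+1 * eps (n%:Z - l.+1%:Z) w) J.

Lemma measurable_tail_trunc J n :
  measurable_fun [set: sigma_of eps (past n%:Z)] (tail_trunc J n).
Proof.
apply: measurable_sum => l; apply: measurable_funM => //.
by apply: measurable_sigma_of; rewrite /past/= gtrDl oppr_lt0.
Qed.

Lemma measurable_tail_process n :
  measurable_fun [set: sigma_of eps (past n%:Z)] (tail_process n).
Proof.
apply: (@measurable_fun_limn_real _ (sigma_of eps (past n%:Z)) R (fun J => tail_trunc J n)).
by move=> J; exact: measurable_tail_trunc.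
Qed.

Lemma measurable_linear_process n :
  measurable_fun [set: T] (linear_process a (fun i => eps i) n).
Proof.
apply: (@measurable_fun_limn_real _ T R (fun J w => series (fun l : nat => a l * eps (n%:Z - l%:Z) w) J)).
move=> J; apply: measurable_sum => l; exact: measurable_funM.
Qed.

Lemma integral_abs_le j : (\int[P]_w `|eps j w|%:E <= (1 + s2)%:E)%E.
Proof.
rewrite (@integral_law _ _ _ _ _ mu law j (fun u => `|u|%:E)); last 2 first.
- by apply/measurable_EFinP; exact: normr_measurable.
- by move=> u; rewrite lee_fin.
have mx2 : measurable_fun setT (fun u : R => (u ^+ 2)%:E).
  by apply/measurable_EFinP; exact: measurable_funX.
apply: (@le_trans _ _ (\int[mu]_u (1%:E + (u ^+ 2)%:E))%E).
  apply: ge0_le_integral => //.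
  - by apply/measurable_EFinP; exact: normr_measurable.
  - exact: emeasurable_funD.
  - move=> u _; rewrite -EFinD lee_fin.
    by have := sqr_ge0 (`|u| - 1); rewrite -(real_normK (num_real u)); have := normr_ge0 u; nra.
rewrite ge0_integralD//; last by move=> u _; rewrite lee_fin sqr_ge0.
by rewrite integral_prob_cst EFinD leeD2l.
Qed.

(** The expected sum of absolute values is at most [A * (1 + s2)], because [|u| <= 1 + u^2]. *)
Lemma ae_summable : {ae P, forall w, forall n : nat,
  cvgn (series (fun l : nat => `|a l * eps (n%:Z - l%:Z) w|))}.
Proof.
apply/ae_foralln => n.
have mt l : measurable_fun [set: T] (fun w => `|a l * eps (n%:Z - l%:Z) w|%:E).
  by apply/measurable_EFinP; apply: measurableT_comp => //; exact: measurable_funM.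
pose S w := (\sum_(0 <= l <oo) `|a l * eps (n%:Z - l%:Z) w|%:E)%E.
have S0 w : (0 <= S w)%E by apply: nneseries_ge0 => l _ _; rewrite lee_fin.
have mS : measurable_fun [set: T] S by apply: ge0_emeasurable_sum => // l w _ _; rewrite lee_fin.
have iS : P.-integrable [set: T] S.
  apply/integrableP; split => //.
  under eq_integral do rewrite gee0_abs//.
  rewrite /S integral_nneseries//.
  apply: (@le_lt_trans _ _ ((A * (1 + s2))%:E)); last exact: ltry.
  have s20 : 0 <= s2.
    by rewrite -lee_fin; apply: le_trans mus2; apply: integral_ge0 => u _; rewrite lee_fin sqr_ge0.
  apply: lime_le; first by apply: is_cvg_nneseries => l _ _; apply: integral_ge0 => w _; rewrite lee_fin.
  apply: nearW => k.
  apply: (@le_trans _ _ (\sum_(0 <= l < k) (`|a l| * (1 + s2))%:E)%E).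
    apply: lee_sum => l _.
    under eq_integral do rewrite normrM EFinM.
    rewrite ge0_integralZl_EFin//; last by apply/measurable_EFinP; exact: measurableT_comp.
    by rewrite EFinM lee_wpmul2l// integral_abs_le.
  rewrite sumEFin lee_fin -mulr_suml ler_wpM2r ?addr_ge0// big_mkord.
  exact: sum_abs_le.
have := integrable_ae measurableT iS; apply: filterS => w /(_ I) Sf.
apply: nondecreasing_is_cvgn; first by apply: nondecreasing_series => l _ _.
exists (fine (S w)) => _ [k _ <-].
rewrite -lee_fin fineK// /series/= -sumEFin.
apply: nneseries_lim_ge => l _ _; by rewrite lee_fin.
Qed.

Lemma linear_process_split : {ae P, forall w, forall n : nat,
  (tail_trunc J n w @[J --> \oo] --> tail_process n w) /\
  linear_process a (fun i => eps i) n w = a 0 * eps n%:Z w + tail_process n w}.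
Proof.
apply: filterS ae_summable => w cvw n.
have cv : cvgn (series (fun l : nat => a l * eps (n%:Z - l%:Z) w)) by apply: normed_cvg; exact: cvw.
pose u := fun l : nat => a l * eps (n%:Z - l%:Z) w.
have E J : series (fun l => u l.+1) J = series u J.+1 - u 0.
  by rewrite /series/= big_nat_recl// addrAC subrr add0r.
have cvt : series (fun l => u l.+1) J @[J --> \oo] --> limn (series u) - u 0.
  under eq_fun do rewrite E.
  by apply: cvgB; [rewrite (cvg_shiftS (series u)); exact: cv|exact: cvg_cst].
have tE : tail_process n w = limn (series u) - u 0 by apply/cvg_lim.
split; first by rewrite tE.
by rewrite tE /linear_process -/u /u subr0 addrC subrK.
Qed.

End process.

Lemma limn_einf_le (R : realType) (u : nat -> \bar R) (c : \bar R) :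
  (forall n, u n <= c)%E -> (limn_einf u <= c)%E.
Proof.
move=> uc; rewrite limn_einf_lim; apply: lime_le; first exact: is_cvg_einfs.
apply: nearW => n; apply: le_trans (uc n).
by apply: ereal_inf_lbound; exists n => /=.
Qed.

Lemma limn_esup_le_near (R : realType) (u : nat -> \bar R) (c : \bar R) :
  (\forall n \near \oo, (u n <= c)%E) -> (limn_esup u <= c)%E.
Proof.
move=> [N _ uc]; rewrite limn_esup_lim; apply: lime_le; first exact: is_cvg_esups.
exists N => // n /= Nn; apply: ge_ereal_sup => _ [k /= nk <-].
by apply: uc => /=; exact: leq_trans nk.
Qed.

(* Lebesgue measure lives on [measurableTypeR R], whose display differs from that of [R]. *)
Lemma ge0_integral_lebesgue_density (R : realType) (nu : {measure set R -> \bar R})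
    (f : R -> R) : measurable_fun setT f -> (forall x, 0 <= f x) ->
  (forall A, measurable A -> nu A = \int[lebesgue_measure]_(x in A) (f x)%:E)%E ->
  forall phi : R -> \bar R, measurable_fun setT phi -> (forall x, 0 <= phi x)%E ->
  (\int[nu]_x phi x = \int[lebesgue_measure]_x (phi x * (f x)%:E))%E.
Proof.
move=> mf f0 nuE phi mphi phi0.
have mid : measurable_fun [set: R] (id : R -> measurableTypeR R).
  by move=> _ A mA; rewrite setTI.
rewrite -(@ge0_integral_density _ _ _ lebesgue_measure (pushforward_measure nu mid) f)//.
exact/esym/(@ge0_integral_pushforward _ _ _ _ _ _ mid nu setT phi measurableT mphi (fun x _ => phi0 x)).
Qed.

Section density_of_process.
Context d (T : measurableType d) (R : realType) (P : probability T R).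
Context (eps : int -> {RV P >-> R}) (mu : probability R R).
Hypothesis indep : mutually_independent P (fun i => (eps i : T -> R)).
Hypothesis law : forall j A, measurable A -> P (eps j @^-1` A) = mu A.
Local Notation leb := (@lebesgue_measure R).
Context (s2 : R).
Hypothesis mus2 : (\int[mu]_u (u ^+ 2)%:E <= s2%:E)%E.
Context (a : nat -> R).
Hypothesis cva : cvgn (series (fun i => `|a i|)).
Hypothesis a0 : a 0 != 0.
Context (fe : R -> R).
Hypothesis mfe : measurable_fun setT fe.
Hypothesis fe0 : forall x, 0 <= fe x.
Hypothesis mufe : forall A, measurable A -> mu A = (\int[leb]_(x in A) (fe x)%:E)%E.

Definition scaled_density (t : R) : R := `|a 0|^-1 * fe (t / a 0).
Local Notation g := scaled_density.

Lemma scaled_density_ge0 t : 0 <= g t.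
Proof. by rewrite mulr_ge0// invr_ge0. Qed.

Lemma measurable_scaled_density : measurable_fun setT g.
Proof. by apply: measurable_funM => //; apply: (measurableT_comp mfe); exact: measurable_funM. Qed.

Lemma integral_law_scaled (k : R -> \bar R) (y : R) : measurable_fun setT k ->
  (forall x, 0 <= k x)%E ->
  (\int[mu]_u k (a 0 * u + y)%R = \int[leb]_x (k x * (g (x - y)%R)%:E))%E.
Proof.
move=> mk k0.
have mg := measurable_scaled_density.
rewrite (ge0_integral_lebesgue_density mfe fe0 mufe); last 2 first.
- by apply: (measurableT_comp mk); exact: measurable_affine.
- by move=> x; exact: k0.
rewrite (@ge0_integral_affine _ (a 0) y (fun x => k x * (g (x - y)%R)%:E)%E)//; last 2 first.
- apply: emeasurable_funM => //; apply/measurable_EFinP; apply: (measurableT_comp mg).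
  exact: measurable_funB.
- by move=> x; rewrite mule_ge0// lee_fin scaled_density_ge0.
rewrite -ge0_integralZl_EFin//; last 2 first.
- by move=> x _; rewrite mule_ge0// lee_fin scaled_density_ge0.
- apply: emeasurable_funM; first by apply: (measurableT_comp mk); exact: measurable_affine.
  apply/measurable_EFinP; apply: (measurableT_comp mg); apply: measurable_funB => //.
  exact: measurable_affine.
apply: eq_integral => u _; rewrite addrK /scaled_density [(a 0 * u)%R]mulrC mulfK//.
by rewrite muleCA -EFinM mulrA mulfV ?normr_eq0// mul1r.
Qed.

Context (B L1 L2 : R).
Hypothesis ng : nice B L1 L2 g.
Local Notation Y := (tail_process eps a).

Lemma measurable_tailT n : measurable_fun [set: T] (Y n).
Proof.
by apply: (@sigma_of_measurable_fun _ _ _ P _ eps (past n%:Z)); exact: measurable_tail_process.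
Qed.

(** The conditional density of the process given the past, averaged over the past. *)
Definition marginal (n : nat) (x : R) : R := \int[P]_w g (x - Y n w).

Lemma measurable_gshift (V : T -> R) x : measurable_fun [set: T] V ->
  measurable_fun [set: T] (fun w => g (x - V w)).
Proof.
move=> mV; apply: (measurableT_comp measurable_scaled_density).
exact: measurable_funB.
Qed.

Lemma integrable_gshift (V : T -> R) x : measurable_fun [set: T] V ->
  P.-integrable [set: T] (EFin \o (fun w => g (x - V w))).
Proof.
move=> mV; have [gB _ _] := ng.
apply: (@bounded_integrable _ _ _ P _ B) => [|w]; [exact: measurable_gshift|exact: gB].
Qed.

Lemma gshift_lipschitz (V : T -> R) x y : measurable_fun [set: T] V ->
  `|\int[P]_w g (x - V w) - \int[P]_w g (y - V w)| <= L1 * `|x - y|.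
Proof.
move=> mV; have [gB gL _] := ng.
rewrite -RintegralB//; [|exact: integrable_gshift..].
apply: Rintegral_norm_le.
  by apply: measurable_funB; exact: measurable_gshift.
by move=> w; apply: le_trans (gL _ _) _; rewrite opprB addrA subrK.
Qed.

Lemma marginal_lipschitz n x y : `|marginal n x - marginal n y| <= L1 * `|x - y|.
Proof. exact: gshift_lipschitz (measurable_tailT n). Qed.

Lemma marginal_bound n x : `|marginal n x| <= B.
Proof.
have [gB _ _] := ng.
by apply: Rintegral_norm_le; [exact/measurable_gshift/measurable_tailT|move=> w; exact: gB].
Qed.

Lemma marginal_ge0 n x : 0 <= marginal n x.
Proof. by apply: Rintegral_ge0 => w _; exact: scaled_density_ge0. Qed.

(** Integrating out the innovation at time [n] with its past fixed shows that both functions have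
    the same integral over each measurable set. They agree almost everywhere, and by continuity at
    every point, which the pointwise decomposition of the estimator requires. *)
Lemma density_marginal (f : R -> R) (n : nat) :
  has_density P (linear_process a (fun i => eps i) n) f -> continuous f ->
  forall x, f x = marginal n x.
Proof.
move=> df cf.
have mg := measurable_scaled_density.
have mY := measurable_tailT n.
have mfb : measurable_fun setT (marginal n) by exact: lipschitz_measurable (marginal_lipschitz n).
pose X := linear_process a (fun i => eps i) n.
have mX : measurable_fun [set: T] X by exact: measurable_linear_process.
pose X' w := a 0 * eps n%:Z w + Y n w.
have mX' : measurable_fun [set: T] X' by apply: measurable_funD => //; exact: measurable_funM.
have XX' : {ae P, forall w, X w = X' w}.
  by apply: filterS (linear_process_split law mus2 cva) => w /(_ n)[].
have key E : measurable E -> (\int[leb]_(x in E) (marginal n x)%:E = \int[leb]_(x in E) (f x)%:E)%E.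
  move=> mE; rewrite -df//.
  have mI : measurable_fun [set: R] (\1_E : R -> R) by exact: measurable_indic.
  pose Q := sigma_of eps (past n%:Z).
  have mYQ : measurable_fun [set: Q] (Y n) by exact: measurable_tail_process.
  pose Psi (z : Q * R) := (\1_E (a 0 * z.2 + Y n z.1) : R)%:E.
  have mPsi : measurable_fun setT Psi.
    apply/measurable_EFinP; apply: (measurableT_comp mI).
    apply: measurable_funD; first exact: measurable_funM.
    exact: (measurableT_comp mYQ).
  have Psi0 z : (0 <= Psi z)%E by rewrite lee_fin.
  have mXE : measurable (X @^-1` E) by rewrite -[X in measurable X]setTI; exact: mX.
  transitivity (\int[P]_w Psi (w, eps n%:Z w))%E; last first.
    transitivity (\int[P]_w (\1_(X @^-1` E) w)%:E)%E; last by rewrite integral_indic// setIT.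
    apply: ge0_ae_eq_integral => //.
    - apply/measurable_EFinP; apply: (measurableT_comp mI).
      exact: mX'.
    - by apply/measurable_EFinP; exact: measurable_indic.
    - apply: filterS XX' => w XX' _; rewrite /Psi !indicE/=.
      by congr ((_ : bool)%:R)%:E; rewrite -/(X' w) -XX'; apply/idP/idP; rewrite !inE.
  rewrite (@integral_indep_law _ _ _ _ _ mu indep law (past n%:Z) n%:Z Psi)//; last by rewrite /past/= ltxx.
  have mEi : measurable_fun setT (fun x : R => (\1_E x : R)%:E) by exact/measurable_EFinP/measurable_indic.
  have Ei0 (x : R) : (0 <= (\1_E x : R)%:E)%E by rewrite lee_fin.
  under [RHS]eq_integral => w _.
    rewrite (@integral_law_scaled (fun x => (\1_E x)%:E) (Y n w) mEi Ei0).
    over.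
  pose H (z : T * R) := ((\1_E z.2)%:E * (g (z.2 - Y n z.1))%:E)%E.
  have mH : measurable_fun setT H.
    apply: emeasurable_funM; first exact: (measurableT_comp mEi).
    apply/measurable_EFinP; apply: (measurableT_comp mg); apply: measurable_funB => //.
    exact: (measurableT_comp mY).
  have H0 z : (0 <= H z)%E by rewrite mule_ge0// lee_fin// scaled_density_ge0.
  rewrite (@fubini_tonelli _ _ _ _ _ P leb H)// integral_mkcond.
  apply: eq_integral => x _; rewrite patchE /H/= indicE.
  case: ifP => _; last by rewrite integral0_eq// => w _; rewrite mul0e.
  under eq_integral do rewrite mul1e.
  by rewrite EFin_Rintegral//; exact: integrable_gshift.
have ifb : leb.-integrable setT (fun x => (marginal n x)%:E).
  apply/integrableP; split; first exact/measurable_EFinP.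
  under eq_integral do rewrite gee0_abs ?lee_fin ?marginal_ge0//.
  by rewrite key// -df// preimage_setT probability_setT ltry.
have : ae_eq leb setT (fun x => (marginal n x)%:E) (fun x => (f x)%:E).
  apply: integral_ae_eq => //; first by apply/measurable_EFinP; exact: continuous_measurable_fun.
  by move=> E _ mE; exact: key.
move=> ae; move=> x; apply: continuous_ae_eq => //.
  move=> y; apply/cvgrPdist_le => e e0; near=> z.
  apply: le_trans (marginal_lipschitz n y z) _.
  have L0 : 0 < `|L1| + 1 by rewrite ltr_wpDl.
  apply: (@le_trans _ _ ((`|L1| + 1) * `|y - z|)).
    by rewrite ler_wpM2r// (le_trans (ler_norm _))// lerDl.
  rewrite mulrC -ler_pdivlMr//.
  near: z; apply: cvgr_dist_le; last by rewrite divr_gt0.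
  exact: cvg_id.
by apply: filterS ae => y /(_ I) [].
Unshelve. all: by end_near. Qed.

End density_of_process.

(** * Sums of conditional densities over blocks *)

Section coefficients.
Context (R : realType) (a : nat -> R).

(* [lsum (block_coef J p)] started at time [m + 1 - J] is the truncation at
   lag [J] of the past part of the process at time [m + 1 + p]. *)
Definition block_coef (J p s : nat) : R :=
  if (p <= s < J + p)%N then a (J + p - s)%N else 0.

Lemma block_coef_le J p s :
  `|block_coef J p s| <= if (s < J + p)%N then `|a (J + p - s)%N| else 0.
Proof.
rewrite /block_coef; case: (s < J + p)%N; rewrite ?andbF ?normr0// andbT.
by case: ifP => _; rewrite ?normr0.
Qed.

Context (A : R).
Hypothesis aA : forall n, \sum_(i < n) `|a i| <= A.

(** For fixed [s] the lags [J + p - s] are distinct. The induction keeps the sharper bound by the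
    first [J + q - s] coefficients. *)
Lemma sum_block_coef_p J q s : \sum_(p < q) `|block_coef J p s| <= A.
Proof.
apply: le_trans (aA (J + q - s)).
elim: q => [|q IH]; first by rewrite big_ord0; apply: sumr_ge0.
rewrite big_ord_recr/=.
apply: le_trans (lerD IH (block_coef_le J q s)) _.
case: ifPn => [sJ|]; last first.
  by rewrite -leqNgt addr0 => sJ; rewrite addnS (_ : (J + q - s)%N = 0%N) ?big_ord0 ?sumr_ge0//; lia.
by rewrite addnS subSn ?big_ord_recr//=; lia.
Qed.

Lemma sum_block_coef_s J p N : \sum_(s < N) `|block_coef J p s| <= A.
Proof.
(* The second sum collects the lags, below [J + p - N] inclusive, that are still available. *)
suff : \sum_(s < N) `|block_coef J p s| + \sum_(l < (J + p - N).+1) `|a l| <= \sum_(l < (J + p).+1) `|a l|.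
  move=> H; apply: le_trans (aA (J + p).+1); apply: le_trans H.
  by rewrite lerDl sumr_ge0.
elim: N => [|N IH]; first by rewrite big_ord0 subn0 add0r.
rewrite big_ord_recr/=; apply: le_trans IH; rewrite -addrA lerD2l.
apply: le_trans (lerD (block_coef_le J p N) (lexx _)) _.
case: ifPn => [NJ|]; last first.
  by rewrite -leqNgt add0r => NJ; rewrite (_ : (J + p - N.+1)%N = (J + p - N)%N)//; lia.
by rewrite subnS prednK ?subn_gt0// addrC [leRHS]big_ord_recr.
Qed.

(** One factor of the square is bounded by a column sum; after exchanging the sums, row sums bound
    the rest. Here short memory gives growth linear in [q]. *)
Lemma sum_sqr_block_coef J q N :
  \sum_(s < N) (\sum_(p < q) `|block_coef J p s|) ^+ 2 <= A ^+ 2 * q%:R.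
Proof.
have A0 : 0 <= A by apply: le_trans (aA 0); rewrite big_ord0.
apply: (@le_trans _ _ (\sum_(s < N) A * \sum_(p < q) `|block_coef J p s|)).
  apply: ler_sum => s _; rewrite expr2 ler_wpM2r ?sumr_ge0//.
  exact: sum_block_coef_p.
rewrite -mulr_sumr exchange_big/= expr2 -mulrA ler_wpM2l//.
apply: (@le_trans _ _ (\sum_(p < q) A)).
  by apply: ler_sum => p _; exact: sum_block_coef_s.
by rewrite sumr_const card_ord mulr_natr.
Qed.
End coefficients.

Section block_bound.
Context d (T : measurableType d) (R : realType) (P : probability T R).
Context (eps : int -> {RV P >-> R}) (mu : probability R R).
Hypothesis indep : mutually_independent P (fun i => (eps i : T -> R)).
Hypothesis law : forall j A, measurable A -> P (eps j @^-1` A) = mu A.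
Local Notation leb := (@lebesgue_measure R).

Lemma avgs_expectation B L1 L2 (c : nat -> R) (tau : int) N (G : R -> R) x :
  nice B L1 L2 G -> (forall y, 0 <= G y) ->
  ((avgs mu c N G x)%:E = \int[P]_w (G (x - lsum eps c tau N w))%:E)%E.
Proof.
elim: N G => [|N IH] G nG G0.
  under eq_integral do rewrite /lsum big_ord0 subr0.
  by rewrite integral_prob_cst.
have mG := nice_measurable nG; have [GB _ _] := nG.
rewrite /= IH; [|exact: nice_avg|by move=> y; exact: Rintegral_ge0].
pose j := (tau + N%:Z)%R.
pose Q := sigma_of eps (past j).
have mS : measurable_fun [set: Q] (lsum eps c tau N) by exact: measurable_lsum.
pose Psi (z : Q * R) := (G (x - lsum eps c tau N z.1 - c N * z.2))%:E.
have mPsi : measurable_fun setT Psi.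
  apply/measurable_EFinP; apply: (measurableT_comp mG).
  apply: measurable_funB; last exact: measurable_funM.
  by apply: measurable_funB => //; exact: (measurableT_comp mS).
have -> : (\int[P]_w (G (x - lsum eps c tau N.+1 w))%:E = \int[P]_w Psi (w, eps j w))%E.
  by apply: eq_integral => w _; rewrite /Psi /lsum big_ord_recr/= opprD addrA.
rewrite (@integral_indep_law _ _ _ _ _ mu indep law (past j) j Psi)//; last 2 first.
- by rewrite /past/= ltxx.
- by move=> z; rewrite lee_fin.
apply: eq_integral => w _; rewrite /avg -EFin_Rintegral//.
apply: (@bounded_integrable _ _ _ mu _ B) => [|u]; last exact: GB.
exact: measurable_comp_affine.
Qed.

Context (a : nat -> R).

Lemma lsum_block_coef J q m p w : (p < q)%N ->
  lsum eps (block_coef a J p) (m.+1%:Z - J%:Z) (J + q) w = tail_trunc eps a J (m + p).+1 w.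
Proof.
move=> pq; rewrite /lsum /tail_trunc /series/=.
rewrite -(big_mkord xpredT (fun s => block_coef a J p s * eps (m.+1%:Z - J%:Z + s%:Z) w)).
rewrite (@big_cat_nat _ _ _ p)//=; last by lia.
rewrite big_nat big1 ?add0r; last first.
  by move=> s /andP[_ sp]; rewrite /block_coef leqNgt sp mul0r.
rewrite (@big_cat_nat _ _ _ (J + p)%N)//=; [|lia..].
rewrite [X in _ + X]big_nat [X in _ + X]big1 ?addr0; last first.
  by move=> s /andP[sJ _]; rewrite /block_coef ltnNge sJ andbF mul0r.
(* Reversal: the index [s = J + p - 1 - l] carries the lag [l + 1]. *)
rewrite -{1}[p]add0n big_addn addnK big_nat_rev/= add0n.
rewrite !big_nat; apply: eq_bigr => l /andP[_ lJ].
rewrite /block_coef; case: ifPn => [|]; last by lia.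
by move=> _; congr (a _ * eps _ w); lia.
Qed.

Context (s2 : R).
Hypothesis mus2 : (\int[mu]_u (u ^+ 2)%:E <= s2%:E)%E.
Hypothesis cva : cvgn (series (fun i => `|a i|)).
Hypothesis a0 : a 0 != 0.
Context (fe : R -> R).
Hypothesis mfe : measurable_fun setT fe.
Hypothesis fe0 : forall x, 0 <= fe x.
Context (B L1 L2 : R).
Local Notation g := (scaled_density a fe).
Hypothesis ng : nice B L1 L2 g.
Hypothesis L20 : 0 <= L2.
Local Notation Y := (tail_process eps a).
Let A := limn (series (fun i => `|a i|)).

Definition block_sum (f : R -> R) (m q : nat) (x : R) (w : T) : R :=
  \sum_(p < q) (g (x - Y (m + p).+1 w) - f x).

(** Each term is centred at its own mean: the truncated process does not have density [f]. *)
Definition block_sum_trunc (J m q : nat) (x : R) (w : T) : R :=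
  \sum_(p < q) (g (x - tail_trunc eps a J (m + p).+1 w) -
                \int[P]_w' g (x - tail_trunc eps a J (m + p).+1 w')).

Lemma measurable_trunc_T J n : measurable_fun [set: T] (tail_trunc eps a J n).
Proof.
by apply: (@sigma_of_measurable_fun _ _ _ P _ eps (past n%:Z)); exact: measurable_tail_trunc.
Qed.

(** The bound does not depend on [J], so it passes to the untruncated sums by Fatou. *)
Lemma block_trunc_L2 J m q :
  (\int[leb]_x \int[P]_w (block_sum_trunc J m q x w ^+ 2)%:E <= (L2 * s2 * A ^+ 2 * q%:R)%:E)%E.
Proof.
have g0 t : 0 <= g t by exact: scaled_density_ge0.
have [gB _ _] := ng; have mg := nice_measurable ng.
have s20 : 0 <= s2.
  by rewrite -lee_fin; apply: le_trans mus2; apply: integral_ge0 => u _; rewrite lee_fin sqr_ge0.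
have := @array_L2 _ _ _ _ _ mu indep law B L1 L2 s2 q (block_coef a J) (m.+1%:Z - J%:Z) (J + q)
  (fun=> g) L20 mus2 (fun=> ng).
set LHS := (X in (X <= _)%E -> _); set LHS' := (X in _ -> (X <= _)%E).
suff -> : LHS = LHS'.
  move/le_trans; apply; rewrite lee_fin.
  under eq_bigr do rewrite -mulrA [_ * s2]mulrC mulrA.
  rewrite -mulr_sumr -[leRHS]mulrA ler_wpM2l ?mulr_ge0//.
  exact: (sum_sqr_block_coef (sum_abs_le cva)).
apply: eq_integral => x _; apply: eq_integral => w _; congr (_ ^+ 2)%:E.
rewrite -sumrB; apply: eq_bigr => p _; rewrite lsum_block_coef//; congr (_ - _).
apply: EFin_inj; rewrite (@avgs_expectation B L1 L2 _ (m.+1%:Z - J%:Z))//.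
rewrite -EFin_Rintegral//; last first.
  exact: (@integrable_gshift _ _ _ P a fe mfe B L1 L2 ng _ x (measurable_trunc_T J (m + p).+1)).
by apply: eq_integral => w' _; rewrite lsum_block_coef.
Qed.

End block_bound.

Section block_limit.
Context d (T : measurableType d) (R : realType) (P : probability T R).
Context (eps : int -> {RV P >-> R}) (mu : probability R R).
Hypothesis indep : mutually_independent P (fun i => (eps i : T -> R)).
Hypothesis law : forall j A, measurable A -> P (eps j @^-1` A) = mu A.
Local Notation leb := (@lebesgue_measure R).
Context (a : nat -> R) (s2 : R).
Hypothesis mus2 : (\int[mu]_u (u ^+ 2)%:E <= s2%:E)%E.
Hypothesis cva : cvgn (series (fun i => `|a i|)).
Context (fe : R -> R).
Hypothesis mfe : measurable_fun setT fe.
Hypothesis fe0 : forall x, 0 <= fe x.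
Context (B L1 L2 : R).
Local Notation g := (scaled_density a fe).
Hypothesis ng : nice B L1 L2 g.
Hypothesis L20 : 0 <= L2.
Local Notation Y := (tail_process eps a).
Let A := limn (series (fun i => `|a i|)).
Context (f : R -> R).
Hypothesis fE : forall n x, f x = marginal eps a fe n x.

Lemma lipschitz_continuous (L : R) (G : R -> R) :
  (forall x y, `|G x - G y| <= L * `|x - y|) -> continuous G.
Proof.
move=> GL x; apply/cvgrPdist_le => e e0; near=> y.
apply: le_trans (GL x y) _.
have L0 : 0 < `|L| + 1 by rewrite ltr_wpDl.
apply: (@le_trans _ _ ((`|L| + 1) * `|x - y|)).
  by rewrite ler_wpM2r// (le_trans (ler_norm _))// lerDl.
rewrite mulrC -ler_pdivlMr//.
near: y; apply: cvgr_dist_le; last by rewrite divr_gt0.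
exact: cvg_id.
Unshelve. all: by end_near. Qed.

Lemma continuous_g : continuous g.
Proof. by have [_ gL _] := ng; exact: lipschitz_continuous gL. Qed.

Lemma measurable_f : measurable_fun setT f.
Proof.
apply: (@lipschitz_measurable _ L1) => x y; rewrite !(fE 0).
exact: marginal_lipschitz ng _ _ _.
Qed.

Lemma measurable_block_sum m q :
  measurable_fun [set: R * T] (fun z => block_sum eps a fe f m q z.1 z.2).
Proof.
have mg := nice_measurable ng.
apply: measurable_sum => p; apply: measurable_funB; last exact: (measurableT_comp measurable_f).
apply: (measurableT_comp mg); apply: measurable_funB => //.
exact: (measurableT_comp (@measurable_tailT _ _ _ _ eps a (m + p).+1)).
Qed.

Lemma measurable_block_sum_trunc J m q :
  measurable_fun [set: R * T] (fun z => block_sum_trunc eps a fe J m q z.1 z.2).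
Proof.
have mg := nice_measurable ng.
have mt p := @measurable_trunc_T _ _ _ _ eps a J (m + p).+1.
pose E p (x : R) := \int[P]_w' g (x - tail_trunc eps a J (m + p).+1 w').
have mE p : measurable_fun setT (E p).
  apply: (@lipschitz_measurable _ L1) => x y.
  exact: (@gshift_lipschitz _ _ _ P a fe mfe B L1 L2 ng _ x y (mt p)).
apply: measurable_sum => p; apply: measurable_funB; last exact: (measurableT_comp (mE p)).
apply: (measurableT_comp mg); apply: measurable_funB => //.
exact: (measurableT_comp (mt p)).
Qed.

Lemma trunc_expectation_cvg n x :
  \int[P]_w g (x - tail_trunc eps a J n w) @[J --> \oo] --> f x.
Proof.
have [gB gL _] := ng; have mg := nice_measurable ng.
have mt J := @measurable_trunc_T _ _ _ _ eps a J n.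
have mY := @measurable_tailT _ _ _ _ eps a n.
have [|||||] := @dominated_convergence _ _ _ P setT measurableT
  (fun J w => (g (x - tail_trunc eps a J n w))%:E) (fun w => (g (x - Y n w))%:E) (fun=> B%:E).
- by move=> J; apply/measurable_EFinP; exact: measurable_gshift.
- by apply/measurable_EFinP; exact: measurable_gshift.
- apply: filterS (linear_process_split law mus2 cva) => w /(_ n)[cv _] _.
  apply: cvg_EFin; [by apply: nearW|rewrite /comp/=].
  have cvx : x - tail_trunc eps a J n w @[J --> \oo] --> x - Y n w.
    by apply: cvgB => //; exact: cvg_cst.
  exact: (cvg_comp _ _ cvx (@continuous_g _)).
- by apply: (@bounded_integrable _ _ _ P (fun=> B) `|B|).
- by apply: aeW => w J _; rewrite lee_fin.
move=> _ _.
have E J : (\int[P]_w (g (x - tail_trunc eps a J n w))%:E =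
   (\int[P]_w g (x - tail_trunc eps a J n w))%:E)%E.
  by rewrite EFin_Rintegral//; exact: (@integrable_gshift _ _ _ P a fe mfe B L1 L2 ng _ x (mt J)).
under eq_fun do rewrite E.
rewrite EFin_Rintegral//; last exact: (@integrable_gshift _ _ _ P a fe mfe B L1 L2 ng _ x mY).
by rewrite -/(marginal eps a fe n x) -fE => /fine_cvgP[].
Qed.

Lemma block_trunc_cvg : {ae P, forall w, forall m q x,
  block_sum_trunc eps a fe J m q x w @[J --> \oo] --> block_sum eps a fe f m q x w}.
Proof.
apply: filterS (linear_process_split law mus2 cva) => w cvw m q x.
apply: cvg_big => [|p _]; first exact: add_continuous.
apply: cvgB; last exact: trunc_expectation_cvg.
have [cv _] := cvw (m + p).+1.
have cvx : x - tail_trunc eps a J (m + p).+1 w @[J --> \oo] --> x - Y (m + p).+1 w.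
  by apply: cvgB => //; exact: cvg_cst.
exact: (cvg_comp _ _ cvx (@continuous_g _)).
Qed.

Definition block_norm m q w : \bar R := (\int[leb]_x (block_sum eps a fe f m q x w ^+ 2)%:E)%E.

Lemma measurable_block_norm m q : measurable_fun [set: T] (block_norm m q).
Proof.
apply: (@measurable_fun_fubini_tonelli_G _ _ _ _ _ leb (fun z : R * T => (block_sum eps a fe f m q z.1 z.2 ^+ 2)%:E)).
  by apply/measurable_EFinP; apply: measurable_funX; exact: measurable_block_sum.
by move=> z; rewrite lee_fin sqr_ge0.
Qed.

Lemma block_norm_ge0 m q w : (0 <= block_norm m q w)%E.
Proof. by apply: integral_ge0 => x _; rewrite lee_fin sqr_ge0. Qed.

(** Fatou is applied twice, in [x] for almost every sample point and then over the sample space. *)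
Lemma expectation_block_norm m q :
  (\int[P]_w block_norm m q w <= (L2 * s2 * A ^+ 2 * q%:R)%:E)%E.
Proof.
pose bT J w := (\int[leb]_x (block_sum_trunc eps a fe J m q x w ^+ 2)%:E)%E.
have bT0 J w : (0 <= bT J w)%E by apply: integral_ge0 => x _; rewrite lee_fin sqr_ge0.
have m2 J : measurable_fun [set: R * T] (fun z => (block_sum_trunc eps a fe J m q z.1 z.2 ^+ 2)%:E).
  by apply/measurable_EFinP; apply: measurable_funX; exact: measurable_block_sum_trunc.
have mbT J : measurable_fun [set: T] (bT J).
  apply: (@measurable_fun_fubini_tonelli_G _ _ _ _ _ leb (fun z : R * T => (block_sum_trunc eps a fe J m q z.1 z.2 ^+ 2)%:E)) => [|z].
    exact: m2.
  by rewrite lee_fin sqr_ge0.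
have IbT J : (\int[P]_w bT J w <= (L2 * s2 * A ^+ 2 * q%:R)%:E)%E.
  have nn (z : R * T) : (0 <= (block_sum_trunc eps a fe J m q z.1 z.2 ^+ 2)%:E)%E.
    by rewrite lee_fin sqr_ge0.
  rewrite -(@fubini_tonelli _ _ _ _ _ leb P (fun z : R * T => (block_sum_trunc eps a fe J m q z.1 z.2 ^+ 2)%:E) (m2 J) nn).
  exact: (block_trunc_L2 indep law mus2 cva mfe fe0 ng L20).
apply: (@le_trans _ _ (\int[P]_w limn_einf (bT^~ w))%E); last first.
  apply: le_trans (fatou _ _ _ _) _ => //.
  exact: limn_einf_le.
apply: ae_ge0_le_integral => //.
- by move=> w _; exact: block_norm_ge0.
- exact: measurable_block_norm.
- move=> w _; rewrite limn_einf_lim; apply: lime_ge; first exact: is_cvg_einfs.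
  by apply: nearW => n; apply: le_ereal_inf_tmp => _ [k _ <-].
- rewrite /limn_einf; apply: measurableT_comp => //.
  by apply: measurable_fun_limn_esup => n; exact: measurableT_comp.
apply: filterS block_trunc_cvg => w cvw _.
have -> : block_norm m q w = (\int[leb]_x limn_einf (fun J => (block_sum_trunc eps a fe J m q x w ^+ 2)%:E))%E.
  apply: eq_integral => x _; apply/esym.
  have /cvg_limn_einf_sup[->] // : ((block_sum_trunc eps a fe J m q x w ^+ 2)%:E @[J --> \oo] --> (block_sum eps a fe f m q x w ^+ 2)%:E).
  apply: cvg_EFin; [by apply: nearW|rewrite /comp/=].
  exact: (cvg_comp _ _ (cvw m q x) (@exprn_continuous _ 2 _)).
apply: fatou => //; last by move=> J x _; rewrite lee_fin sqr_ge0.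
by move=> J; exact: (measurable_fun_pair1 w (m2 J)).
Qed.

End block_limit.

(** * Maximal inequality *)

Section bounded_sums.
Context (R : realType).

Lemma nneseries_le (u : nat -> R) (v : nat -> \bar R) (c : R) :
  (forall k, 0 <= v k)%E -> (forall k, v k <= (u k)%:E)%E ->
  (forall n, \sum_(k < n) u k <= c) -> (\sum_(0 <= k <oo) v k <= c%:E)%E.
Proof.
move=> v0 vu uc; apply: lime_le; first by apply: is_cvg_nneseries.
apply: nearW => n; rewrite /= big_mkord.
apply: (@le_trans _ _ (\sum_(k < n) (u k)%:E)%E); first exact: lee_sum.
by rewrite sumEFin lee_fin.
Qed.

Lemma sum_geometric_le (r : R) n : 0 <= r -> r < 1 -> \sum_(k < n) r ^+ k <= (1 - r)^-1.
Proof.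
move=> r0 r1; have d0 : 0 < 1 - r by rewrite subr_gt0.
rewrite -[leRHS]div1r ler_pdivlMr//.
suff -> : (\sum_(k < n) r ^+ k) * (1 - r) = 1 - r ^+ n by rewrite gerBl exprn_ge0.
elim: n => [|n IH]; first by rewrite big_ord0 mul0r expr0 subrr.
by rewrite big_ord_recr/= mulrDl IH exprS; ring.
Qed.

Lemma sum_telescope_le n : \sum_(k < n) ((k.+1%:R * k.+2%:R)^-1 : R) <= 1.
Proof.
suff -> : \sum_(k < n) ((k.+1%:R * k.+2%:R)^-1 : R) = 1 - n.+1%:R^-1.
  by rewrite gerBl invr_ge0.
elim: n => [|n IH]; first by rewrite big_ord0 invr1 subrr.
rewrite big_ord_recr/= IH.
have h1 : (n.+1%:R : R) != 0 by rewrite pnatr_eq0.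
have h2 : (n.+2%:R : R) != 0 by rewrite pnatr_eq0.
have e : (n.+2%:R : R) = n.+1%:R + 1 by rewrite natr1.
move: h1 h2; rewrite e; move: (n.+1%:R : R) => t h1 h2.
by field; rewrite h1 h2.
Qed.

End bounded_sums.

Section maximal.
Context d (T : measurableType d) (R : realType) (P : probability T R).
Local Notation leb := (@lebesgue_measure R).
Context (S : nat -> nat -> R -> T -> R) (C : R).
Let N m q w := (\int[leb]_x (S m q x w ^+ 2)%:E)%E.
Hypothesis mS : forall m q, measurable_fun [set: R * T] (fun z => S m q z.1 z.2).
Hypothesis SD : forall m q q' x w, S m (q + q') x w = S m q x w + S (m + q) q' x w.
Hypothesis C0 : 0 <= C.
Hypothesis EN : forall m q, (\int[P]_w N m q w <= (C * q%:R)%:E)%E.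

Let N0 m q w : (0 <= N m q w)%E.
Proof. by apply: integral_ge0 => x _; rewrite lee_fin sqr_ge0. Qed.

Let mN m q : measurable_fun [set: T] (N m q).
Proof.
apply: (@measurable_fun_fubini_tonelli_G _ _ _ _ _ leb (fun z : R * T => (S m q z.1 z.2 ^+ 2)%:E)).
  by apply/measurable_EFinP; apply: measurable_funX; exact: mS.
by move=> z; rewrite lee_fin sqr_ge0.
Qed.

Let mSw m q w : measurable_fun [set: R] (fun x => S m q x w).
Proof. exact: (measurable_fun_pair1 w (mS m q)). Qed.

(* [(x + y)^2 <= 11 x^2 + (11/10) y^2]: the weight [11/10 < 9/8] makes the dyadic recursion grow
   slower than [(9/4)^k], hence slower than [2^(6k/5)]. *)
Let ND m q q' w : (N m (q + q') w <= 11%:E * N m q w + (11 / 10)%:E * N (m + q) q' w)%E.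
Proof.
have mE m' q'' : measurable_fun [set: R] (fun x => (S m' q'' x w ^+ 2)%:E).
  by apply/measurable_EFinP; apply: measurable_funX; exact: mSw.
rewrite -ge0_integralZl_EFin//; last 2 first.
- by move=> x _; rewrite lee_fin sqr_ge0.
- exact: mE.
rewrite -ge0_integralZl_EFin//; last 2 first.
- by move=> x _; rewrite lee_fin sqr_ge0.
- exact: mE.
have mcE (c : R) m' q'' : measurable_fun [set: R] (fun x => c%:E * (S m' q'' x w ^+ 2)%:E)%E.
  by apply: emeasurable_funM => //; exact: mE.
have cE0 (c : R) m' q'' x : 0 <= c -> (0 <= c%:E * (S m' q'' x w ^+ 2)%:E)%E.
  by move=> c0; rewrite -EFinM lee_fin mulr_ge0// sqr_ge0.
rewrite -ge0_integralD//; last 4 first.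
- by move=> x _; exact: cE0.
- exact: mcE.
- by move=> x _; apply: cE0; lra.
- exact: mcE.
apply: ge0_le_integral => //.
- by move=> x _; rewrite lee_fin sqr_ge0.
- exact: mE.
- exact: (emeasurable_funD (mcE _ _ _) (mcE _ _ _)).
- move=> x _; rewrite -!EFinM -EFinD lee_fin SD.
  by have := sqr_ge0 (10 * S m q x w - S (m + q) q' x w); nra.
Qed.

(** A random majorant of [N m n w] for all [n <= 2^k] at once. If [n] passes the midpoint, the full
    left half is charged 11 and the rest lies in the right half; adding the majorants of both halves
    covers either case. *)
Fixpoint dyadic_bound (k m : nat) (w : T) : \bar R :=
  if k is k'.+1 then (11%:E * N m (2 ^ k') w +
    (11 / 10)%:E * (dyadic_bound k' m w + dyadic_bound k' (m + 2 ^ k') w))%E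
  else N m 1 w.

Let dyadic_ge0 k m w : (0 <= dyadic_bound k m w)%E.
Proof.
elim: k m => [|k IH] m /=; first exact: N0.
by apply: adde_ge0; apply: mule_ge0; rewrite ?lee_fin ?N0 ?adde_ge0.
Qed.

Let measurable_dyadic k m : measurable_fun [set: T] (dyadic_bound k m).
Proof.
elim: k m => [|k IH] m /=; first exact: mN.
apply: emeasurable_funD; first by apply: emeasurable_funM => //; exact: mN.
by apply: emeasurable_funM => //; exact: emeasurable_funD.
Qed.

Lemma norm_le_dyadic k m n w : (n <= 2 ^ k)%N -> (N m n w <= dyadic_bound k m w)%E.
Proof.
elim: k m n => [|k IH] m n /=.
  rewrite expn0; case: n => [|[|//]] _; last by [].
  (* Additivity with two empty blocks forces the empty sum to be 0. *)
  have S0 x : S m 0 x w = S m 0 x w + S m 0 x w by have := SD m 0 0 x w; rewrite !addn0.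
  have -> : N m 0 w = 0%E; last exact: N0.
  rewrite /N integral0_eq// => x _.
  suff -> : S m 0 x w = 0 by rewrite expr0n.
  by have := S0 x; lra.
rewrite expnS mul2n -addnn => nk.
have [nk'|nk'] := leqP n (2 ^ k).
  apply: le_trans (IH m n nk') _.
  apply: (@le_trans _ _ ((11 / 10)%:E * dyadic_bound k m w)%E).
    by rewrite -[leLHS]mul1e lee_wpmul2r// lee_fin; lra.
  apply: (@le_trans _ _ ((11 / 10)%:E * (dyadic_bound k m w + dyadic_bound k (m + 2 ^ k) w))%E).
    by rewrite lee_wpmul2l// leeDl.
  by rewrite leeDr// mule_ge0.
rewrite -[in leLHS](subnKC (ltnW nk')).
apply: le_trans (ND _ _ _ _) _; rewrite leeD2l// lee_wpmul2l//.
apply: le_trans (IH _ _ _) _; first by rewrite leq_subLR.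
by rewrite leeDr.
Qed.

(** The right side solves [u (k+1) = 11 * C * 2^k + (11/5) * u k] with [u 0 = C]. *)
Lemma expectation_dyadic k m :
  (\int[P]_w dyadic_bound k m w <= (C * (56 * (11 / 5) ^+ k - 55 * 2 ^+ k))%:E)%E.
Proof.
elim: k m => [|k IH] m /=.
  by apply: le_trans (EN m 1) _; rewrite lee_fin !expr0; lra.
have m1 : measurable_fun [set: T] (fun w => 11%:E * N m (2 ^ k) w)%E.
  by apply: emeasurable_funM => //; exact: mN.
have m2 : measurable_fun [set: T] (fun w => dyadic_bound k m w + dyadic_bound k (m + 2 ^ k) w)%E.
  by apply: emeasurable_funD; exact: measurable_dyadic.
have m3 : measurable_fun [set: T] (fun w => (11 / 10)%:E *
    (dyadic_bound k m w + dyadic_bound k (m + 2 ^ k) w))%E.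
  exact: emeasurable_funM.
have h1 w : [set: T] w -> (0 <= 11%:E * N m (2 ^ k) w)%E by move=> _; rewrite mule_ge0// N0.
have h2 w : [set: T] w -> (0 <= dyadic_bound k m w + dyadic_bound k (m + 2 ^ k) w)%E.
  by move=> _; rewrite adde_ge0// dyadic_ge0.
have h3 w : [set: T] w -> (0 <= (11 / 10)%:E *
    (dyadic_bound k m w + dyadic_bound k (m + 2 ^ k) w))%E.
  by move=> Tw; rewrite mule_ge0//; exact: h2.
rewrite (ge0_integralD P measurableT h1 m1 h3 m3).
rewrite (ge0_integralZl_EFin P measurableT (fun w _ => N0 m (2 ^ k) w) (mN m (2 ^ k)))//.
rewrite (ge0_integralZl_EFin P measurableT h2 m2)//.
rewrite (ge0_integralD P measurableT (fun w _ => dyadic_ge0 k m w) (measurable_dyadic k m)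
  (fun w _ => dyadic_ge0 k (m + 2 ^ k) w) (measurable_dyadic k (m + 2 ^ k))).
apply: (@le_trans _ _ (11%:E * (C * (2 ^ k)%:R)%:E + (11 / 10)%:E * ((C * (56 * (11 / 5) ^+ k - 55 * 2 ^+ k))%:E + (C * (56 * (11 / 5) ^+ k - 55 * 2 ^+ k))%:E))%E).
  by apply: leeD; apply: lee_wpmul2l => //; exact: leeD.
rewrite -!EFinD lee_fin natrX !exprS le_eqVlt; apply/orP; left; apply/eqP.
by field.
Qed.

(** The condition on [v] says [v <= (2n)^(6/5)] without real powers. The weights [(4/9)^k] are
    summable against [(11/5)^k], with ratio 44/45, and [v = (9/4)^k] qualifies because
    [(9/4)^5 <= 2^6]. *)
Lemma ae_maximal : {ae P, forall w, exists2 M : R, 0 <= M & forall n : nat, (0 < n)%N ->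
  exists v : R, [/\ 0 <= v, v ^+ 5 <= (2 * n%:R) ^+ 6 & (N 0 n w <= (M * v)%:E)%E]}.
Proof.
pose V k w := (((4 / 9) ^+ k)%:E * dyadic_bound k 0 w)%E.
have : {ae P, forall w, exists M : R, forall k, (V k w <= M%:E)%E}.
  apply: ae_bounded.
  - by move=> k; exact: emeasurable_funM.
  - by move=> k w; rewrite mule_ge0// lee_fin exprn_ge0.
  - apply: (@le_lt_trans _ _ ((C * 56 * (1 - 44 / 45)^-1)%:E)); last exact: ltry.
    apply: (@nneseries_le _ (fun k => C * 56 * (44 / 45) ^+ k)).
    + by move=> k; apply: integral_ge0 => w _; rewrite mule_ge0// lee_fin exprn_ge0.
    + move=> k; rewrite ge0_integralZl_EFin// ?exprn_ge0//.
      apply: (@le_trans _ _ (((4 / 9) ^+ k)%:E * (C * (56 * (11 / 5) ^+ k))%:E)%E).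
        rewrite lee_wpmul2l ?lee_fin ?exprn_ge0//.
        apply: le_trans (expectation_dyadic k 0) _; rewrite lee_fin ler_wpM2l// gerBl.
        by rewrite mulr_ge0// exprn_ge0.
      rewrite -EFinM lee_fin le_eqVlt; apply/orP; left; apply/eqP.
      rewrite (_ : 44 / 45 = 4 / 9 * (11 / 5)); last by field.
      rewrite (exprMn k (4 / 9) (11 / 5)).
      by move: ((4 / 9) ^+ k) ((11 / 5) ^+ k) => x y; ring.
    + move=> n; rewrite -mulr_sumr ler_wpM2l ?mulr_ge0//.
      by apply: sum_geometric_le; lra.
apply: filterS => w [M VM].
exists `|M| => // n n0.
(* Then [n < 2^k <= 2n]. *)
pose k := (trunc_log 2 n).+1.
exists ((9 / 4) ^+ k); split.
- by rewrite exprn_ge0//; lra.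
- rewrite -exprM mulnC exprM.
  apply: (@le_trans _ _ ((2 ^+ 6) ^+ k)).
    by rewrite lerXn2r// ?nnegrE//; lra.
  rewrite -exprM mulnC exprM lerXn2r// ?nnegrE// ?exprn_ge0//.
  by rewrite /k exprS ler_wpM2l// -natrX ler_nat trunc_logP.
- apply: (@le_trans _ _ (dyadic_bound k 0 w)).
    by apply: norm_le_dyadic; rewrite ltnW// trunc_log_ltn.
  have := VM k; rewrite /V.
  have -> : 4 / 9 = (9 / 4)^-1 :> R by field.
  have p0 : 0 < (9 / 4 : R) ^+ k by rewrite exprn_gt0//; lra.
  rewrite exprVn muleC -lee_pdivlMr ?invr_gt0// invrK -EFinM => /le_trans; apply.
  by rewrite lee_fin ler_wpM2r ?(ltW p0)// ler_norm.
Qed.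

End maximal.

(** * Almost sure control of the kernel martingale *)

Section martingale_as.
Context d (T : measurableType d) (R : realType) (P : probability T R).
Context (eps : int -> {RV P >-> R}) (mu : probability R R).
Hypothesis indep : mutually_independent P (fun i => (eps i : T -> R)).
Hypothesis law : forall j A, measurable A -> P (eps j @^-1` A) = mu A.
Local Notation leb := (@lebesgue_measure R).
Context (a : nat -> R).
Hypothesis a0 : a 0 != 0.
Context (fe : R -> R).
Hypothesis mfe : measurable_fun setT fe.
Hypothesis fe0 : forall x, 0 <= fe x.
Hypothesis mufe : forall A, measurable A -> mu A = (\int[leb]_(x in A) (fe x)%:E)%E.
Context (B : R).
Local Notation g := (scaled_density a fe).
Hypothesis gB : forall x, `|g x| <= B.
Local Notation Y := (tail_process eps a).
Context (K : R -> R) (MK k2 : R).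
Hypothesis mK : measurable_fun setT K.
Hypothesis KM : forall x, `|K x| <= MK.
Hypothesis K2 : (\int[leb]_u (K u ^+ 2)%:E <= k2%:E)%E.

Definition kern (h : R) (y : R) : R := K (y / h).

Lemma measurable_kern h : measurable_fun setT (kern h).
Proof. by apply: (measurableT_comp mK); exact: measurable_funM. Qed.

Lemma integral_kern_sqr h : 0 < h -> (\int[leb]_y (kern h y ^+ 2)%:E <= (h * k2)%:E)%E.
Proof.
move=> h0; have hn : h^-1 != 0 by rewrite invr_eq0 gt_eqF.
have mK2 : measurable_fun [set: R] (fun u => (K u ^+ 2)%:E).
  by apply/measurable_EFinP; exact: measurable_funX.
have K20 (u : R) : (0 <= (K u ^+ 2)%:E)%E by rewrite lee_fin sqr_ge0.
have := K2; rewrite (@ge0_integral_affine _ h^-1 0 _ hn mK2 K20).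
rewrite gtr0_norm ?invr_gt0// => /(@lee_wpmul2l _ h%:E) H.
rewrite EFinM; apply: le_trans (H _); last by rewrite lee_fin ltW.
rewrite muleA -EFinM mulfV ?gt_eqF// mul1e le_eqVlt; apply/orP; left; apply/eqP.
by apply: eq_integral => y _; rewrite /kern addr0 mulrC.
Qed.

(** The factor [h] comes from the bounded density of the scaled innovation, which gives a kernel
    window mass [O(h)] uniformly in [y]. *)
Lemma integral_law_kern_sqr h y : 0 < h ->
  (\int[mu]_u (kern h (y - a 0 * u) ^+ 2)%:E <= (B * (h * k2))%:E)%E.
Proof.
move=> h0; have mg := measurable_scaled_density a mfe.
have mk := measurable_kern h.
pose q (t : R) := (kern h (y - t) ^+ 2)%:E.
have mq : measurable_fun [set: R] q.
  apply/measurable_EFinP; apply: measurable_funX; apply: (measurableT_comp mk).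
  exact: measurable_funB.
have q0 t : (0 <= q t)%E by rewrite lee_fin sqr_ge0.
have B0 : 0 <= B by rewrite (le_trans _ (gB 0)).
have := @integral_law_scaled _ mu a a0 fe mfe fe0 mufe q 0 mq q0.
under eq_integral do rewrite addr0.
move=> ->.
apply: (@le_trans _ _ (\int[leb]_x (B%:E * q x))%E).
  apply: ge0_le_integral => //.
  - by move=> x _; rewrite mule_ge0// lee_fin scaled_density_ge0.
  - apply: emeasurable_funM => //; apply/measurable_EFinP; apply: (measurableT_comp mg).
    exact: measurable_funB.
  - exact: emeasurable_funM.
  - move=> x _; rewrite muleC lee_wpmul2r// lee_fin.
    by rewrite (le_trans (ler_norm _)).
rewrite ge0_integralZl_EFin// EFinM lee_wpmul2l ?lee_fin//.
apply: le_trans (integral_kern_sqr h0).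
have mk2 : measurable_fun [set: R] (fun u => (kern h u ^+ 2)%:E).
  by apply/measurable_EFinP; exact: measurable_funX.
have k20 (u : R) : (0 <= (kern h u ^+ 2)%:E)%E by rewrite lee_fin sqr_ge0.
rewrite (@ge0_integral_affine _ (-1) y _ _ mk2 k20) ?oppr_eq0 ?oner_eq0//.
rewrite normrN1 mul1e le_eqVlt; apply/orP; left; apply/eqP.
by apply: eq_integral => t _; rewrite /q mulN1r addrC.
Qed.

Context (h : nat -> R).
Hypothesis h0 : forall n, 0 < h n.
Local Notation Z n := (kmart eps mu (a 0) Y (kern (h n)) n).

(** This is [2 cosh t - 2]; it controls both signs of the martingale at once. *)
Definition cosh2 (t : R) : R := expR2 t + expR2 (- t).

Lemma cosh2_ge0 t : 0 <= cosh2 t.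
Proof. by rewrite addr_ge0// expR2_ge0. Qed.

Lemma measurable_cosh2 : measurable_fun setT cosh2.
Proof.
apply: measurable_funD; first exact: measurable_expR2.
by apply: (measurableT_comp (@measurable_expR2 R)).
Qed.

(** Apply [kmart_exp] with [lam] equal to plus and minus [h^2]. The growth factor becomes
    [(1 + 2 B k2 h^5)^n], at most the exponential of a multiple of [n h^5]. *)
Lemma expectation_cosh2 n : h n ^+ 2 * (2 * MK) <= 3^-1 -> 0 <= k2 ->
  (\int[P]_w \int[leb]_x (cosh2 (h n ^+ 2 * Z n x w))%:E <=
   (4 * k2 * (n%:R * h n ^+ 5) * expR (2 * B * k2 * (n%:R * h n ^+ 5)))%:E)%E.
Proof.
move=> hM k20.
have B0 : 0 <= B by rewrite (le_trans _ (gB 0)).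
have hn := h0 n; have hn0 := ltW hn.
have mk := measurable_kern (h n).
have kM x : `|kern (h n) x| <= MK by exact: KM.
have mY i : measurable_fun [set: sigma_of eps (past i%:Z)] (Y i) by exact: measurable_tail_process.
have mZ : measurable_fun [set: R * T] (fun z => Z n z.1 z.2).
  exact: (@measurable_kmartT _ _ _ _ eps mu (a 0) Y mY (kern (h n)) MK n mk kM).
have bound lam : lam ^+ 2 = h n ^+ 4 -> `|lam| = h n ^+ 2 ->
  (\int[leb]_x \int[P]_w (expR2 (lam * Z n x w))%:E <=
    (2 * k2 * (n%:R * h n ^+ 5) * expR (2 * B * k2 * (n%:R * h n ^+ 5)))%:E)%E.
  move=> lam2 lam1.
  have := @kmart_exp _ _ _ _ _ mu indep law (a 0) Y mY (kern (h n)) MK (h n * k2) (B * (h n * k2)) lam n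
    mk kM (integral_kern_sqr hn) (fun y => integral_law_kern_sqr y hn).
  rewrite lam1 => /(_ hM) H; apply: le_trans (H _ _) _; rewrite ?mulr_ge0//.
  rewrite lee_fin lam2.
  rewrite (_ : n%:R * (2 * h n ^+ 4 * (h n * k2)) = 2 * k2 * (n%:R * h n ^+ 5)); last by ring.
  have h50 : 0 <= n%:R * h n ^+ 5 by rewrite mulr_ge0// exprn_ge0.
  rewrite ler_wpM2l ?mulr_ge0//.
  rewrite (_ : 2 * B * k2 * (n%:R * h n ^+ 5) = n%:R * (2 * h n ^+ 4 * (B * (h n * k2)))); last by ring.
  rewrite expRM_natl lerXn2r// ?nnegrE ?expR_ge0 ?expR_ge1Dx// addr_ge0//.
  by rewrite !mulr_ge0// exprn_ge0.
pose E lam (z : R * T) := (expR2 (lam * Z n z.1 z.2))%:E.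
have mE lam : measurable_fun setT (E lam).
  by apply/measurable_EFinP; apply: (measurableT_comp (@measurable_expR2 R)); exact: measurable_funM.
have E0 lam z : (0 <= E lam z)%E by rewrite lee_fin expR2_ge0.
have mIE lam : measurable_fun [set: R] (fun x => \int[P]_w (E lam (x, w)))%E.
  exact: (@measurable_fun_fubini_tonelli_F _ _ _ _ _ P (E lam) (mE lam) (E0 lam)).
pose F (z : R * T) := (E (h n ^+ 2)%R z + E (- h n ^+ 2)%R z)%E.
have mF : measurable_fun setT F by exact: emeasurable_funD.
have F0 z : (0 <= F z)%E by rewrite adde_ge0.
have -> : (\int[P]_w \int[leb]_x (cosh2 (h n ^+ 2 * Z n x w))%:E = \int[P]_w \int[leb]_x F (x, w))%E.
  by apply: eq_integral => w _; apply: eq_integral => x _; rewrite /cosh2 EFinD /F /E mulNr.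
rewrite -(@fubini_tonelli _ _ _ _ _ leb P F mF F0).
have -> : (\int[leb]_x \int[P]_w F (x, w) = \int[leb]_x (\int[P]_w E (h n ^+ 2)%R (x, w) + \int[P]_w E (- h n ^+ 2)%R (x, w)))%E.
  apply: eq_integral => x _; rewrite /F ge0_integralD//.
  - exact: (measurable_fun_pair2 x (mE _)).
  - exact: (measurable_fun_pair2 x (mE _)).
rewrite ge0_integralD//; last 4 first.
- by move=> x _; exact: integral_ge0.
- exact: mIE.
- by move=> x _; exact: integral_ge0.
- exact: mIE.
apply: le_trans (leeD (bound (h n ^+ 2) _ _) (bound (- h n ^+ 2) _ _)) _.
- by rewrite -exprM.
- by rewrite ger0_norm// exprn_ge0.
- by rewrite sqrrN -exprM.
- by rewrite normrN ger0_norm// exprn_ge0.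
by rewrite -EFinD lee_fin le_eqVlt; apply/orP; left; apply/eqP; ring.
Qed.

Lemma ae_cosh2 (c : R) (n0 : nat) : 0 <= k2 -> (0 < n0)%N -> 0 <= c ->
  (forall n, (n0 <= n)%N -> h n ^+ 2 * (2 * MK) <= 3^-1 /\ n%:R * h n ^+ 5 <= c * ln n%:R) ->
  exists D : nat, {ae P, forall w, exists2 M : R, 0 <= M & forall n, (n0 <= n)%N ->
    (\int[leb]_x (cosh2 (h n ^+ 2 * Z n x w))%:E <= (M * n%:R ^+ D)%:E)%E}.
Proof.
move=> k20 n00 c0 hh.
have B0 : 0 <= B by rewrite (le_trans _ (gB 0)).
have mY i : measurable_fun [set: sigma_of eps (past i%:Z)] (Y i) by exact: measurable_tail_process.
(* With this exponent the exponential factor is at most [n^D1], as [n h^5 <= c log n]. *)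
pose D1 := (Num.truncn (2 * B * k2 * c)).+1.
have D1P : 2 * B * k2 * c <= D1%:R.
  by rewrite ltW// truncnS_gt.
(* One extra power of [n] absorbs the prefactor [log n], and the telescoping factor makes the
   weighted means summable. *)
pose wt n := (n%:R ^+ D1.+1 * (n.+1%:R * n.+2%:R))^-1 : R.
have wt0 n : 0 <= wt n by rewrite /wt invr_ge0; apply: mulr_ge0; [rewrite exprn_ge0|rewrite mulr_ge0].
pose I n w := (\int[leb]_x (cosh2 (h n ^+ 2 * Z n x w))%:E)%E.
pose V n w := if (n0 <= n)%N then ((wt n)%:E * I n w)%E else 0%E.
have I0 n w : (0 <= I n w)%E by apply: integral_ge0 => x _; rewrite lee_fin cosh2_ge0.
have mI n : measurable_fun [set: T] (I n).
  apply: (@measurable_fun_fubini_tonelli_G _ _ _ _ _ leb (fun z : R * T => (cosh2 (h n ^+ 2 * Z n z.1 z.2))%:E)).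
    apply/measurable_EFinP; apply: (measurableT_comp measurable_cosh2).
    apply: measurable_funM => //.
    exact: (@measurable_kmartT _ _ _ _ eps mu (a 0) Y mY (kern (h n)) MK n (measurable_kern (h n)) (fun x => KM _)).
  by move=> z; rewrite lee_fin cosh2_ge0.
have V0 n w : (0 <= V n w)%E by rewrite /V; case: ifP => // _; rewrite mule_ge0// lee_fin.
have mV n : measurable_fun [set: T] (V n).
  by rewrite /V; case: (n0 <= n)%N => //; exact: emeasurable_funM.
have : {ae P, forall w, exists M : R, forall n, (V n w <= M%:E)%E}.
  apply: ae_bounded => //.
  apply: (@le_lt_trans _ _ (4 * k2 * c)%:E); last exact: ltry.
  apply: (@nneseries_le _ (fun n => 4 * k2 * c * (n.+1%:R * n.+2%:R)^-1)).
  - by move=> n; apply: integral_ge0.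
  - move=> n; rewrite /V; have [nn0|nn0] := boolP (n0 <= n)%N; last first.
      by rewrite integral0 lee_fin !mulr_ge0// invr_ge0 mulr_ge0.
    have [hM nh5] := hh n nn0.
    have n1 : (0 < n)%N by exact: leq_trans nn0.
    have nR : 1 <= n%:R :> R by rewrite ler1n.
    rewrite ge0_integralZl_EFin//.
    apply: le_trans (lee_wpmul2l _ (expectation_cosh2 hM k20)) _; first by rewrite lee_fin.
    rewrite -EFinM lee_fin /wt invfM mulrAC.
    rewrite ler_wpM2r ?invr_ge0 ?mulr_ge0//.
    rewrite ler_pdivrMl ?exprn_gt0 ?ltr0n//.
    have ln0 : 0 <= ln n%:R :> R by rewrite ln_ge0.
    have lnn : ln n%:R <= n%:R :> R.
      rewrite -ler_expR lnK ?posrE ?ltr0n//.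
      by apply: le_trans (expR_ge1Dx _); rewrite lerDr.
    have h5 : 0 <= n%:R * h n ^+ 5 by rewrite mulr_ge0// exprn_ge0// ltW.
    apply: (@le_trans _ _ (4 * k2 * (c * n%:R) * expR (D1%:R * ln n%:R))).
      have p1 : 4 * k2 * (n%:R * h n ^+ 5) <= 4 * k2 * (c * n%:R).
        rewrite ler_wpM2l ?mulr_ge0//; apply: le_trans nh5 _.
        by rewrite ler_wpM2l.
      have p2 : expR (2 * B * k2 * (n%:R * h n ^+ 5)) <= expR (D1%:R * ln n%:R).
        rewrite ler_expR; apply: (@le_trans _ _ (2 * B * k2 * (c * ln n%:R))).
          by rewrite ler_wpM2l ?mulr_ge0.
        by rewrite mulrA ler_wpM2r.
      have q1 : 0 <= 4 * k2 * (n%:R * h n ^+ 5) by apply: (mulr_ge0 _ h5); rewrite mulr_ge0.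
      exact: (ler_pM q1 (expR_ge0 _) p1 p2).
    rewrite expRM_natl lnK ?posrE ?ltr0n// exprS le_eqVlt; apply/orP; left; apply/eqP.
    by ring.
  - move=> n; rewrite -mulr_sumr -[leRHS]mulr1 ler_wpM2l ?mulr_ge0//.
    exact: sum_telescope_le.
(* Inverting the weight costs [n^(D1+1) (n+1) (n+2)], at most [6 n^(D1+4)] for [n >= 1]. *)
move=> aeV; exists D1.+4.
apply: filterS aeV => w [M VM].
exists (6 * `|M|); first by rewrite mulr_ge0.
move=> n nn0; have n1 : (0 < n)%N by exact: leq_trans nn0.
have nR : 1 <= n%:R :> R by rewrite ler1n.
have := VM n; rewrite /V nn0 /wt muleC -lee_pdivlMr; last first.
  by rewrite invr_gt0 mulr_gt0// ?exprn_gt0 ?ltr0n// mulr_gt0.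
rewrite invrK -EFinM => /le_trans; apply; rewrite lee_fin.
apply: (@le_trans _ _ (`|M| * (n%:R ^+ D1.+1 * (n.+1%:R * n.+2%:R)))).
  by rewrite ler_wpM2r ?ler_norm// mulr_ge0 ?exprn_ge0// mulr_ge0.
rewrite (_ : 6 * `|M| * n%:R ^+ D1.+4 = `|M| * (6 * n%:R ^+ D1.+4)); last by rewrite mulrA [_ * 6]mulrC.
rewrite ler_wpM2l//.
have -> : n%:R ^+ D1.+4 = n%:R ^+ D1.+1 * n%:R ^+ 3 :> R by rewrite -exprD addn3.
rewrite [leRHS]mulrCA ler_wpM2l ?exprn_ge0//.
have -> : n.+1%:R = n%:R + 1 :> R by rewrite natr1.
have -> : n.+2%:R = n%:R + 2 :> R by rewrite -addn2 natrD.
have : 1 <= n%:R ^+ 2 :> R by rewrite exprn_ege1.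
nra.
Qed.

End martingale_as.

(** * Deterministic estimates *)

Lemma integrable_bounded_mul d (T : measurableType d) (R : realType)
    (nu : {measure set T -> \bar R}) (K phi : T -> R) (M : R) :
  nu.-integrable setT (EFin \o K) -> measurable_fun setT phi ->
  (forall x, `|phi x| <= M) -> nu.-integrable setT (EFin \o (fun x => K x * phi x)).
Proof.
move=> iK mphi phiM.
have mK : measurable_fun setT K by apply/measurable_EFinP; exact: measurable_int iK.
apply: (@le_integrable _ _ _ nu setT measurableT _ (fun x => M%:E * (K x)%:E)%E).
- by apply/measurable_EFinP; exact: measurable_funM.
- move=> x _ /=; rewrite lee_fin !normrM mulrC ler_wpM2r//.
  by rewrite (le_trans (phiM x))// ler_norm.
- exact: integrableZl.
Qed.

Section kernel_smoothing.
Context (R : realType) (mu : probability R R).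
Local Notation leb := (@lebesgue_measure R).
Context (a : nat -> R).
Hypothesis a0 : a 0 != 0.
Context (fe : R -> R).
Hypothesis mfe : measurable_fun setT fe.
Hypothesis fe0 : forall x, 0 <= fe x.
Hypothesis mufe : forall A, measurable A -> mu A = (\int[leb]_(x in A) (fe x)%:E)%E.
Local Notation g := (scaled_density a fe).

Let mgs (h y : R) : measurable_fun setT (fun v : R => g (y - h * v)).
Proof. exact: (measurable_comp_affine y h (measurable_scaled_density a mfe)). Qed.

Lemma avg_kern_ge0 (k : R -> R) (M h y : R) : 0 < h -> measurable_fun setT k ->
  (forall x, 0 <= k x) -> (forall x, `|k x| <= M) ->
  ((avg mu (a 0) (kern k h) y)%:E = h%:E * \int[leb]_v (k v * g (y - h * v)%R)%:E)%E.
Proof.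
move=> h0 mk k0 kM.
have mg := measurable_scaled_density a mfe.
have mkh : measurable_fun setT (kern k h) by exact: measurable_kern.
pose q (t : R) := (kern k h (y - t))%:E.
have mq : measurable_fun [set: R] q.
  apply/measurable_EFinP; apply: (measurableT_comp mkh); exact: measurable_funB.
have q0 t : (0 <= q t)%E by rewrite lee_fin k0.
rewrite /avg -EFin_Rintegral//; last first.
  apply: (@bounded_integrable _ _ _ mu _ M) => [|u]; last exact: kM.
  exact: measurable_comp_affine.
have -> : (\int[mu]_u (kern k h (y - a 0 * u))%:E = \int[leb]_x (q x * (g (x - 0)%R)%:E))%E.
  rewrite -(integral_law_scaled a0 mfe fe0 mufe 0 mq q0).
  by apply: eq_integral => u _; rewrite /q addr0.
rewrite (@ge0_integral_affine _ (- h) y); last 3 first.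
- by rewrite oppr_eq0 gt_eqF.
- apply: emeasurable_funM => //; apply/measurable_EFinP; apply: (measurableT_comp mg).
  exact: measurable_funB.
- by move=> x; rewrite mule_ge0// lee_fin scaled_density_ge0.
rewrite normrN gtr0_norm//; congr (_ * _)%E; apply: eq_integral => v _.
rewrite /q -EFinM /kern; congr (k _ * g _)%:E.
  by field; rewrite gt_eqF.
by ring.
Qed.

Lemma integrable_kern_density_ge0 (k : R -> R) (M h y : R) : 0 < h -> measurable_fun setT k ->
  (forall x, 0 <= k x) -> (forall x, `|k x| <= M) ->
  leb.-integrable setT (EFin \o (fun v => k v * g (y - h * v))).
Proof.
move=> h0 mk k0 kM; apply/integrableP; split.
  by apply/measurable_EFinP; apply: measurable_funM => //; exact: mgs.
under eq_integral => v _ do rewrite /comp gee0_abs ?lee_fin ?mulr_ge0 ?scaled_density_ge0//.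
have := @avg_kern_ge0 k M h y h0 mk k0 kM.
set I := (\int[leb]_v _)%E => E; rewrite ltey; apply/eqP => Iy.
(* An infinite integral times [h > 0] would be infinite, but the average is a real number. *)
by move: E; rewrite Iy gt0_muley.
Qed.

(** The density formula is for nonnegative functions, so [K] is written as [(K + M) - M]. The
    constant is not integrable on the line, but its product with the density is. *)
Lemma avg_kern (K : R -> R) (M h y : R) : 0 < h -> measurable_fun setT K ->
  (forall x, `|K x| <= M) ->
  avg mu (a 0) (kern K h) y = h * \int[leb]_v (K v * g (y - h * v)).
Proof.
move=> h0 mK KM.
have M0 : 0 <= M by rewrite (le_trans _ (KM 0)).
pose k1 (v : R) := K v + M; pose k2 (v : R) := M.
have mk1 : measurable_fun setT k1 by exact: measurable_funD.
have mk2 : measurable_fun setT k2 by exact: measurable_cst.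
have k10 v : 0 <= k1 v by have := KM v; rewrite /k1 ler_norml => /andP[]; lra.
have k20 v : 0 <= k2 v by [].
have k1M v : `|k1 v| <= M + M by rewrite (le_trans (ler_normD _ _))// lerD// ger0_norm.
have k2M v : `|k2 v| <= M by rewrite ger0_norm.
have i1 := @integrable_kern_density_ge0 k1 _ h y h0 mk1 k10 k1M.
have i2 := @integrable_kern_density_ge0 k2 _ h y h0 mk2 k20 k2M.
have e1 := @avg_kern_ge0 k1 _ h y h0 mk1 k10 k1M.
have e2 := @avg_kern_ge0 k2 _ h y h0 mk2 k20 k2M.
rewrite EFin_Rintegral// -EFinM in e1; rewrite EFin_Rintegral// -EFinM in e2.
have -> : \int[leb]_v (K v * g (y - h * v)) =
    \int[leb]_v (k1 v * g (y - h * v)) - \int[leb]_v (k2 v * g (y - h * v)).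
  rewrite -RintegralB//; apply: eq_Rintegral => v _.
  by rewrite -mulrBl /k1 addrK.
rewrite mulrBr; move: e1 e2 => [<-] [<-].
have mKh := measurable_kern mK h.
have mc : measurable_fun setT (fun u => kern K h (y - a 0 * u)) by exact: measurable_comp_affine.
rewrite /avg -RintegralB//.
- by apply: eq_Rintegral => u _; rewrite /kern /k1 addrK.
- apply: (@bounded_integrable _ _ _ mu _ (M + M)) => [|u]; last exact: k1M.
  exact: (measurable_comp_affine _ _ (measurable_kern mk1 h)).
- by apply: (@bounded_integrable _ _ _ mu _ M) => [|u]; [|exact: k2M].
Qed.

End kernel_smoothing.

Section smoothing_bounds.
Context (R : realType).
Local Notation leb := (@lebesgue_measure R).
Context (K : R -> R) (k1 MS : R).
Hypothesis iK : leb.-integrable setT (EFin \o K).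
Hypothesis K1 : \int[leb]_u K u = 1.
Hypothesis normK : (\int[leb]_u `|K u|%:E <= k1%:E)%E.
Hypothesis suppK : forall u, MS < `|u| -> K u = 0.
Hypothesis Kodd : \int[leb]_u (u * K u) = 0.

Let mK : measurable_fun setT K.
Proof. by apply/measurable_EFinP; exact: measurable_int iK. Qed.

Let k10 : 0 <= k1.
Proof. by rewrite -lee_fin; apply: le_trans normK; apply: integral_ge0. Qed.

Lemma smoothing_bias (f : R -> R) (Bf M h x : R) : (forall x, derivable f x 1) ->
  (forall x, derivable (derive1 f) x 1) -> (forall x, `|derive1 (derive1 f) x| <= M) ->
  (forall x, `|f x| <= Bf) ->
  `|\int[leb]_v (K v * f (x - h * v)) - f x| <= M * MS ^+ 2 * k1 * h ^+ 2.
Proof.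
move=> df ddf fM fB.
have M0 : 0 <= M by rewrite (le_trans _ (fM 0)).
have mf : measurable_fun setT f.
  by apply: continuous_measurable_fun; exact: derivable_continuous.
have iKf : leb.-integrable setT (EFin \o (fun v => K v * f (x - h * v))).
  apply: (integrable_bounded_mul iK) (fun v => fB _).
  exact: measurable_comp_affine.
have iuK : leb.-integrable setT (EFin \o (fun v => v * K v)).
  apply: (@le_integrable _ _ _ leb setT measurableT _ (fun v => MS%:E * (K v)%:E)%E).
  - by apply/measurable_EFinP; exact: measurable_funM.
  - move=> v _ /=; rewrite lee_fin !normrM.
    have [vM|vM] := ltP MS `|v|; first by rewrite (suppK vM) normr0 !mulr0.
    by rewrite ler_wpM2r// (le_trans vM)// ler_norm.
  - exact: (integrableZl _ _ iK).
(* The Taylor remainder: the kernel has mass 1 and first moment 0, so subtracting the affine part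
   removes exactly [f x]. *)
pose r v := f (x - h * v) - f x - (- (h * v)) * derive1 f x.
have iKr : leb.-integrable setT (EFin \o (fun v => K v * r v)).
  rewrite (_ : EFin \o _ = (fun v => ((K v * f (x - h * v))%:E - ((f x)%:E * (K v)%:E))
      + (h * derive1 f x)%:E * (v * K v)%:E)%E); last first.
    by apply/funext => v /=; rewrite -!EFinM -EFinB -EFinD /r; congr EFin; ring.
  apply: integrableD => //; last exact: (integrableZl _ _ iuK).
  apply: integrableB => //; exact: (integrableZl _ _ iK).
have -> : \int[leb]_v (K v * f (x - h * v)) - f x = \int[leb]_v (K v * r v).
  have iZK c : leb.-integrable setT (EFin \o (fun v => c * K v)) by exact: (integrableZl measurableT c iK).
  have iZu c : leb.-integrable setT (EFin \o (fun v => c * (v * K v))) by exact: (integrableZl measurableT c iuK).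
  have iB : leb.-integrable setT (EFin \o (fun v => K v * f (x - h * v) - f x * K v)).
    exact: (integrableB measurableT iKf (iZK (f x))).
  transitivity (\int[leb]_v ((K v * f (x - h * v) - f x * K v) + (h * derive1 f x) * (v * K v))).
    rewrite RintegralD// RintegralB// RintegralZl// RintegralZl// K1 Kodd.
    by rewrite mulr1 mulr0 addr0.
  by apply: eq_Rintegral => v _; rewrite /r; ring.
apply: le_trans (le_normr_Rintegral _ iKr) _ => //.
have cr v : `|K v * r v| <= (M * MS ^+ 2 * h ^+ 2) * `|K v|.
  have [vM|vM] := ltP MS `|v|; first by rewrite (suppK vM) mul0r normr0 mulr0.
  rewrite normrM mulrC ler_wpM2r//.
  apply: le_trans (taylor2_le df ddf fM x (- (h * v))) _.
  have -> : M * (- (h * v)) ^+ 2 = M * h ^+ 2 * v ^+ 2 by ring.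
  have -> : M * MS ^+ 2 * h ^+ 2 = M * h ^+ 2 * MS ^+ 2 by ring.
  apply: ler_wpM2l; first by rewrite mulr_ge0// sqr_ge0.
  by rewrite -(real_normK (num_real v)) lerXn2r// nnegrE// (le_trans _ vM).
have inK : leb.-integrable setT (EFin \o (fun v => `|K v|)) by exact: (integrable_norm iK).
apply: (@le_trans _ _ (\int[leb]_v ((M * MS ^+ 2 * h ^+ 2) * `|K v|))).
  apply: le_Rintegral => //; first exact: (integrable_norm iKr).
  exact: (integrableZl measurableT _ inK).
rewrite RintegralZl// [leRHS]mulrAC; apply: ler_wpM2l; first by rewrite mulr_ge0 ?sqr_ge0// mulr_ge0 ?sqr_ge0.
by rewrite -lee_fin -EFin_Rintegral.
Qed.

End smoothing_bounds.

Section pointwise.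
Context (R : realType).

(** Using the logarithm of the larger argument avoids the singularity of the entropy at 0: for
    [v <= u], the remaining term [v (ln u - ln v)] is at most [u - v]. *)
Lemma entropy_diff_le (x y : R) : 0 < x -> 0 <= y ->
  `|x * ln x - y * ln y| <= `|x - y| * (1 + `|ln (Num.max x y)|).
Proof.
have key (u v : R) : 0 < u -> 0 <= v -> v <= u ->
    `|u * ln u - v * ln v| <= `|u - v| * (1 + `|ln u|).
  move=> u0; rewrite le_eqVlt => /predU1P[<- _|v0 vu].
    rewrite mul0r !subr0 normrM ler_wpM2l//.
    by rewrite lerDr.
  have -> : u * ln u - v * ln v = (u - v) * ln u + v * (ln u - ln v) by ring.
  have -> : `|u - v| * (1 + `|ln u|) = `|u - v| * `|ln u| + `|u - v| by ring.
  apply: le_trans (ler_normD _ _) _; rewrite normrM lerD2l.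
  rewrite -ln_div ?posrE//.
  have uv1 : 1 <= u / v by rewrite ler_pdivlMr ?mul1r.
  rewrite !ger0_norm ?subr_ge0 ?mulr_ge0 ?(ltW v0) ?ln_ge0//.
  have : ln (u / v) <= u / v - 1.
    by rewrite -[X in ln X](addrNK 1) addrC le_ln1Dx//; lra.
  move=> /(ler_wpM2l (ltW v0)) /le_trans; apply.
  have -> : v * (u / v - 1) = u - v by field; rewrite gt_eqF.
  by [].
move=> x0 y0; have [yx|/ltW xy] := leP y x.
  exact: key.
have yp : 0 < y by exact: lt_le_trans xy.
by rewrite distrC (distrC x); apply: key => //; exact: ltW.
Qed.

(** The bound [ln z <= z] at [t] and at its inverse. The term [g^-1] is the source of one of the two
    powers of [1 / gamma] in the rate. *)
Lemma abs_ln_le (t g : R) : 0 < g -> g <= t -> `|ln t| <= g^-1 + t.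
Proof.
move=> g0 gt; have t0 : 0 < t by exact: lt_le_trans gt.
have lnle (z : R) : 0 < z -> ln z <= z.
  by move=> z0; rewrite -ler_expR lnK// (le_trans _ (expR_ge1Dx _))// lerDr.
have gi : 0 < g^-1 by rewrite invr_gt0.
rewrite ler_norml; apply/andP; split; last first.
  by rewrite (le_trans (lnle t t0))// lerDr ltW.
rewrite lerNl -lnV ?posrE//.
have tg : t^-1 <= g^-1 by rewrite lef_pV2 ?posrE.
by have := lnle t^-1; rewrite invr_gt0 => /(_ t0); lra.
Qed.

(** The bias [b] and the past part [nu] are bounded beforehand, the martingale part [ze] is not. Its
    product with itself, which arises because the logarithm is bounded through [fn], is kept as a
    square. *)
Lemma entropy_integrand_le (fn f b nu ze C g : R) : 0 < g -> g <= 1 -> g <= fn ->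
  0 <= f <= C -> 0 <= b <= C -> 0 <= nu <= C -> 0 <= ze ->
  `|fn - f| <= b + nu + ze ->
  `|fn * ln fn - f * ln f| <= (2 + 5 * C) / g * (b + nu + ze) + ze ^+ 2.
Proof.
move=> g0 g1 gfn /andP[f0 fC] /andP[b0 bC] /andP[nu0 nuC] ze0 D.
have fn0 : 0 < fn by exact: lt_le_trans gfn.
apply: le_trans (entropy_diff_le fn0 f0) _.
set m := Num.max fn f.
have gm : g <= m by rewrite /m le_max gfn.
have mle : m <= f + (b + nu + ze).
  rewrite /m ge_max; apply/andP; split; last by lra.
  by have := le_trans (ler_norm _) D; lra.
have := abs_ln_le g0 gm.
have gi : 1 <= g^-1 by rewrite invf_ge1.
set L := `|ln m|; set G := g^-1 in gi * => LG.
have L0 : 0 <= L by exact: normr_ge0.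
set E := b + nu + ze in D mle *.
have E0 : 0 <= E by rewrite /E; lra.
apply: (@le_trans _ _ (E * (1 + L))); first by rewrite ler_wpM2r//; lra.
have C0 : 0 <= C by lra.
have : E * (1 + L) <= E * ((2 + 3 * C) * G + ze).
  rewrite ler_wpM2l//.
  have : 3 * C <= 3 * C * G by rewrite ler_peMr// mulr_ge0.
  by rewrite /E in mle; lra.
move/le_trans; apply.
have : E * ze <= 2 * C * G * ze + ze ^+ 2.
  rewrite expr2 -mulrDl ler_wpM2r//.
  have : 2 * C <= 2 * C * G by rewrite ler_peMr// mulr_ge0.
  by rewrite /E; lra.
have : 2 * C * G * ze <= 2 * C * G * E.
  by rewrite ler_wpM2l ?mulr_ge0//; rewrite /E; lra.
by nra.
Qed.

(** From [exp(s - L) >= 1 + s - L]: linear up to the level [L], exponential beyond it. With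
    [L = D log n] the factor [exp(-L)] cancels a bound of order [n^D] on the integral of [cosh2]. *)
Lemma le_cosh2 (t L : R) : 0 <= L -> `|t| <= (L + 2) + expR (- L) * cosh2 t.
Proof.
move=> L0.
have eL : expR (- L) <= 1 by rewrite expR_le1 oppr_le0.
have eL0 := expR_ge0 (- L).
have key (s : R) : s <= L + 2 + expR (- L) * (expR s - 2).
  by have := expR_ge1Dx (s - L); rewrite expRD; lra.
have c1 : expR t - 2 <= cosh2 t by have := expR_ge0 (- t); rewrite /cosh2 /expR2; lra.
have c2 : expR (- t) - 2 <= cosh2 t by have := expR_ge0 t; rewrite /cosh2 /expR2; lra.
rewrite ler_norml; apply/andP; split.
  have := key (- t); have := ler_wpM2l eL0 c2; lra.
by have := key t; have := ler_wpM2l eL0 c1; lra.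
Qed.

Lemma sqr_le_cosh2 (t L : R) : 0 <= L -> t ^+ 2 <= (2 * L ^+ 2 + 16) + 8 * expR (- L) * cosh2 t.
Proof.
move=> L0.
have eL : expR (- L) <= 1 by rewrite expR_le1 oppr_le0.
have eL0 := expR_ge0 (- L).
have sq (s : R) : 0 <= s -> s ^+ 2 <= 4 * expR s.
  move=> s0; have : (1 + s / 2) ^+ 2 <= expR s.
    rewrite {2}(_ : s = s / 2 + s / 2); last by lra.
    by rewrite expRD -expr2 lerXn2r ?nnegrE ?expR_ge0 ?expR_ge1Dx//; lra.
  by nra.
have key (s : R) : 0 <= s -> s ^+ 2 <= 2 * L ^+ 2 + 16 + 8 * expR (- L) * (expR s - 2).
  move=> s0.
  have : s ^+ 2 <= 2 * L ^+ 2 + 8 * expR (- L) * expR s.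
    have [sL|Ls] := leP s L.
      have : 0 <= 8 * expR (- L) * expR s by rewrite !mulr_ge0// expR_ge0.
      have : s ^+ 2 <= L ^+ 2 by rewrite lerXn2r.
      by have := sqr_ge0 L; lra.
    have := sq (s - L); rewrite subr_ge0 => /(_ (ltW Ls)); rewrite expRD => H.
    (* Beyond [L] only the excess [s - L] is paid for by the exponential. *)
    have : s ^+ 2 <= 2 * L ^+ 2 + 2 * (s - L) ^+ 2 by have := sqr_ge0 (s - 2 * L); nra.
    by move: H; set e1 := expR s; set e2 := expR (- L); lra.
  by nra.
have c1 : expR t - 2 <= cosh2 t by have := expR_ge0 (- t); rewrite /cosh2 /expR2; lra.
have c2 : expR (- t) - 2 <= cosh2 t by have := expR_ge0 t; rewrite /cosh2 /expR2; lra.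
have e8 : 0 <= 8 * expR (- L) by rewrite mulr_ge0.
have [t0|t0] := leP 0 t.
  by apply: le_trans (key t t0) _; rewrite lerD2l ler_wpM2l.
rewrite -sqrrN; apply: le_trans (key (- t) _) _; first by rewrite oppr_ge0 ltW.
by rewrite lerD2l ler_wpM2l.
Qed.

End pointwise.

Section integral_bounds.
Context (R : realType).
Local Notation leb := (@lebesgue_measure R).
Context (A : set R) (al : R).
Hypothesis mA : measurable A.
Hypothesis Aal : (leb A <= al%:E)%E.

Lemma integral_cst_le (c : R) : 0 <= c -> (\int[leb]_(x in A) c%:E <= (c * al)%:E)%E.
Proof. by move=> c0; rewrite integral_cst// EFinM lee_wpmul2l// lee_fin. Qed.

Lemma integral_affine_le (F G : R -> R) (c1 c2 I : R) : 0 <= c1 -> 0 <= c2 ->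
  measurable_fun setT F -> measurable_fun setT G ->
  (forall x, 0 <= F x) -> (forall x, 0 <= G x) ->
  (forall x, F x <= c1 + c2 * G x) ->
  (\int[leb]_x (G x)%:E <= I%:E)%E ->
  (\int[leb]_(x in A) (F x)%:E <= (c1 * al + c2 * I)%:E)%E.
Proof.
move=> c10 c20 mF mG F0 G0 FG GI.
have mGE : measurable_fun [set: R] (fun x => (G x)%:E) by exact/measurable_EFinP.
have mGA : measurable_fun A (fun x => (G x)%:E) by exact: measurable_funTS.
apply: (@le_trans _ _ (\int[leb]_(x in A) (c1%:E + c2%:E * (G x)%:E))%E).
  apply: ge0_le_integral; [exact: mA| | | |].
  - by move=> x _; rewrite lee_fin.
  - by apply: measurable_funTS; exact/measurable_EFinP.
  - by apply: emeasurable_funD => //; exact: emeasurable_funM.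
  - by move=> x _; rewrite -EFinM -EFinD lee_fin.
rewrite ge0_integralD//; last 2 first.
- by move=> x _; rewrite -EFinM lee_fin mulr_ge0.
- exact: emeasurable_funM.
rewrite EFinD; apply: leeD; first exact: integral_cst_le.
have G0E x : A x -> (0 <= (G x)%:E)%E by move=> _; rewrite lee_fin.
rewrite (ge0_integralZl_EFin leb mA G0E mGA c20) EFinM lee_wpmul2l// ?lee_fin//.
apply: le_trans GI; apply: ge0_subset_integral => // x _; by rewrite lee_fin.
Qed.

Lemma integral_norm_cosh2 (Z : R -> R) (lam L V M : R) : 0 < lam -> 0 <= L ->
  measurable_fun setT Z -> (\int[leb]_x (cosh2 (lam * Z x))%:E <= V%:E)%E ->
  expR (- L) * V <= M ->
  (\int[leb]_(x in A) `|Z x|%:E <= (lam^-1 * ((L + 2) * al + M))%:E)%E /\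
  (\int[leb]_(x in A) (Z x ^+ 2)%:E <= (lam ^- 2 * ((2 * L ^+ 2 + 16) * al + 8 * M))%:E)%E.
Proof.
move=> l0 L0 mZ ZV eV.
have li : 0 < lam^-1 by rewrite invr_gt0.
have mc : measurable_fun setT (fun x => cosh2 (lam * Z x)).
  by apply: (measurableT_comp (@measurable_cosh2 R)); exact: measurable_funM.
have eL0 := expR_ge0 (- L).
have c0 x : 0 <= cosh2 (lam * Z x) by exact: cosh2_ge0.
split.
- have c1 : 0 <= lam^-1 * (L + 2) by rewrite mulr_ge0 ?ltW//; lra.
  have c2 : 0 <= lam^-1 * expR (- L) by exact: (mulr_ge0 (ltW li) eL0).
  have mnZ : measurable_fun setT (fun x => `|Z x|) by exact: (measurableT_comp (@normr_measurable R setT)).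
  have H x : `|Z x| <= lam^-1 * (L + 2) + lam^-1 * expR (- L) * cosh2 (lam * Z x).
    have := le_cosh2 (lam * Z x) L0; rewrite normrM gtr0_norm// => H.
    by rewrite -mulrA -mulrDr ler_pdivlMl.
  apply: le_trans (integral_affine_le c1 c2 mnZ mc (fun x => normr_ge0 _) c0 H ZV) _.
  rewrite lee_fin (_ : _ + _ = lam^-1 * ((L + 2) * al + expR (- L) * V)); last by ring.
  by apply: ler_wpM2l; [exact: ltW|rewrite lerD2l].
- have li2 : 0 <= lam ^- 2 by rewrite invr_ge0 sqr_ge0.
  have L2 : 0 <= 2 * L ^+ 2 + 16 by have := sqr_ge0 L; lra.
  have c1 : 0 <= lam ^- 2 * (2 * L ^+ 2 + 16) by rewrite mulr_ge0.
  have c2 : 0 <= lam ^- 2 * (8 * expR (- L)) by rewrite mulr_ge0// mulr_ge0.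
  have mZ2 : measurable_fun setT (fun x => Z x ^+ 2) by exact: measurable_funX.
  have H x : Z x ^+ 2 <= lam ^- 2 * (2 * L ^+ 2 + 16) + lam ^- 2 * (8 * expR (- L)) * cosh2 (lam * Z x).
    have := sqr_le_cosh2 (lam * Z x) L0; rewrite exprMn => H.
    by rewrite -[lam ^- 2 * (8 * _) * _]mulrA -mulrDr ler_pdivlMl ?exprn_gt0.
  apply: le_trans (integral_affine_le c1 c2 mZ2 mc (fun x => sqr_ge0 _) c0 H ZV) _.
  rewrite lee_fin (_ : _ + _ = lam ^- 2 * ((2 * L ^+ 2 + 16) * al + 8 * (expR (- L) * V))); last by ring.
  by rewrite ler_wpM2l// lerD2l ler_wpM2l.
Qed.

Context (K : R -> R) (k1 : R).
Hypothesis iK : leb.-integrable setT (EFin \o K).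
Hypothesis normK : (\int[leb]_u `|K u|%:E <= k1%:E)%E.

Let mK : measurable_fun setT K.
Proof. by apply/measurable_EFinP; exact: measurable_int iK. Qed.

Lemma smoothing_abs (S : R -> R) (M h x : R) : measurable_fun setT S ->
  (forall x, `|S x| <= M) ->
  (`|\int[leb]_v (K v * S (x - h * v))|%:E <= \int[leb]_v (`|K v| * `|S (x - h * v)|)%:E)%E.
Proof.
move=> mS SM.
have mSx : measurable_fun setT (fun v => S (x - h * v)) by exact: measurable_comp_affine.
have iKS : leb.-integrable setT (EFin \o (fun v => K v * S (x - h * v))).
  exact: (integrable_bounded_mul iK mSx (fun v => SM _)).
have := le_normr_Rintegral measurableT iKS.
rewrite -lee_fin => /le_trans; apply.
rewrite -EFin_Rintegral//; last exact: (integrable_norm iKS).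
by rewrite le_eqVlt; apply/orP; left; apply/eqP; apply: eq_integral => v _; rewrite normrM.
Qed.

Lemma smoothing_sup (S : R -> R) (M h x : R) : measurable_fun setT S ->
  (forall x, `|S x| <= M) -> `|\int[leb]_v (K v * S (x - h * v))| <= M * k1.
Proof.
move=> mS SM; rewrite -lee_fin; apply: le_trans (smoothing_abs h x mS SM) _.
have M0 : 0 <= M by rewrite (le_trans _ (SM 0)).
have mnK : measurable_fun [set: R] (fun v => `|K v|%:E).
  by apply/measurable_EFinP; exact: measurableT_comp.
apply: (@le_trans _ _ (\int[leb]_v (M%:E * `|K v|%:E))%E).
  apply: ge0_le_integral => //.
  - apply/measurable_EFinP; apply: measurable_funM; first exact: measurableT_comp.
    by apply: measurableT_comp => //; exact: measurable_comp_affine.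
  - exact: emeasurable_funM.
  - by move=> v _; rewrite lee_fin mulrC ler_wpM2r.
by rewrite ge0_integralZl_EFin// EFinM lee_wpmul2l// lee_fin.
Qed.

Lemma measurable_smoothing_abs (S : R -> R) h : measurable_fun setT S ->
  measurable_fun setT (fun x : R => \int[leb]_v (`|K v| * `|S (x - h * v)%R|)%:E)%E.
Proof.
move=> mS.
apply: (@measurable_fun_fubini_tonelli_F _ _ _ _ _ leb (fun z : R * R => (`|K z.2| * `|S (z.1 - h * z.2)|)%:E)) => //.
apply/measurable_EFinP; apply: measurable_funM.
  by apply: measurableT_comp => //; exact: (measurableT_comp mK).
apply: measurableT_comp => //; apply: (measurableT_comp mS).
by apply: measurable_funB => //; exact: measurable_funM.
Qed.

(** The inequality [|y| <= s + y^2 / s] stands in for Cauchy-Schwarz: the constant is integrated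
    over [A] only, the square over the whole line. The free parameter [s] becomes [n h^2] later. *)
Lemma integral_smoothing_abs (S : R -> R) (h s be : R) : measurable_fun setT S ->
  0 < s -> (\int[leb]_x (S x ^+ 2)%:E <= be%:E)%E -> 0 <= k1 ->
  (\int[leb]_(x in A) \int[leb]_v (`|K v| * `|S (x - h * v)%R|)%:E <=
    (k1 * (s * al + be / s))%:E)%E.
Proof.
move=> mS s0 Sbe k10.
have mnK : measurable_fun [set: R] (fun v => `|K v|%:E).
  by apply/measurable_EFinP; exact: measurableT_comp.
pose F (z : R * R) := (s^-1%:E * (`|K z.2| * S (z.1 - h * z.2) ^+ 2)%:E)%E.
have mF0 : measurable_fun setT (fun z : R * R => `|K z.2| * S (z.1 - h * z.2) ^+ 2).
  apply: measurable_funM.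
    by apply: measurableT_comp => //; exact: (measurableT_comp mK).
  apply: measurable_funX; apply: (measurableT_comp mS).
  by apply: measurable_funB => //; exact: measurable_funM.
have mF : measurable_fun setT F by apply: emeasurable_funM => //; exact/measurable_EFinP.
have si : 0 <= s^-1 by rewrite invr_ge0 ltW.
have F0 z : (0 <= F z)%E.
  by rewrite /F -EFinM lee_fin; apply: mulr_ge0 => //; apply: mulr_ge0 => //; exact: sqr_ge0.
have mIF : measurable_fun setT (fun x : R => \int[leb]_v F (x, v))%E.
  exact: (@measurable_fun_fubini_tonelli_F _ _ _ _ _ leb F).
have ptw (x : R) : (\int[leb]_v (`|K v| * `|S (x - h * v)%R|)%:E <=
    (s * k1)%:E + \int[leb]_v F (x, v))%E.
  have mFx : measurable_fun [set: R] (fun v => F (x, v)) by exact: (measurable_fun_pair2 x mF).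
  apply: (@le_trans _ _ (\int[leb]_v (s%:E * `|K v|%:E + F (x, v)))%E).
    apply: ge0_le_integral => //.
    - apply/measurable_EFinP; apply: measurable_funM; first exact: measurableT_comp.
      by apply: measurableT_comp => //; exact: measurable_comp_affine.
    - by apply: emeasurable_funD => //; exact: emeasurable_funM.
    - move=> v _; rewrite /F -!EFinM -EFinD lee_fin/=.
      set y := S _; rewrite [s * _]mulrC [s^-1 * _]mulrCA -mulrDr ler_wpM2l//.
      rewrite -(real_normK (num_real y)).
      have y0 := normr_ge0 y.
      have -> : s + s^-1 * `|y| ^+ 2 = (s ^+ 2 + `|y| ^+ 2) / s by field; rewrite gt_eqF.
      rewrite ler_pdivlMr//; have := sqr_ge0 (s - `|y|); nra.
  rewrite ge0_integralD//; last 2 first.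
  - by move=> v _; rewrite -EFinM lee_fin mulr_ge0// ltW.
  - exact: emeasurable_funM.
  rewrite leeD2r// ge0_integralZl_EFin ?(ltW s0)// EFinM lee_wpmul2l// lee_fin ltW//.
apply: (@le_trans _ _ (\int[leb]_(x in A) ((s * k1)%:E + \int[leb]_v F (x, v)))%E).
  apply: ge0_le_integral => //.
  - by move=> x _; apply: integral_ge0 => v _; rewrite lee_fin mulr_ge0.
  - by apply: measurable_funTS; exact: measurable_smoothing_abs.
  - by apply: emeasurable_funD => //; exact: measurable_funTS.
rewrite ge0_integralD//; last 3 first.
- by move=> x _; rewrite lee_fin mulr_ge0// ltW.
- by move=> x _; exact: integral_ge0.
- exact: measurable_funTS.
rewrite mulrDr EFinD; apply: leeD.
  apply: le_trans (integral_cst_le _) _; first by rewrite mulr_ge0// ltW.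
  by rewrite lee_fin le_eqVlt; apply/orP; left; apply/eqP; ring.
apply: (@le_trans _ _ (\int[leb]_x \int[leb]_v F (x, v))%E).
  by apply: ge0_subset_integral => // x _; exact: integral_ge0.
rewrite (@fubini_tonelli _ _ _ _ _ leb leb F mF F0).
apply: (@le_trans _ _ (\int[leb]_v ((be / s)%:E * `|K v|%:E))%E).
  apply: ge0_le_integral => //.
  - by move=> v _; exact: integral_ge0.
  - exact: (@measurable_fun_fubini_tonelli_G _ _ _ _ _ leb F).
  - exact: emeasurable_funM.
  - move=> v _; rewrite /F/=.
    under eq_integral do rewrite -EFinM mulrCA mulrA EFinM.
    have mS2 : measurable_fun [set: R] (fun x => (S x ^+ 2)%:E).
      by apply/measurable_EFinP; exact: measurable_funX.
    have S20 (x : R) : (0 <= (S x ^+ 2)%:E)%E by rewrite lee_fin sqr_ge0.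
    rewrite ge0_integralZl_EFin//; last 2 first.
    + apply/measurable_EFinP; apply: measurable_funX; apply: (measurableT_comp mS).
      exact: measurable_funB.
    + by rewrite mulr_ge0.
    rewrite (@ge0_integral_shift _ (h * v) (fun x => (S x ^+ 2)%:E) mS2 S20).
    apply: le_trans (lee_wpmul2l _ Sbe) _; first by rewrite lee_fin mulr_ge0.
    by rewrite -!EFinM lee_fin le_eqVlt; apply/orP; left; apply/eqP; ring.
have be0 : 0 <= be.
  by rewrite -lee_fin; apply: le_trans Sbe; apply: integral_ge0 => x _; rewrite lee_fin sqr_ge0.
have bs : 0 <= be / s by rewrite mulr_ge0.
by rewrite ge0_integralZl_EFin// [(k1 * _)%R]mulrC [leRHS]EFinM lee_wpmul2l.
Qed.

End integral_bounds.

Section asymptotics.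
Context (R : realType).

Lemma limn_esup_lt_near (u : nat -> \bar R) (M : \bar R) :
  (limn_esup u < M)%E -> \forall n \near \oo, (u n < M)%E.
Proof.
rewrite limn_esup_lim (cvg_lim _ (@cvg_esups_inf _ _))// => /ereal_inf_lt[_ [N _ <-] uM].
exists N => // n /= Nn; apply: le_lt_trans uM.
by apply: ereal_sup_ubound; exists n.
Qed.

(** Fifth powers of the ratio bounds. This is the only form in which (B.1) enters the proof. *)
Lemma asymp_bounds (h : nat -> R) : (forall n, 0 < h n) ->
  asymp h (fun n => (n%:R^-1 * ln n%:R) `^ (5^-1)) ->
  exists c1 c2 : R, [/\ 0 < c1, 0 < c2 &
    \forall n \near \oo, c1 * ln n%:R <= n%:R * h n ^+ 5 <= c2 * ln n%:R].
Proof.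
move=> h0; pose b (n : nat) : R := (n%:R^-1 * ln n%:R) `^ (5^-1).
rewrite -[X in asymp h X]/b => -[inf0 [_ supy]].
have [c c0 cinf] : exists2 c : R, 0 < c & (c%:E < limn_einf (fun n => (h n / b n)%:E))%E.
  case: (limn_einf _) inf0 => [r| |]//; rewrite ?lte_fin.
    by move=> r0; exists (r / 2); rewrite ?lte_fin; lra.
  by move=> _; exists 1; rewrite ?ltry.
have [C Csup] : exists C : R, (limn_esup (fun n => (h n / b n)%:E) < C%:E)%E.
  case: (limn_esup _) supy => [r| |]//; first by exists (r + 1); rewrite lte_fin ltrDl.
  by exists 0; rewrite ltNyr.
have nc : \forall n \near \oo, c < h n / b n.
  have : (limn_esup (fun n => - (h n / b n)%:E) < - c%:E)%E by rewrite lteNr.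
  by move/limn_esup_lt_near; apply: filterS => n; rewrite lteN2 lte_fin.
have nC : \forall n \near \oo, h n / b n < C by have := limn_esup_lt_near Csup.
exists (c ^+ 5), ((`|C| + 1) ^+ 5); split; first exact: exprn_gt0.
  by apply: exprn_gt0; apply: ltr_wpDl.
near=> n.
have n2 : (2 <= n)%N by near: n; exists 2%N.
have nR : 0 < n%:R :> R by rewrite ltr0n (leq_trans _ n2).
have ln0 : 0 < ln n%:R :> R by rewrite ln_gt0// ltr1n.
have b5 : b n ^+ 5 = n%:R^-1 * ln n%:R.
  rewrite /b -powR_mulrn ?powR_ge0// -powRrM mulVf ?pnatr_eq0// powRr1// mulr_ge0 ?invr_ge0 ?ltW//.
have b0 : 0 < b n by rewrite powR_gt0// mulr_gt0// invr_gt0.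
have hr : h n = h n / b n * b n by rewrite divfK// gt_eqF.
have r1 : c < h n / b n by near: n.
have r2 : h n / b n < C by near: n.
have E : n%:R * h n ^+ 5 = (h n / b n) ^+ 5 * ln n%:R.
  by rewrite {1}hr exprMn b5 mulrCA mulVKf// gt_eqF.
have r0 : 0 < h n / b n by exact: lt_trans r1.
have C1 : h n / b n <= `|C| + 1.
  by rewrite (le_trans (ltW r2))// (le_trans (ler_norm C))// lerDl.
rewrite E; apply/andP; split; (apply: ler_wpM2r; first exact: ltW).
  by apply: lerXn2r; rewrite ?nnegrE; exact: ltW.
by apply: lerXn2r => //; rewrite nnegrE ?addr_ge0// ltW.
Unshelve. all: by end_near. Qed.

(** Comparing fifth powers removes the real exponent; [1 + c^2] instead of [c^2] ensures a base of
    at least 1. *)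
Lemma rate_le (n : nat) (ga h c : R) : 0 < ga -> 0 < h -> 0 <= c -> 0 < ln n%:R :> R ->
  n%:R * h ^+ 5 <= c * ln n%:R ->
  (n%:R * ga ^+ 5 / ln n%:R) `^ (2 / 5) <= (1 + c ^+ 2) * (ga ^+ 2 / h ^+ 2).
Proof.
move=> g0 h0 c0 ln0 nh.
have gh : 0 < ga ^+ 2 / h ^+ 2 by rewrite divr_gt0 ?exprn_gt0.
have c2 : 0 <= c ^+ 2 by exact: sqr_ge0.
set x := n%:R * ga ^+ 5 / ln n%:R.
have x0 : 0 <= x.
  by rewrite /x; apply: divr_ge0; [apply: mulr_ge0 => //; apply: exprn_ge0|]; exact: ltW.
have rhs0 : 0 <= (1 + c ^+ 2) * (ga ^+ 2 / h ^+ 2) by apply: mulr_ge0 (ltW gh); rewrite addr_ge0.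
rewrite -(@ler_pXn2r _ 5)// ?nnegrE ?powR_ge0//.
have -> : (x `^ (2 / 5)) ^+ 5 = x ^+ 2.
  by rewrite -[LHS]powR_mulrn ?powR_ge0// -powRrM divfK ?pnatr_eq0// powR_mulrn.
have xle : x <= c * (ga ^+ 5 / h ^+ 5).
  rewrite /x ler_pdivrMr//.
  rewrite (_ : c * _ * _ = ga ^+ 5 * (c * ln n%:R) / h ^+ 5); last by ring.
  rewrite ler_pdivlMr ?exprn_gt0//.
  rewrite (_ : _ * h ^+ 5 = ga ^+ 5 * (n%:R * h ^+ 5)); last by ring.
  by rewrite ler_wpM2l// exprn_ge0// ltW.
apply: (@le_trans _ _ ((c * (ga ^+ 5 / h ^+ 5)) ^+ 2)).
  by rewrite lerXn2r// nnegrE (le_trans x0).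
rewrite exprMn (_ : (ga ^+ 5 / h ^+ 5) ^+ 2 = (ga ^+ 2 / h ^+ 2) ^+ 5); last first.
  by rewrite !expr_div_n -!exprM.
rewrite [leRHS]exprMn ler_wpM2r ?exprn_ge0 ?(ltW gh)//.
apply: (@le_trans _ _ (1 + c ^+ 2)); first by rewrite lerDr.
by rewrite -[leLHS]expr1 ler_weXn2l// lerDl.
Qed.

End asymptotics.

Section decomposition.
Context d (T : measurableType d) (R : realType) (P : probability T R).
Context (eps : int -> {RV P >-> R}) (mu : probability R R).
Local Notation leb := (@lebesgue_measure R).
Context (a : nat -> R).
Hypothesis a0 : a 0 != 0.
Context (fe : R -> R).
Hypothesis mfe : measurable_fun setT fe.
Hypothesis fe0 : forall x, 0 <= fe x.
Hypothesis mufe : forall A, measurable A -> mu A = (\int[leb]_(x in A) (fe x)%:E)%E.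
Local Notation g := (scaled_density a fe).
Local Notation Y := (tail_process eps a).
Context (B : R) (f : R -> R).
Hypothesis gB : forall x, `|g x| <= B.
Hypothesis mf : measurable_fun setT f.
Hypothesis fB : forall x, `|f x| <= B.
Context (K : R -> R) (MK : R).
Hypothesis iK : leb.-integrable setT (EFin \o K).
Hypothesis KM : forall x, `|K x| <= MK.

Let mK : measurable_fun setT K.
Proof. by apply/measurable_EFinP; exact: measurable_int iK. Qed.

Lemma measurable_block_path n w : measurable_fun setT (block_sum eps a fe f 0 n ^~ w).
Proof.
apply: measurable_sum => p; apply: measurable_funB => //.
apply: (measurableT_comp (measurable_scaled_density a mfe)).
exact: measurable_funB.
Qed.

Lemma block_path_bound n w x : `|block_sum eps a fe f 0 n x w| <= n%:R * (2 * B).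
Proof.
rewrite (le_trans (ler_norm_sum _ _ _))//.
apply: (@le_trans _ _ (\sum_(p < n) 2 * B)); last first.
  by rewrite sumr_const card_ord [leRHS]mulr_natl.
apply: ler_sum => p _; rewrite (le_trans (ler_normB _ _))//.
by rewrite mulr_natl mulr2n; exact: (lerD (gB _) (fB _)).
Qed.

(** By [avg_kern] each conditional mean is a smoothed translate of the density of the scaled
    innovation, so linearity moves the sum inside the kernel integral. *)
Lemma smoothed_past h n w x : 0 < h ->
  \sum_(i < n) (avg mu (a 0) (kern K h) (x - Y i.+1 w) - h * \int[leb]_v (K v * f (x - h * v))) =
  h * \int[leb]_v (K v * block_sum eps a fe f 0 n (x - h * v) w).
Proof.
move=> h0.
have mS n' : measurable_fun setT (fun v => block_sum eps a fe f 0 n' (x - h * v) w).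
  exact: (@measurable_comp_affine _ (fun y => block_sum eps a fe f 0 n' y w) x h (measurable_block_path n' w)).
have iS n' : leb.-integrable setT (EFin \o (fun v => K v * block_sum eps a fe f 0 n' (x - h * v) w)).
  exact: (integrable_bounded_mul iK (mS n') (fun v => block_path_bound n' w _)).
elim: n => [|n IH].
  rewrite big_ord0 (_ : \int[leb]_v _ = 0) ?mulr0//.
  under eq_Rintegral do rewrite /block_sum big_ord0 mulr0.
  by rewrite /Rintegral integral0.
rewrite big_ord_recr/= IH (avg_kern a0 mfe fe0 mufe _ h0 mK KM) -mulrBr -mulrDr; congr (_ * _).
have ig : leb.-integrable setT (EFin \o (fun v => K v * g (x - Y n.+1 w - h * v))).
  apply: (integrable_bounded_mul iK) (fun v => gB _).
  exact: (measurable_comp_affine _ _ (measurable_scaled_density a mfe)).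
have if_ : leb.-integrable setT (EFin \o (fun v => K v * f (x - h * v))).
  apply: (integrable_bounded_mul iK) (fun v => fB _).
  exact: measurable_comp_affine.
rewrite -RintegralB// -RintegralD//; last exact: (integrableB measurableT ig if_).
apply: eq_Rintegral => v _; rewrite /block_sum big_ord_recr/= -mulrBr -mulrDr add0n.
by rewrite addrAC.
Qed.

Lemma kde_decomposition (h : nat -> R) n w x : 0 < h n -> (0 < n)%N ->
  (forall i, linear_process a (fun i => eps i) i w = a 0 * eps i%:Z w + Y i w) ->
  kde K h (linear_process a (fun i => eps i)) n w x =
  (n%:R * h n)^-1 * kmart eps mu (a 0) Y (kern K (h n)) n x w +
  n%:R^-1 * \int[leb]_v (K v * block_sum eps a fe f 0 n (x - h n * v) w) +
  \int[leb]_v (K v * f (x - h n * v)).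
Proof.
move=> h0 n0 split.
set I := \int[leb]_v (K v * f (x - h n * v)).
have S : \sum_(1 <= i < n.+1) K ((x - linear_process a (fun i => eps i) i w) / h n) =
  kmart eps mu (a 0) Y (kern K (h n)) n x w +
  h n * \int[leb]_v (K v * block_sum eps a fe f 0 n (x - h n * v) w) + n%:R * (h n * I).
  rewrite -smoothed_past// /kmart big_add1/= big_mkord -big_split/=.
  have -> : n%:R * (h n * I) = \sum_(i < n) (h n * I).
    by rewrite sumr_const card_ord mulr_natl.
  rewrite -big_split/=; apply: eq_bigr => i _.
  by rewrite split /kern opprD addrA [_ - a 0 * _ - _]addrAC -/I; ring.
have nh : n%:R != 0 :> R by rewrite pnatr_eq0 -lt0n.
have hn : h n != 0 by rewrite gt_eqF.
rewrite /kde S; clear S; move: (kmart _ _ _ _ _ _ _ _) (\int[leb]_v (K v * block_sum _ _ _ _ _ _ _ _)) I => z s i.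
by field; rewrite nh hn.
Qed.

End decomposition.

Section deviation.
Context (R : realType).
Local Notation leb := (@lebesgue_measure R).
Context (A : set R) (al : R).
Hypothesis mA : measurable A.
Hypothesis Aal : (leb A <= al%:E)%E.

(** Integrability of [u] on [A] is deduced from that of [v] and of the difference, which makes the
    subtraction of extended reals legitimate. *)
Lemma abs_integral_diff_le (u v : R -> R) (D : R) : measurable_fun setT u ->
  leb.-integrable A (EFin \o v) -> (\int[leb]_(x in A) `|u x - v x|%:E <= D%:E)%E ->
  (`|(- (\int[leb]_(x in A) (u x)%:E)) - (- \int[leb]_(x in A) (v x)%:E)| <= D%:E)%E.
Proof.
move=> mu_ iv uvD; have mA' : @measurable _ (measurableTypeR R) A := mA.
have mv := measurable_int _ iv.
have mu' : measurable_fun A u by exact: measurable_funTS.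
have mv' : measurable_fun A v by exact/measurable_EFinP.
have iuv : leb.-integrable A (EFin \o (fun x => u x - v x)).
  apply/integrableP; split; first by apply/measurable_EFinP; exact: measurable_funB.
  by apply: le_lt_trans (ltry D); exact: uvD.
have iu : leb.-integrable A (EFin \o u).
  have H := integrableD mA' iuv iv.
  apply: eq_integrable H => // x _ /=.
  by rewrite -EFinD subrK.
rewrite oppeK addeC -(integralB mA' iv iu); apply: le_trans (le_abse_integral _ _ _) _ => //.
  exact: measurable_int (integrableB mA' iv iu).
apply: le_trans uvD; apply: ge0_le_integral => //.
- exact: measurableT_comp (measurable_int _ (integrableB mA' iv iu)).
- by apply/measurable_EFinP; apply: measurableT_comp => //; exact: measurable_funB.
- by move=> x _; rewrite /= distrC.
Qed.

Context (K : R -> R) (k1 : R).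
Hypothesis iK : leb.-integrable setT (EFin \o K).
Hypothesis normK : (\int[leb]_u `|K u|%:E <= k1%:E)%E.
Hypothesis k10 : 0 <= k1.

(** Here [b] bounds the bias, [S] is the past sum, [z] the martingale, [N] the sample size and [al]
    a bound on the measure of [A]. The pointwise bound is integrated term by term, so the four
    summands correspond to bias, past, martingale and squared martingale. *)
Lemma integral_entropy_diff_le (F f S z : R -> R) (ga h N C Cs b s be lam L V M : R) :
  measurable_fun setT F -> measurable_fun setT f -> measurable_fun setT S -> measurable_fun setT z ->
  0 < ga <= 1 -> 0 < h -> 0 < N -> (forall x, A x -> ga <= F x) -> (forall x, 0 <= f x <= C) ->
  0 <= b <= C -> (forall x, `|S x| <= N * Cs) -> Cs * k1 <= C ->
  (forall x, `|F x - f x| <= b + N^-1 * `|\int[leb]_v (K v * S (x - h * v))| + (N * h)^-1 * `|z x|) ->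
  0 < s -> (\int[leb]_x (S x ^+ 2)%:E <= be%:E)%E ->
  0 < lam -> 0 <= L -> (\int[leb]_x (cosh2 (lam * z x))%:E <= V%:E)%E -> expR (- L) * V <= M ->
  (\int[leb]_(x in A) `|F x * ln (F x) - f x * ln (f x)|%:E <=
    ((2 + 5 * C) / ga * (b * al + N^-1 * (k1 * (s * al + be / s)) +
       (N * h)^-1 * (lam^-1 * ((L + 2) * al + M))) +
     (N * h)^-1 ^+ 2 * (lam ^- 2 * ((2 * L ^+ 2 + 16) * al + 8 * M)))%:E)%E.
Proof.
move=> mF mf mS mz /andP[ga0 ga1] h0 N0 AF fC /andP[b0 bC] SN CsC D s0 Sbe lam0 L0 zV VM.
have [Z1 Z2] := integral_norm_cosh2 mA Aal lam0 L0 mz zV VM.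
have I1 := integral_smoothing_abs mA Aal iK normK h mS s0 Sbe k10.
have C0 : 0 <= C by exact: le_trans bC.
set c := (2 + 5 * C) / ga.
have c0 : 0 <= c by rewrite /c divr_ge0 ?(ltW ga0)//; lra.
have Ni : 0 <= N^-1 by rewrite invr_ge0 ltW.
have Nhi : 0 <= (N * h)^-1 by rewrite invr_ge0; apply: mulr_ge0; exact: ltW.
pose I x := (\int[leb]_v (`|K v| * `|S (x - h * v)%R|)%:E)%E.
have I0 x : (0 <= I x)%E by apply: integral_ge0 => v _; rewrite lee_fin mulr_ge0.
have mI : measurable_fun A I by apply: measurable_funTS; exact: measurable_smoothing_abs.
have mz1 : measurable_fun A (fun x => `|z x|%:E).
  by apply/measurable_EFinP; apply: measurable_funTS; exact: measurableT_comp.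
have mz2 : measurable_fun A (fun x => (z x ^+ 2)%:E).
  by apply/measurable_EFinP; apply: measurable_funTS; exact: measurable_funX.
pose G x := ((c * b)%:E + (c * N^-1)%:E * I x + (c * (N * h)^-1)%:E * `|z x|%:E +
  ((N * h)^-1 ^+ 2)%:E * (z x ^+ 2)%:E)%E.
have c1 : 0 <= c * N^-1 by rewrite mulr_ge0.
have c2 : 0 <= c * (N * h)^-1 by rewrite mulr_ge0.
have c3 : 0 <= (N * h)^-1 ^+ 2 by rewrite sqr_ge0.
have c4 : 0 <= c * b by rewrite mulr_ge0.
have mg (u : R -> \bar R) (r : R) : measurable_fun A u -> measurable_fun A (fun x => r%:E * u x)%E.
  by move=> mu_; exact: emeasurable_funM.
have ge0 (u : R -> \bar R) (r : R) x : 0 <= r -> (0 <= u x)%E -> (0 <= r%:E * u x)%E.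
  by move=> r0 u0; rewrite mule_ge0.
have z10 x : (0 <= `|z x|%:E)%E by rewrite lee_fin.
have z20 x : (0 <= (z x ^+ 2)%:E)%E by rewrite lee_fin sqr_ge0.
have mG2 : measurable_fun A (fun x => (c * b)%:E + (c * N^-1)%:E * I x)%E.
  by apply: emeasurable_funD => //; exact: mg.
have mG3 : measurable_fun A (fun x => (c * b)%:E + (c * N^-1)%:E * I x + (c * (N * h)^-1)%:E * `|z x|%:E)%E.
  by apply: emeasurable_funD => //; exact: mg.
have mlnG (u : R -> R) : measurable_fun setT u -> measurable_fun setT (fun x => u x * ln (u x)).
  by move=> mu_; apply: measurable_funM => //; exact: (measurableT_comp (@measurable_ln R)).
apply: (@le_trans _ _ (\int[leb]_(x in A) G x)%E).
  apply: ge0_le_integral => //.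
  - apply/measurable_EFinP; apply: measurable_funTS; apply: measurableT_comp => //.
    by apply: measurable_funB; exact: mlnG.
  - by apply: emeasurable_funD => //; exact: mg.
  move=> x Ax.
  set nu := N^-1 * `|\int[leb]_v (K v * S (x - h * v))|.
  have nu0 : 0 <= nu by rewrite mulr_ge0.
  have nuC : nu <= C.
    rewrite /nu ler_pdivrMl//; apply: le_trans (smoothing_sup iK normK _ _ mS SN) _.
    by rewrite -mulrA ler_wpM2l// ltW.
  have nuI : (nu%:E <= N^-1%:E * I x)%E.
    by rewrite /nu EFinM lee_wpmul2l ?lee_fin//; exact: (smoothing_abs iK h x mS SN).
  have ze0 : 0 <= (N * h)^-1 * `|z x| by rewrite mulr_ge0.
  have b0C : 0 <= b <= C by rewrite b0.
  have nu0C : 0 <= nu <= C by rewrite nu0.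
  have := entropy_integrand_le ga0 ga1 (AF x Ax) (fC x) b0C nu0C ze0 (D x).
  rewrite -lee_fin => /le_trans; apply.
  rewrite -/c !mulrDr !EFinD exprMn real_normK ?num_real//; apply: leeD; last by rewrite -EFinM.
  apply: leeD; last by rewrite -EFinM mulrA.
  apply: leeD => //.
  by rewrite [leLHS]EFinM [(c * N^-1)%:E]EFinM -muleA lee_wpmul2l// lee_fin.
have t1 x : (0 <= (c * N^-1)%:E * I x)%E by exact: ge0.
have t2 x : (0 <= (c * (N * h)^-1)%:E * `|z x|%:E)%E by exact: ge0.
have t3 x : (0 <= ((N * h)^-1 ^+ 2)%:E * (z x ^+ 2)%:E)%E by exact: ge0.
have t0 : (0 <= (c * b)%:E)%E by rewrite lee_fin.
rewrite /G (ge0_integralD leb mA (fun x _ => adde_ge0 (adde_ge0 t0 (t1 x)) (t2 x)) mG3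
  (fun x _ => t3 x) (mg _ _ mz2)).
rewrite (ge0_integralD leb mA (fun x _ => adde_ge0 t0 (t1 x)) mG2 (fun x _ => t2 x) (mg _ _ mz1)).
rewrite (ge0_integralD leb mA (fun x _ => t0) (measurable_cst _) (fun x _ => t1 x) (mg _ _ mI)).
rewrite !ge0_integralZl_EFin//.
rewrite EFinD; apply: leeD.
  rewrite [c * (_ + _)]mulrDr [c * (b * al + _)]mulrDr EFinD EFinD.
  apply: leeD; last by rewrite [c * (_ * _)]mulrA [leRHS]EFinM lee_wpmul2l// lee_fin.
  apply: leeD; last by rewrite [c * (_ * _)]mulrA [leRHS]EFinM lee_wpmul2l// lee_fin.
  by rewrite [c * (_ * _)]mulrA; exact: integral_cst_le.
by rewrite [leRHS]EFinM lee_wpmul2l// lee_fin.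
Qed.

End deviation.

Section rate.
Context (R : realType).

Lemma deviation_rate (h ga N l c1 k1 C Mb Mv D M : R) : 0 < h <= 1 -> 0 < ga <= 1 -> 0 < N ->
  1 <= l -> 0 < c1 -> c1 * l <= N * h ^+ 5 ->
  0 <= k1 -> 0 <= C -> 0 <= Mb -> 0 <= Mv -> 0 <= D -> 0 <= M ->
  (2 + 5 * C) / ga * (Mb * h ^+ 2 * (k1 / ga) +
      N^-1 * (k1 * (N * h ^+ 2 * (k1 / ga) + Mv * (N ^+ 2 * h ^+ 4) / (N * h ^+ 2))) +
      (N * h)^-1 * ((h ^+ 2)^-1 * ((D * l + 2) * (k1 / ga) + M))) +
    (N * h)^-1 ^+ 2 * ((h ^+ 2) ^- 2 * ((2 * (D * l) ^+ 2 + 16) * (k1 / ga) + 8 * M)) <=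
  ((2 + 5 * C) * (Mb * k1 + k1 * (k1 + Mv) + ((D + 2) * k1 + M) / c1) +
    ((2 * D ^+ 2 + 16) * k1 + 8 * M) / c1 ^+ 2) * (h ^+ 2 / ga ^+ 2).
Proof.
move=> /andP[h0 h1] /andP[g0 g1] N0 l1 c10 cl k10 C0 Mb0 Mv0 D0 M0.
(* The scale [m = 1 / (N h^3)] is that of the normalized martingale; [m * l <= h^2 / c1] absorbs its
   logarithms. Since [G >= 1], lower powers of [G] may be raised to [G^2]. *)
pose G := ga^-1; pose m := (N * h ^+ 3)^-1; pose c := 2 + 5 * C; pose e := c1^-1.
have G1 : 1 <= G by rewrite invf_ge1.
have c0 : 0 <= c by rewrite /c; lra.
have m0 : 0 < m by rewrite invr_gt0 mulr_gt0// exprn_gt0.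
have e0 : 0 < e by rewrite invr_gt0.
have ml : m * l <= e * h ^+ 2.
  rewrite /m /e ler_pdivrMl ?mulr_gt0 ?exprn_gt0// mulrCA ler_pdivlMl//.
  by apply: le_trans cl _; rewrite le_eqVlt; apply/orP; left; apply/eqP; ring.
have ml0 : 0 <= m * l by rewrite mulr_ge0; lra.
have hh : h ^+ 2 <= 1 by rewrite exprn_ile1// ltW.
have h20 : 0 <= h ^+ 2 by exact: sqr_ge0.
rewrite [leLHS](_ : _ = c * G * (Mb * h ^+ 2 * (k1 * G) + k1 * (h ^+ 2 * k1 * G + Mv * h ^+ 2) +
   m * ((D * l + 2) * k1 * G + M)) + m ^+ 2 * ((2 * D ^+ 2 * l ^+ 2 + 16) * k1 * G + 8 * M)); last first.
  by rewrite /c /G /m; field; rewrite !gt_eqF.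
rewrite [leRHS](_ : _ = (c * (Mb * k1 + k1 * (k1 + Mv) + ((D + 2) * k1 + M) * e) +
    ((2 * D ^+ 2 + 16) * k1 + 8 * M) * e ^+ 2) * (h ^+ 2 * G ^+ 2)); last first.
  by rewrite /c /G /e; field; rewrite !gt_eqF.
move: (h ^+ 2) hh h20 ml => H H1 H0 ml.
have G0 : 0 <= G by exact: le_trans G1.
have GG : G <= G ^+ 2 by rewrite expr2 ler_peMr.
have mD : m * ((D * l + 2) * k1 * G + M) <= ((D + 2) * k1 + M) * e * H * G.
  apply: (@le_trans _ _ (m * l * (((D + 2) * k1 + M) * G))).
    rewrite -!mulrA ler_wpM2l ?(ltW m0)//.
    have : 2 * (k1 * G) <= l * (2 * (k1 * G)) by rewrite ler_peMl// mulr_ge0// mulr_ge0.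
    have : M <= l * (M * G).
      by rewrite mulrA -[leLHS]mulr1 ler_pM// ler_peMl.
    nra.
  rewrite -[X in _ <= X]mulrA -[X in _ <= X]mulrA mulrC -mulrA.
  have W0 : 0 <= (D + 2) * k1 + M by rewrite addr_ge0// mulr_ge0//; lra.
  rewrite ler_wpM2l// mulrC [e * _]mulrA ler_wpM2r//.
have mS : m ^+ 2 * ((2 * D ^+ 2 * l ^+ 2 + 16) * k1 * G + 8 * M) <=
    ((2 * D ^+ 2 + 16) * k1 + 8 * M) * e ^+ 2 * (H * G ^+ 2).
  apply: (@le_trans _ _ ((m * l) ^+ 2 * (((2 * D ^+ 2 + 16) * k1 + 8 * M) * G))).
    rewrite [(m * l) ^+ 2]exprMn -[leRHS]mulrA ler_wpM2l ?sqr_ge0//.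
    have l2 : 1 <= l ^+ 2 by rewrite exprn_ege1.
    have : 16 * (k1 * G) <= l ^+ 2 * (16 * (k1 * G)) by rewrite ler_peMl// mulr_ge0// mulr_ge0.
    have : 8 * M <= l ^+ 2 * (8 * M * G).
      by rewrite mulrA -[leLHS]mulr1 ler_pM// ?mulr_ge0// ler_peMl// mulr_ge0.
    nra.
  have W0 : 0 <= (2 * D ^+ 2 + 16) * k1 + 8 * M.
    by rewrite addr_ge0// mulr_ge0//; have := sqr_ge0 D; lra.
  rewrite mulrCA -[leRHS]mulrA ler_wpM2l// mulrA.
  apply: ler_pM => //; first by rewrite sqr_ge0.
  apply: (@le_trans _ _ ((e * H) ^+ 2)); first by rewrite lerXn2r// nnegrE// mulr_ge0// ltW.
  by rewrite exprMn ler_wpM2l ?sqr_ge0// expr2 ler_piMl.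
have T1 : c * G * (Mb * H * (k1 * G)) = c * (Mb * k1) * (H * G ^+ 2) by ring.
have T2 : c * G * (k1 * (H * k1 * G + Mv * H)) <= c * (k1 * (k1 + Mv)) * (H * G ^+ 2).
  rewrite (_ : c * G * _ = c * k1 * H * (k1 * G ^+ 2 + Mv * G)); last by ring.
  rewrite [leRHS](_ : _ = c * k1 * H * (k1 * G ^+ 2 + Mv * G ^+ 2)); last by ring.
  by rewrite ler_wpM2l ?mulr_ge0// lerD2l ler_wpM2l.
have T3 : c * G * (m * ((D * l + 2) * k1 * G + M)) <= c * (((D + 2) * k1 + M) * e) * (H * G ^+ 2).
  apply: le_trans (ler_wpM2l (mulr_ge0 c0 G0) mD) _.
  by rewrite le_eqVlt; apply/orP; left; apply/eqP; ring.
rewrite [leRHS]mulrDl; apply: lerD => //.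
rewrite [leLHS]mulrDr [c * G * (_ + _)]mulrDr T1.
have -> (p q r : R) : c * (p + q + r) * (H * G ^+ 2) =
  c * p * (H * G ^+ 2) + c * q * (H * G ^+ 2) + c * r * (H * G ^+ 2) by ring.
by apply: lerD => //; apply: lerD.
Qed.

(** In fifth powers, [(N^2 h^4)^5 = N^6 (N h^5)^4], and [N h^5 >= c]. The factor [1 + c^-1] covers
    small [c], through [(1 + c^-1) (1 + c) >= 2]. *)
Lemma fifth_root_bound (v c N h l : R) : 0 < c -> 0 < h -> 1 <= N -> 1 <= l ->
  c * l <= N * h ^+ 5 -> v ^+ 5 <= (2 * N) ^+ 6 -> 0 <= v ->
  v <= 2 * (1 + c^-1) * (N ^+ 2 * h ^+ 4).
Proof.
move=> c0 h0 N1 l1 cl v5 v0.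
have N0 : 0 < N by lra.
have cN : c <= N * h ^+ 5 by apply: le_trans cl; rewrite ler_peMr// ltW.
have c1 : 1 <= 1 + c^-1 by rewrite lerDl invr_ge0 ltW.
rewrite -(@ler_pXn2r _ 5)// ?nnegrE//; last first.
  by rewrite !mulr_ge0 ?exprn_ge0 ?ltW//; lra.
apply: le_trans v5 _.
have E : (2 * (1 + c^-1) * (N ^+ 2 * h ^+ 4)) ^+ 5 = 32 * N ^+ 6 * ((1 + c^-1) * ((1 + c^-1) * (N * h ^+ 5)) ^+ 4).
  by ring.
have F : 2 <= (1 + c^-1) * ((1 + c^-1) * (N * h ^+ 5)) ^+ 4.
  set X := (1 + c^-1) * (N * h ^+ 5).
  have X1 : 1 + c <= X.
    apply: (@le_trans _ _ ((1 + c^-1) * c)); first by rewrite mulrDl mulVf ?gt_eqF// mul1r addrC.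
    by rewrite /X ler_wpM2l//; lra.
  have X4 : X <= X ^+ 4 by rewrite ler_eXnr//; lra.
  have : (1 + c^-1) * (1 + c) <= (1 + c^-1) * X ^+ 4.
    by apply: ler_wpM2l; [lra|exact: le_trans X1 X4].
  apply: le_trans; rewrite mulrDl mul1r mulrDr mulr1 mulVf ?gt_eqF//.
  have ci : 0 < c^-1 by rewrite invr_gt0.
  lra.
rewrite E.
have : 32 * N ^+ 6 * 2 <= 32 * N ^+ 6 * ((1 + c^-1) * ((1 + c^-1) * (N * h ^+ 5)) ^+ 4).
  by rewrite ler_wpM2l// mulr_ge0// exprn_ge0// ltW.
apply: le_trans; rewrite exprMn; lra.
Qed.

End rate.

Section estimator.
Context (T : Type) (R : realType).
Local Notation leb := (@lebesgue_measure R).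
Context (K : R -> R) (k1 : R) (h gamma : nat -> R) (X : nat -> T -> R) (n : nat) (w : T).
Hypothesis mK : measurable_fun setT K.
Hypothesis normK : (\int[leb]_u `|K u|%:E <= k1%:E)%E.
Hypothesis h0 : 0 < h n.
Hypothesis g0 : 0 < gamma n.
Hypothesis n0 : (0 < n)%N.

Let mKX i : measurable_fun setT (fun x : R => K ((x - X i w) / h n)).
Proof.
by apply: (measurableT_comp mK); apply: measurable_funM => //; exact: measurable_funB.
Qed.

Lemma measurable_kde : measurable_fun setT (kde K h X n w).
Proof. by apply: measurable_funM => //; apply: measurable_sum. Qed.

Lemma measurable_An : measurable (An K h gamma X n w).
Proof.
rewrite (_ : An _ _ _ _ _ _ = kde K h X n w @^-1` `[gamma n, +oo[%classic).
  by rewrite -[X in measurable X]setTI; apply: measurable_kde.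
by apply/seteqP; split => x; rewrite /An /= in_itv /= andbT g0.
Qed.

Lemma integral_abs_kde : (\int[leb]_x `|kde K h X n w x|%:E <= k1%:E)%E.
Proof.
have nh0 : 0 < n%:R * h n by rewrite mulr_gt0// ltr0n.
have nhi : 0 <= (n%:R * h n)^-1 by rewrite invr_ge0 ltW.
have mKn i : measurable_fun setT (fun x : R => `|K ((x - X i w) / h n)|%:E).
  by apply/measurable_EFinP; exact: measurableT_comp.
have mnK : measurable_fun setT (fun x : R => `|K x|%:E).
  by apply/measurable_EFinP; exact: measurableT_comp.
have KX i : (\int[leb]_x `|K ((x - X i w) / h n)%R|%:E <= (h n * k1)%:E)%E.
  have hi : (h n)^-1 != 0 by rewrite invr_eq0 gt_eqF.
  have := ge0_integral_affine (- X i w / h n) hi mnK (fun x => _ : (0 <= `|K x|%:E)%E).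
  rewrite gtr0_norm ?invr_gt0// => H; move: normK; rewrite H; last by move=> x; rewrite lee_fin.
  rewrite (_ : (\int[leb]_x `|K ((h n)^-1 * x + - X i w / h n)%R|%:E)%E =
     (\int[leb]_x `|K ((x - X i w) / h n)%R|%:E)%E); last first.
    by apply: eq_integral => x _; rewrite mulrDl [_ * x]mulrC.
  move=> /(@lee_wpmul2l _ (h n)%:E); rewrite lee_fin (ltW h0) => /(_ isT).
  by rewrite muleA -EFinM divff ?gt_eqF// mul1e.
apply: (@le_trans _ _ (\int[leb]_x ((n%:R * h n)^-1%:E * \sum_(1 <= i < n.+1) `|K ((x - X i w) / h n)%R|%:E))%E).
  apply: ge0_le_integral => //.
  - by apply/measurable_EFinP; apply: measurableT_comp => //; exact: measurable_kde.
  - by apply: emeasurable_funM => //; exact: emeasurable_sum.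
  move=> x _; rewrite /kde normrM (ger0_norm nhi) EFinM lee_wpmul2l ?lee_fin//.
  by rewrite sumEFin lee_fin; exact: ler_norm_sum.
rewrite ge0_integralZl_EFin//; last 2 first.
- by move=> x _; apply: sume_ge0 => i _; rewrite lee_fin.
- exact: emeasurable_sum.
rewrite ge0_integral_sum//.
apply: (@le_trans _ _ ((n%:R * h n)^-1%:E * \sum_(1 <= i < n.+1) (h n * k1)%:E)%E).
  by rewrite lee_wpmul2l ?lee_fin//; apply: lee_sum => i _; exact: KX.
rewrite sumEFin -EFinM lee_fin sumr_const_nat subn1/= -[X in _ * X]mulr_natl [n%:R * (_ * _)]mulrA.
by rewrite mulKf// gt_eqF.
Qed.

(** Markov's inequality. The kernel may take negative values, so the [L^1] norm of the estimator is
    bounded by [k1], not by 1. *)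
Lemma measure_An : (leb (An K h gamma X n w) <= (k1 / gamma n)%:E)%E.
Proof.
have mk : measurable_fun setT (EFin \o kde K h X n w) by apply/measurable_EFinP; exact: measurable_kde.
have := @le_integral_abse _ _ _ leb setT measurableT _ (gamma n) mk g0.
move=> /le_trans /(_ integral_abs_kde) H.
rewrite mulrC EFinM lee_pdivlMl//.
apply: le_trans H; rewrite lee_wpmul2l// ?lee_fin ?(ltW g0)//.
apply: le_measure; rewrite ?inE.
- exact: measurable_An.
- by apply: emeasurable_fun_c_infty => //; exact: measurableT_comp.
- by move=> x /andP[_ gx]; split => //=; rewrite lee_fin (le_trans gx)// ler_norm.
Qed.

End estimator.

(** The predicate [has_density] does not include nonnegativity. A negative value would persist on a
    ball by continuity and give it a negative integral. *)
Lemma continuous_density_ge0 (R : realType) (fe : R -> R) : continuous fe ->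
  (forall A : set R, measurable A -> (0 <= \int[@lebesgue_measure R]_(x in A) (fe x)%:E)%E) ->
  forall x, 0 <= fe x.
Proof.
move=> cf H x; rewrite leNgt; apply/negP => fx.
have : \forall y \near x, fe y < fe x / 2.
  by apply: (cvgr_lt _ (cf x)); lra.
move=> /nbhs_ballP[e /= e0 He].
have mB : measurable (ball x e) by exact: measurable_ball.
have mfe : measurable_fun (ball x e) (fun y => (- fe y)%:E).
  apply/measurable_EFinP; apply: measurable_funTS; apply: measurableT_comp => //.
  exact: continuous_measurable_fun.
have := H _ mB; apply/negP; rewrite -ltNge.
have neg y : ball x e y -> (0 <= (- fe y)%:E)%E.
  by move=> /He; rewrite lee_fin /=; lra.
rewrite (_ : (\int[_]_(y in _) _)%E = (- \int[@lebesgue_measure R]_(y in ball x e) (- fe y)%:E)%E); last first.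
  by rewrite -integral_ge0N//; apply: eq_integral => y _; rewrite -EFinN opprK.
rewrite oppe_lt0; apply: (@lt_le_trans _ _ (\int[@lebesgue_measure R]_(y in ball x e) (- (fe x / 2))%:E)%E).
  rewrite integral_cst// [X in (_ * X)%E](_ : _ = (e *+ 2)%:E); last exact: (lebesgue_measure_ball x (ltW e0)).
  by rewrite -EFinM lte_fin mulr_gt0 ?mulrn_wgt0//; lra.
apply: ge0_le_integral => //.
- by move=> y _; rewrite lee_fin; lra.
- by move=> y /He /=; rewrite lee_fin; lra.
Qed.

(** * Rate of the entropy estimator *)

Section main.
Context d (T : measurableType d) (R : realType) (P : probability T R).
Context (eps : int -> {RV P >-> R}) (mu : probability R R).
Hypothesis indep : mutually_independent P (fun i => (eps i : T -> R)).
Hypothesis law : forall j A, measurable A -> P (eps j @^-1` A) = mu A.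
Local Notation leb := (@lebesgue_measure R).
Context (s2 : R).
Hypothesis mus2 : (\int[mu]_u (u ^+ 2)%:E <= s2%:E)%E.
Context (a : nat -> R).
Hypothesis cva : cvgn (series (fun i => `|a i|)).
Hypothesis a0 : a 0 != 0.
Context (fe : R -> R).
Hypothesis mfe : measurable_fun setT fe.
Hypothesis fe0 : forall x, 0 <= fe x.
Hypothesis mufe : forall A, measurable A -> mu A = (\int[leb]_(x in A) (fe x)%:E)%E.
Local Notation g := (scaled_density a fe).
Local Notation Y := (tail_process eps a).
Local Notation X := (linear_process a (fun i => eps i)).
Context (B L1 L2 : R).
Hypothesis ng : nice B L1 L2 g.
Hypothesis L20 : 0 <= L2.
Context (f : R -> R) (M2 : R).
Hypothesis fE : forall n x, f x = marginal eps a fe n x.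
Hypothesis df : forall x, derivable f x 1.
Hypothesis ddf : forall x, derivable (derive1 f) x 1.
Hypothesis fM : forall x, `|derive1 (derive1 f) x| <= M2.
Hypothesis fent : leb.-integrable setT (EFin \o (fun x => f x * ln (f x))).
Context (K : R -> R) (k1 MK MS : R).
Hypothesis iK : leb.-integrable setT (EFin \o K).
Hypothesis K1 : \int[leb]_u K u = 1.
Hypothesis normK : (\int[leb]_u `|K u|%:E <= k1%:E)%E.
Hypothesis KM : forall x, `|K x| <= MK.
Hypothesis suppK : forall u, MS < `|u| -> K u = 0.
Hypothesis Kodd : \int[leb]_u (u * K u) = 0.
Context (h gamma : nat -> R).
Hypothesis h0 : forall n, 0 < h n.
Hypothesis ga0 : forall n, 0 < gamma n.

Let mK : measurable_fun setT K.
Proof. by apply/measurable_EFinP; exact: measurable_int iK. Qed.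

Let mf : measurable_fun setT f.
Proof. by apply: continuous_measurable_fun; exact: derivable_continuous. Qed.

Let fB x : `|f x| <= B.
Proof. by rewrite (fE 0 x); exact: (marginal_bound _ mfe ng). Qed.

Let f_ge0 x : 0 <= f x.
Proof. by rewrite (fE 0 x); exact: marginal_ge0. Qed.

Let k10 : 0 <= k1.
Proof. by rewrite -lee_fin; apply: le_trans normK; apply: integral_ge0 => x _; rewrite lee_fin. Qed.

Let M20 : 0 <= M2. Proof. exact: le_trans (fM 0). Qed.

Let B0 : 0 <= B. Proof. exact: le_trans (fB 0). Qed.

Let Mb := M2 * MS ^+ 2 * k1.

(** A common bound for the density ([B]), the bias ([Mb], when [h <= 1]) and the normalized smoothed
    past part ([2 * B * k1]). *)
Let C := B + Mb + 2 * B * k1.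

Let A := An K h gamma X.

Let F := kde K h X.

Lemma integral_deviation_le (n D : nat) (w : T) (v Mv M c1 : R) : (0 < n)%N -> h n <= 1 -> gamma n <= 1 ->
  1 <= ln n%:R :> R -> 0 < c1 -> c1 * ln n%:R <= n%:R * h n ^+ 5 ->
  (forall i, X i w = a 0 * eps i%:Z w + Y i w) ->
  0 <= v -> v ^+ 5 <= (2 * n%:R) ^+ 6 -> 0 <= Mv ->
  (\int[leb]_x (block_sum eps a fe f 0 n x w ^+ 2)%:E <= (Mv * v)%:E)%E -> 0 <= M ->
  (\int[leb]_x (cosh2 (h n ^+ 2 * kmart eps mu (a 0) Y (kern K (h n)) n x w))%:E <= (M * n%:R ^+ D)%:E)%E ->
  (\int[leb]_(x in A n w) `|F n w x * ln (F n w x) - f x * ln (f x)|%:E <=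
    (((2 + 5 * C) * (Mb * k1 + k1 * (k1 + Mv * (2 * (1 + c1^-1))) + ((D%:R + 2) * k1 + M) / c1) +
    ((2 * D%:R ^+ 2 + 16) * k1 + 8 * M) / c1 ^+ 2) * (h n ^+ 2 / gamma n ^+ 2))%:E)%E.
Proof.
move=> n0 h1 g1 l1 c10 cl split v0 v5 Mv0 SM M0 ZM.
have N0 : 0 < n%:R :> R by rewrite ltr0n.
have N1 : 1 <= n%:R :> R by rewrite ler1n.
have Mb0 : 0 <= Mb by apply: mulr_ge0 => //; apply: mulr_ge0 => //; exact: sqr_ge0.
have Bk0 : 0 <= 2 * B * k1 by apply: mulr_ge0 => //; exact: mulr_ge0.
have C0 : 0 <= C by rewrite /C; move: Mb Mb0 B0 Bk0 => y; lra.
have h2 : h n ^+ 2 <= 1 by rewrite exprn_ile1// ltW.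
have mA : measurable (A n w) by exact: measurable_An.
have Aal : (leb (A n w) <= (k1 / gamma n)%:E)%E by exact: measure_An.
have mS := measurable_block_path eps a mfe mf n w.
have [gB _ _] := ng.
have SB x : `|block_sum eps a fe f 0 n x w| <= n%:R * (2 * B) by exact: block_path_bound.
have mz : measurable_fun setT (fun x => kmart eps mu (a 0) Y (kern K (h n)) n x w).
  have mY i : measurable_fun [set: sigma_of eps (past i%:Z)] (Y i) by exact: measurable_tail_process.
  have mkz := @measurable_kmartT _ _ _ _ eps mu (a 0) Y mY (kern K (h n)) MK n
    (measurable_kern mK (h n)) (fun x => KM _).
  exact: (measurable_fun_pair1 w mkz).
have D_ x : `|F n w x - f x| <= Mb * h n ^+ 2 +
    n%:R^-1 * `|\int[leb]_v (K v * block_sum eps a fe f 0 n (x - h n * v) w)| +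
    (n%:R * h n)^-1 * `|kmart eps mu (a 0) Y (kern K (h n)) n x w|.
  rewrite /F (kde_decomposition a0 mfe fe0 mufe gB mf fB iK KM x (h0 n) n0 split).
  have := smoothing_bias iK K1 normK suppK Kodd (h n) x df ddf fM fB.
  set I := \int[leb]_v (K v * f _); set S := \int[leb]_v _; set z := kmart _ _ _ _ _ _ _ _.
  move=> bias; rewrite (_ : _ - f x = I - f x + n%:R^-1 * S + (n%:R * h n)^-1 * z); last by ring.
  rewrite (le_trans (ler_normD _ _))// normrM gtr0_norm ?invr_gt0 ?mulr_gt0// lerD2r.
  by rewrite (le_trans (ler_normD _ _))// normrM [`|n%:R^-1|]gtr0_norm ?invr_gt0// lerD2r.
have vle := fifth_root_bound c10 (h0 n) N1 l1 cl v5 v0.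
have SM' : (\int[leb]_x (block_sum eps a fe f 0 n x w ^+ 2)%:E <=
    (Mv * (2 * (1 + c1^-1)) * (n%:R ^+ 2 * h n ^+ 4))%:E)%E.
  by apply: le_trans SM _; rewrite lee_fin -mulrA ler_wpM2l.
have eL : expR (- (D%:R * ln n%:R)) * (M * n%:R ^+ D) <= M.
  by rewrite expRN expRM_natl lnK ?posrE// mulrCA mulVf ?mulr1// expf_neq0// gt_eqF.
(* The parameters: [s = n h^2] balances the two terms of the past part, whose square integral is
   [O(n^2 h^4)]; [lam = h^2]; and [L = D log n] cancels the factor [n^D]. *)
have := @integral_entropy_diff_le _ _ _ mA Aal K k1 iK normK k10 (F n w) f
  (fun x => block_sum eps a fe f 0 n x w) (fun x => kmart eps mu (a 0) Y (kern K (h n)) n x w)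
  (gamma n) (h n) n%:R C (2 * B) (Mb * h n ^+ 2) (n%:R * h n ^+ 2) _ (h n ^+ 2) (D%:R * ln n%:R) _ M
  (measurable_kde h X n w mK) mf mS mz _ (h0 n) N0 _ _ _ SB _ D_ _ SM' _ _ ZM eL.
move=> /(_ _ _ _ _ _ _ _ _)/le_trans; apply.
- by rewrite ga0.
- by move=> x /andP[].
- by move=> x; rewrite f_ge0/= (le_trans (ler_norm _))// (le_trans (fB x))// /C -addrA lerDl addr_ge0.
- rewrite mulr_ge0 ?sqr_ge0//= (@le_trans _ _ Mb)//; first by rewrite ler_piMr.
  by rewrite /C addrAC lerDr addr_ge0.
- by rewrite /C lerDr addr_ge0.
- by rewrite mulr_gt0// exprn_gt0.
- by rewrite exprn_gt0.
- by rewrite mulr_ge0//; lra.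
rewrite lee_fin; apply: deviation_rate => //.
- by rewrite h0.
- by rewrite ga0.
- by rewrite mulr_ge0// mulr_ge0// addr_ge0// invr_ge0 ltW.
Qed.

Lemma ae_entropy_rate : asymp h (fun n => (n%:R^-1 * ln n%:R) `^ (5^-1)) ->
  gamma @ \oo --> 0 -> (fun n => h n / gamma n) @ \oo --> 0 ->
  {ae P, forall w, (limn_esup (fun n : nat =>
    ((n%:R * gamma n ^+ 5 / ln n%:R) `^ (2 / 5))%:E *
    `| entropy_est K h gamma X n w - \int[leb]_(x in An K h gamma X n w) (- ln (f x) * f x)%:E |)
    < +oo)%E}.
Proof.
move=> /(asymp_bounds h0)[c1 [c2 [c10 c20 hb]]] cg chg.
have [gB _ _] := ng.
have MK0 : 0 <= MK by exact: le_trans (KM 0).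
have ch : h @ \oo --> 0.
  have : (fun n => h n / gamma n * gamma n) @ \oo --> (0 * 0 : R) by exact: cvgM.
  rewrite mul0r; apply: cvg_trans; apply: near_eq_cvg; near=> n.
  by rewrite divfK// gt_eqF.
have [N _ HN] : \forall n \near \oo, [/\ h n <= 1, gamma n <= 1, 1 <= ln n%:R :> R,
    h n ^+ 2 * (2 * MK) <= 3^-1 & c1 * ln n%:R <= n%:R * h n ^+ 5 <= c2 * ln n%:R].
  near=> n.
  have h1 : h n <= 1 by near: n; exact: (cvgr_le _ ch).
  split => //.
  - by near: n; exact: (cvgr_le _ cg).
  - rewrite -ler_expR lnK; last by rewrite posrE ltr0n; near: n; exists 1%N.
    by near: n; exact: nbhs_infty_ger.
  (* This makes the scaled increments at most 1/3, as the quadratic bound on the exponential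
     requires. *)
  - have h2 : h n <= (6 * (MK + 1))^-1.
      by near: n; apply: (cvgr_le _ ch); rewrite invr_gt0 mulr_gt0//; lra.
    apply: (@le_trans _ _ ((6 * (MK + 1))^-1 * (2 * (MK + 1)))).
      apply: ler_pM; rewrite ?sqr_ge0 ?mulr_ge0//.
        by apply: le_trans h2; rewrite expr2 ler_piMr// ltW.
      by rewrite ler_wpM2l// lerDl.
    rewrite ler_pdivrMl; first by lra.
    by rewrite mulr_gt0//; lra.
  - by near: n; exact: hb.
have mnK : measurable_fun [set: R] (fun v => `|K v|%:E).
  by apply/measurable_EFinP; exact: measurableT_comp.
have K2 : (\int[leb]_u (K u ^+ 2)%:E <= (MK * k1)%:E)%E.
  apply: (@le_trans _ _ (\int[leb]_u (MK%:E * `|K u|%:E))%E).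
    apply: ge0_le_integral => //.
    - by move=> u _; rewrite lee_fin sqr_ge0.
    - by apply/measurable_EFinP; exact: measurable_funX.
    - exact: emeasurable_funM.
    - by move=> u _; rewrite lee_fin -(real_normK (num_real (K u))) expr2 ler_wpM2r.
  by rewrite ge0_integralZl_EFin// EFinM lee_wpmul2l// lee_fin.
have [D aeZ] : exists D : nat, {ae P, forall w, exists2 M : R, 0 <= M & forall n, (N.+1 <= n)%N ->
    (\int[leb]_x (cosh2 (h n ^+ 2 * kmart eps mu (a 0) Y (kern K (h n)) n x w))%:E
      <= (M * n%:R ^+ D)%:E)%E}.
  apply: (@ae_cosh2 _ _ _ _ _ mu indep law a a0 fe mfe fe0 mufe B gB K MK (MK * k1) mK KM K2 h h0 c2) => //.
  - exact: mulr_ge0.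
  - exact: ltW.
  - by move=> n Nn; have [_ _ _ ? /andP[_ ?]] := HN n (ltnW Nn).
have s20 : 0 <= s2.
  by rewrite -lee_fin; apply: le_trans mus2; apply: integral_ge0 => u _; rewrite lee_fin sqr_ge0.
pose As := limn (series (fun i => `|a i|)).
have aeS : {ae P, forall w, exists2 M : R, 0 <= M & forall n : nat, (0 < n)%N ->
  exists v : R, [/\ 0 <= v, v ^+ 5 <= (2 * n%:R) ^+ 6 &
    (\int[leb]_x (block_sum eps a fe f 0 n x w ^+ 2)%:E <= (M * v)%:E)%E]}.
  apply: (@ae_maximal _ _ _ P (block_sum eps a fe f) (L2 * s2 * As ^+ 2)).
  - move=> m q; exact: (measurable_block_sum mfe ng fE).
  - move=> m q q' x w; rewrite /block_sum big_split_ord/=; congr (_ + _).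
    by apply: eq_bigr => i _; rewrite addnA.
  - by rewrite mulr_ge0 ?sqr_ge0// mulr_ge0.
  - move=> m q; exact: (expectation_block_norm indep law mus2 cva mfe fe0 ng L20 fE).
apply: filterS3 aeZ aeS (linear_process_split law mus2 cva) => w [M M0 HZ] [Mv Mv0 HS] HX.
pose Cst := (2 + 5 * C) * (Mb * k1 + k1 * (k1 + Mv * (2 * (1 + c1^-1))) + ((D%:R + 2) * k1 + M) / c1) +
    ((2 * D%:R ^+ 2 + 16) * k1 + 8 * M) / c1 ^+ 2.
apply: (@le_lt_trans _ _ ((1 + c2 ^+ 2) * Cst)%:E); last exact: ltry.
apply: limn_esup_le_near; exists N.+1 => // n /= Nn.
have n0 : (0 < n)%N by exact: leq_trans Nn.
have [h1 g1 l1 _ /andP[cl clu]] := HN n (ltnW Nn).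
have [v [v0 v5 Sv]] := HS n n0.
have dev := integral_deviation_le n0 h1 g1 l1 c10 cl (fun i => (HX i).2) v0 v5 Mv0 Sv M0 (HZ n Nn).
rewrite -/Cst in dev.
have mA : measurable (A n w) by exact: measurable_An.
have mA' : @measurable _ (measurableTypeR R) (A n w) := mA.
have iA : leb.-integrable (A n w) (EFin \o (fun x => f x * ln (f x))).
  by apply: integrableS fent.
have mF : measurable_fun setT (fun x => F n w x * ln (F n w x)).
  have mk := measurable_kde h X n w mK.
  by apply: measurable_funM => //; exact: (measurableT_comp (@measurable_ln R)).
have := abs_integral_diff_le mA mF iA dev.
have -> : (- (\int[leb]_(x in A n w) (f x * ln (f x))%:E))%E = (\int[leb]_(x in A n w) (- ln (f x) * f x)%:E)%E.
  rewrite -(integralN (integrable_add_def mA' iA)).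
  by apply: eq_integral => x _; rewrite -EFinN mulNr mulrC.
rewrite -/(entropy_est K h gamma X n w) => Hd.
(* The normalizing factor is at most a multiple of [gamma^2 / h^2], which cancels the
   [h^2 / gamma^2] of the deviation. *)
apply: (@le_trans _ _ (((1 + c2 ^+ 2) * (gamma n ^+ 2 / h n ^+ 2))%:E * (Cst * (h n ^+ 2 / gamma n ^+ 2))%:E)%E).
  apply: lee_pmul => //; first by rewrite lee_fin powR_ge0.
  rewrite lee_fin; apply: rate_le => //; [exact: ltW|lra].
rewrite -EFinM lee_fin le_eqVlt; apply/orP; left; apply/eqP.
by field; rewrite !gt_eqF.
Unshelve. all: by end_near. Qed.

End main.

(** * Reduction to a nonzero leading coefficient *)

Section shift.
Context (R : realType).

(** Valid for divergent sequences as well: both have the same set of limits, so [lim] selects the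
    same value. This lets the shifted process coincide with the original everywhere, not just almost
    surely. *)
Lemma limn_shift (u : nat -> R) k : limn (fun n => u (n + k)%N) = limn u.
Proof.
rewrite /lim /lim_in; congr get; apply/funext => l.
exact: (cvg_shiftn k u (nbhs l)).
Qed.

Lemma series_shift (u : nat -> R) k : (forall i, (i < k)%N -> u i = 0) ->
  series (fun i => u (i + k)%N) = (fun n => series u (n + k)%N).
Proof.
move=> u0; apply/funext => n; rewrite /series/= [RHS](@big_cat_nat _ _ _ k)//= ?leq_addl//.
have -> : \sum_(0 <= i < k) u i = 0.
  by rewrite big_nat_cond big1// => i /andP[/andP[_ ik] _]; exact: u0.
by have := @big_addn _ 0 +%R 0 (n + k) k xpredT u; rewrite add0n addnK add0r => ->.
Qed.

Lemma linear_process_shift (T : Type) (a : nat -> R) (eps : int -> T -> R) k :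
  (forall i, (i < k)%N -> a i = 0) ->
  linear_process a eps = linear_process (fun i => a (i + k)%N) (fun j => eps (j - k%:Z)).
Proof.
move=> ak; apply/funext => n; apply/funext => w; rewrite /linear_process.
rewrite -(limn_shift (series (fun i : nat => a i * eps (n%:Z - i%:Z) w)) k).
rewrite -(@series_shift (fun i : nat => a i * eps (n%:Z - i%:Z) w) k); last first.
  by move=> i ik; rewrite ak// mul0r.
congr (limn (series _)); apply/funext => i.
by rewrite PoszD opprD addrA.
Qed.

Lemma mutually_independent_inj d (T : measurableType d) (P : probability T R)
    (I J : eqType) (X : I -> T -> R) (s : J -> I) (s' : I -> J) : cancel s s' ->
  mutually_independent P X -> mutually_independent P (fun j => X (s j)).
Proof.
move=> sK indep r B ur mB.
have := indep (map s r) (fun i => B (s' i)) _ (fun i => mB _).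
rewrite map_inj_uniq//; last exact: can_inj sK.
move=> /(_ ur); rewrite big_map.
under eq_bigr do rewrite sK.
move=> <-; congr (P _); apply/seteqP; split => w H i /=.
  by move=> /mapP[j jr ->]; rewrite sK; exact: H.
by move=> ir; have := H (s i); rewrite sK; apply; exact: map_f.
Qed.

End shift.

Lemma fine_integral_le d (T : measurableType d) (R : realType) (mu : {measure set T -> \bar R})
    (u : T -> R) : mu.-integrable setT (EFin \o u) ->
  (\int[mu]_x (u x)%:E <= (fine (\int[mu]_x (u x)%:E))%:E)%E.
Proof. by move=> iu; rewrite fineK//; exact: integrable_fin_num. Qed.

Section reduction.
Context (R : realType) d (T : measurableType d) (P : probability T R).
Local Notation leb := (@lebesgue_measure R).

Lemma ae_entropy_rate_leading (eps : int -> {RV P >-> R}) (fe : R -> R)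
  (a : nat -> R) (f : R -> R) (K : R -> R) (h gamma : nat -> R) :
  mutually_independent P (fun i => (eps i : T -> R)) ->
  (forall i, has_density P (eps i) fe) ->
  P.-integrable setT (fun w => ((eps 0 w) ^+ 2)%:E) ->
  cvgn (series (fun i => `|a i|)) -> a 0 != 0 ->
  (forall n : nat, has_density P (linear_process a (fun i => eps i) n) f) ->
  leb.-integrable setT (fun x => (f x * ln (f x))%:E) ->
  leb.-integrable setT (fun u => (K u)%:E) ->
  (\int[leb]_u (K u)%:E = 1)%E ->
  (forall n, 0 < h n) ->
  asymp h (fun n => (n%:R^-1 * ln n%:R) `^ (5^-1)) ->
  bounded_real K ->
  (exists M : R, forall u, M < `|u| -> K u = 0) ->
  (\int[leb]_u (u * K u)%:E = 0)%E ->
  (forall x, derivable fe x 1 /\ derivable (derive1 fe) x 1) ->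
  bounded_real fe -> bounded_real (derive1 fe) ->
  leb.-integrable setT (fun x => ((derive1 fe) x ^+ 2)%:E) ->
  (forall x, derivable f x 1 /\ derivable (derive1 f) x 1) ->
  bounded_real (derive1n 2 f) ->
  (forall n, 0 < gamma n) -> gamma @ \oo --> 0 -> (fun n => h n / gamma n) @ \oo --> 0 ->
  {ae P, forall w, (limn_esup (fun n : nat =>
    ((n%:R * gamma n ^+ 5 / ln n%:R) `^ (2 / 5))%:E *
    `| entropy_est K h gamma (linear_process a (fun i => eps i)) n w -
       \int[leb]_(x in An K h gamma (linear_process a (fun i => eps i)) n w) (- ln (f x) * f x)%:E |)
    < +oo)%E}.
Proof.
move=> indep dens ieps2 cva a0 fdens fent iK K1 h0 has [MK KM] [MS suppK] Kodd dfe [B feB] [M feM] ife' df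
  [M2 fM] ga0 cga chga.
pose mu : probability R R := distribution P (eps 0).
have law j A : measurable A -> P (eps j @^-1` A) = mu A.
  by move=> mA; rewrite [RHS](dens 0 A mA); exact: dens.
have mufe A : measurable A -> mu A = (\int[leb]_(x in A) (fe x)%:E)%E by exact: dens.
have cfe : continuous fe by apply: derivable_continuous => x; exact: (dfe x).1.
have cfe' : continuous (derive1 fe) by apply: derivable_continuous => x; exact: (dfe x).2.
have mfe : measurable_fun setT fe by exact: continuous_measurable_fun.
have fe0 x : 0 <= fe x.
  by apply: continuous_density_ge0 => // A mA; rewrite -mufe.
have mus2 : (\int[mu]_u (u ^+ 2)%:E <= (fine (\int[P]_w (eps 0 w ^+ 2)%:E))%:E)%E.
  rewrite -(@integral_law _ _ _ _ eps mu law 0 (fun u => (u ^+ 2)%:E)); first exact: fine_integral_le.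
  - by apply/measurable_EFinP; exact: measurable_funX.
  - by move=> x; rewrite lee_fin sqr_ge0.
have nfe := nice_of_derive feB (fun x => (dfe x).1) cfe' feM (fine_integral_le ife').
have ng := nice_scale (`|a 0|^-1) a0 nfe.
have cf : continuous f by apply: derivable_continuous => x; exact: (df x).1.
have fE n := density_marginal indep law mus2 cva a0 mfe fe0 mufe ng (fdens n) cf.
have inK : leb.-integrable setT (EFin \o (fun u => `|K u|)) by exact: (integrable_norm iK).
apply: (ae_entropy_rate indep law mus2 cva a0 mfe fe0 mufe ng _ fE (fun x => (df x).1) (fun x => (df x).2)
  _ fent iK _ (fine_integral_le inK) KM suppK _ h0 ga0 has cga chga).
- rewrite mulr_ge0 ?invr_ge0// mulr_ge0 ?sqr_ge0//.
  by apply/fine_ge0/integral_ge0 => x _; rewrite lee_fin sqr_ge0.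
- exact: fM.
- by rewrite /Rintegral K1.
- by rewrite /Rintegral Kodd.
Qed.

End reduction.

Theorem theorem1 (R : realType) (d : measure_display) (Omega : measurableType d)
  (P : probability Omega R)
  (eps : int -> {RV P >-> R}) (f_eps : R -> R)
  (a : nat -> R) (f : R -> R)
  (K : R -> R) (h gamma : nat -> R) :
  (* the innovations: iid, centered, finite variance, common density f_eps *)
  mutually_independent P (fun i => (eps i : Omega -> R)) ->
  (forall i, has_density P (eps i) f_eps) ->
  (forall i, P.-integrable setT (fun w => ((eps i w) ^+ 2)%:E)) ->
  (forall i, ('E_P[eps i] = 0)%E) ->
  (* coefficients: absolutely summable with nonzero sum (short memory) *)
  cvgn (series (fun i => `|a i|)) ->
  limn (series a) != 0 ->
  (* f is the common marginal density of X_n *)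
  (forall n : nat, has_density P (linear_process a (fun i => eps i) n) f) ->
  (* finite Shannon entropy *)
  lebesgue_measure.-integrable setT (fun x => (f x * ln (f x))%:E) ->
  (* kernel *)
  lebesgue_measure.-integrable setT (fun u => (K u)%:E) ->
  (\int[lebesgue_measure]_u (K u)%:E = 1)%E ->
  (* bandwidths *)
  (forall n, 0 < h n) ->
  (* (B.1) *)
  asymp h (fun n => (n%:R^-1 * ln n%:R) `^ (5^-1)) ->
  (* (K.1) *)
  bounded_real K ->
  (exists M : R, forall u, M < `|u| -> K u = 0) ->
  (exists iota : R, 0 < iota <= 1 /\
     exists C : R, forall x y, `|K x - K y| <= C * `|x - y| `^ iota) ->
  (* (K.2) *)
  (\int[lebesgue_measure]_u (u * K u)%:E = 0)%E ->
  (* (D.1) *)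
  (forall x, derivable f_eps x 1 /\ derivable (derive1 f_eps) x 1) ->
  bounded_real f_eps -> bounded_real (derive1 f_eps) -> bounded_real (derive1n 2 f_eps) ->
  (* (D.2) *)
  lebesgue_measure.-integrable setT (fun x => (f_eps x ^+ 2)%:E) ->
  lebesgue_measure.-integrable setT (fun x => ((derive1 f_eps) x ^+ 2)%:E) ->
  lebesgue_measure.-integrable setT (fun x => ((derive1n 2 f_eps) x ^+ 2)%:E) ->
  (* (D.3) *)
  (forall x, derivable f x 1 /\ derivable (derive1 f) x 1) ->
  bounded_real (derive1n 2 f) ->
  (* gamma_n *)
  (forall n, 0 < gamma n) ->
  gamma @ \oo --> 0 ->
  (fun n => h n / gamma n) @ \oo --> 0 ->
  {ae P, forall w,
    (limn_esup (fun n : nat =>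
       ((n%:R * gamma n ^+ 5 / ln n%:R) `^ (2 / 5))%:E *
       `| entropy_est K h gamma (linear_process a (fun i => eps i)) n w -
          \int[lebesgue_measure]_(x in An K h gamma
                 (linear_process a (fun i => eps i)) n w)
             (- ln (f x) * f x)%:E |) < +oo)%E}.
Proof.
move=> indep dens ieps2 _ cva suma fdens fent iK K1 h0 has KM suppK _ Kodd dfe feB feM _ _ ife' _ df fM ga0
  cga chga.
have exk : exists k, a k != 0.
  apply: contrapT => /forallNP ak; move/eqP: suma; apply.
  rewrite (_ : series a = fun=> 0); first exact: lim_cst.
  apply/funext => n; rewrite /series/= big1// => i _.
  by apply/eqP; apply/negPn/negP; exact: ak.
pose k := ex_minn exk.
have [ak0 ak] : a k != 0 /\ forall i, (i < k)%N -> a i = 0.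
  rewrite /k; case: ex_minnP => m am minm; split=> // i im.
  by apply/eqP; apply: contraLR im => ai; rewrite -leqNgt minm.
(* The density of the scaled innovation requires a nonzero leading coefficient. Dropping the [k]
   zero coefficients and delaying the innovations by [k] leaves the process unchanged. *)
pose a' i := a (i + k)%N; pose eps' (j : int) := eps (j - k%:Z).
have pE : linear_process a (fun i => eps i) = linear_process a' (fun i => eps' i).
  exact: (linear_process_shift (fun i => eps i : Omega -> R) ak).
rewrite pE; apply: (@ae_entropy_rate_leading _ _ _ P eps' f_eps a' f K h gamma) => //.
- exact: (mutually_independent_inj (subrK k%:Z) indep).
- by move=> i; exact: dens.
- exact: ieps2.
- rewrite /a' (@series_shift _ (fun i => `|a i|)); last by move=> i /ak ->; rewrite normr0.
  by move: cva; rewrite -(cvg_shiftn k) => /cvgP.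
- by move=> n; rewrite -pE; exact: fdens.
Qed.
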